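(* Let $k\ge 3$ be a fixed integer and let $\sigma$ be fixed with $\sigma_k^*<\sigma<1$. Then for every $\varepsilon>0$, $$R(k,\sigma;T)\ll_\varepsilon T^{\frac{2(1-\sigma)}{2-\sigma_k^*-\sigma}+\varepsilon}\qquad (T\to\infty).$$
   Context: $\zeta(s)$ is the Riemann zeta-function, $s=\sigma+it$. For $k\in\mathbb N$, $d_k(n)$ is the number of ways of writing $n$ as an ordered product of $k$ positive integer factors. Define $R(k,\sigma;T)$ by $$\int_1^T|\zeta(\sigma+it)|^{2k}\,dt=T\sum_{n=1}^\infty d_k^2(n)n^{-2\sigma}+R(k,\sigma;T).$$ $\sigma_k^*$ denotes the infimum of those $\sigma^*\ge\tfrac12$ for which $\int_1^T|\zeta(\sigma^*+it)|^{2k}\,dt\ll_\varepsilon T^{1+\varepsilon}$ holds for every $\varepsilon>0$. *)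

(* Defs.v *)
From mathcomp Require Import all_boot.
From Stdlib Require Import Reals.
From Coquelicot Require Import Coquelicot.

Open Scope R_scope.

(* [n^(-s)] for [n >= 1], i.e. [exp (- s log n)] with the real logarithm:
   modulus [n^(-Re s)] and argument [- Im s * log n]. *)
Definition nat_Cpow_opp (n : nat) (s : C) : C :=
  (Rpower (INR n) (- Re s) * cos (Im s * ln (INR n)),
   - (Rpower (INR n) (- Re s) * sin (Im s * ln (INR n)))).

Definition analytic_at (f : C -> C) (z0 : C) : Prop :=
  exists (a : nat -> C) (r : R), 0 < r /\
    forall z : C, Cmod (z - z0)%C < r ->
      is_pseries (K := C_AbsRing) (V := C_NormedModule) a (z - z0)%C (f z).

(* The Riemann zeta-function is the analytic continuation of its Dirichlet
   series from [Re s > 1] to [C \ {1}]. By the identity theorem this determines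
   [zeta] everywhere except at the pole [1], where its value is arbitrary. *)
Definition is_riemann_zeta (zeta : C -> C) : Prop :=
  (forall s : C, 1 < Re s ->
     is_series (K := C_AbsRing) (V := C_NormedModule)
       (fun n : nat => nat_Cpow_opp (S n) s) (zeta s)) /\
  (forall s : C, s <> RtoC 1 -> analytic_at zeta s).

(* For [n >= 1] every factor of [n] is a positive integer at most [n], so the
   functions ['I_k -> 'I_(n+1)] with product [n] are exactly the ordered
   factorizations of [n] into [k] positive factors. *)
Definition divisor_fun (k n : nat) : nat :=
  #|[set f : {ffun 'I_k -> 'I_n.+1} | (\prod_(i < k) (f i : nat))%N == n]|.

Definition zeta_moment (zeta : C -> C) (k : nat) (sigma T : R) : R :=
  RInt (fun t : R => Cmod (zeta (sigma, t)) ^ (2 * k)) 1 T.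

(* The term of index [n] is the one of the integer [n + 1]. *)
Definition mean_coeff (k : nat) (sigma : R) : R :=
  Series (fun n : nat =>
    INR (divisor_fun k (S n)) ^ 2 * Rpower (INR (S n)) (- (2 * sigma))).

Definition moment_error (zeta : C -> C) (k : nat) (sigma T : R) : R :=
  zeta_moment zeta k sigma T - T * mean_coeff k sigma.

(* [f(T) << g(T)] as [T -> +oo], for a nonnegative [g]. *)
Definition vinogradov (f g : R -> R) : Prop :=
  exists A : R, Rbar_locally p_infty (fun T : R => Rabs (f T) <= A * g T).

Definition moment_admissible (zeta : C -> C) (k : nat) (x : R) : Prop :=
  1 / 2 <= x /\
  forall eps : R, 0 < eps ->
    vinogradov (zeta_moment zeta k x) (fun T : R => Rpower T (1 + eps)).

(* The set is bounded below by [1/2], and it is nonempty because [zeta] is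
   bounded on each line [Re s = x] with [x > 1]; so its greatest lower bound in
   [Rbar] is finite and [real] returns it unchanged. *)
Definition sigma_star (zeta : C -> C) (k : nat) : R :=
  real (Glb_Rbar (moment_admissible zeta k)).

(* Main.v *)
(** Write [F = zeta ^ k] and fix an admissible [x0] slightly above the infimum
    [sigma_k^*], with [x0 < sigma].  Integrating
    [F (s + w) Y^w e^(w^2) / w] around the rectangle with vertical sides
    [Re w = x0 - sigma] and [Re w = 2] and height [H = log T] gives
    [2 pi F s = P s + E s], where [P] is a Dirichlet polynomial with coefficients
    [d_k(n) W(n)] and smooth weights [W(n)] close to [2 pi] for [n <= Y] and small
    for [n > Y], and [E] is essentially the integral over the left side.  The
    moment hypothesis on [Re s = x0] bounds the mean square of [E] by
    [T^(1+eps) Y^(-2 (sigma - x0))]; expanding the square, the mean square of [P]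
    is its diagonal part plus [O(Y^(2 - 2 sigma + eps))].  The cross term is
    estimated by the inequality of arithmetic and geometric means, and
    [Y = T^(1 / (2 - x0 - sigma))] balances the two errors.

    Working with finite rectangles keeps every integral proper and stays away
    from the pole; the only growth estimate needed on the horizontal sides is
    [zeta s = O(|s|)], obtained from the Euler-Maclaurin formula, which is
    continued across [Re s = 1] by the same kind of contour integral. *)
From HB Require Import structures.
From mathcomp Require Import all_boot.
From Stdlib Require Import Reals Lra Lia ClassicalEpsilon.
From Coquelicot Require Import Coquelicot.
Require Import Defs.

Open Scope R_scope.

Local Notation is_seriesC := (is_series (K := C_AbsRing) (V := C_NormedModule)).
Local Notation continuousD := (continuous_plus (K := R_AbsRing) (V := R_NormedModule)).
Local Notation continuousM := (continuous_mult (K := R_AbsRing)).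
Local Notation derive_continuous := (ex_derive_continuous (V := R_NormedModule)).
Local Notation RInt_correctR := (RInt_correct (V := R_CompleteNormedModule)).
Local Notation ex_RInt_contR := (ex_RInt_continuous (V := R_CompleteNormedModule)).
Local Notation is_RInt_deriveR := (is_RInt_derive (V := R_CompleteNormedModule)).
Local Notation by_lra := ltac:(lra) (only parsing).

Reserved Notation "\sumR_ ( i < n ) F" (at level 36, F at level 36, i, n at level 50,
  format "'[' \sumR_ ( i  <  n ) '/  '  F ']'").
Reserved Notation "\sumC_ ( i < n ) F" (at level 36, F at level 36, i, n at level 50,
  format "'[' \sumC_ ( i  <  n ) '/  '  F ']'").
Notation "\sumR_ ( i < n ) F" := (\big[Rplus/0]_(i < n) F) : R_scope.
Notation "\sumC_ ( i < n ) F" := (\big[Cplus/RtoC 0]_(i < n) F) : R_scope.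
Notation "\sumC_ ( i < n ) F" := (\big[Cplus/RtoC 0]_(i < n) F) : C_scope.

(** What shapes the estimates is that nothing may depend on the length of [P]: it arises from the
    [k]-th power of a partial sum of zeta with [M] terms, has length [M ^ k], and [M] depends on [T]
    without any explicit control. The weight therefore does more than cut at [Y]: it forces
    coefficients of size [Y^(1 - sigma + 2 d) n^(- 1 - d)] up to powers of [H], so that the
    off-diagonal double sum, weighted by [1 / |log (m / n)|], converges absolutely and costs
    [Y^(2 - 2 sigma + 4 d)]. The factor [e^(w^2)] makes the horizontal sides of order [e^(- H^2)]
    times powers of [T]; at [H = log T] this beats every power of [T], while each [H] in a bound
    costs only a logarithm. With the parameter [Y^(- (sigma - x0))] in the arithmetic-geometric mean
    inequality, both halves of the cross term are [T^(1 + eps) Y^(- (sigma - x0))]; equating this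
    with [Y^(2 - 2 sigma)] gives the exponent. Cauchy's formula is needed only for a simple pole at
    the origin inside a rectangle. It is proved by dilating the contour, which requires a continuous
    derivative; this is why differentiability is stated with a locally uniform error. *)

(** * The complex exponential *)

Definition cexp (z : C) : C := (exp (Re z) * cos (Im z), exp (Re z) * sin (Im z)).

Lemma exp_ge0 (x : R) : 0 <= exp x.
Proof. by left; apply: exp_pos. Qed.

Lemma C_ext (z w : C) : Re z = Re w -> Im z = Im w -> z = w.
Proof. by case: z w => a b [c d] /= -> ->. Qed.

Lemma cexp_plus (z w : C) : cexp (z + w) = (cexp z * cexp w)%C.
Proof.
  apply: C_ext; rewrite /cexp /= /Re /Im /= exp_plus ?cos_plus ?sin_plus; ring.
Qed.

Lemma Cmod_cexp (z : C) : Cmod (cexp z) = exp (Re z).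
Proof.
  have He := exp_pos (Re z).
  rewrite /cexp /Cmod /= -{5}(sqrt_Rsqr (exp (Re z))); last lra.
  congr sqrt; have := sin2_cos2 (Im z); rewrite /Rsqr => H.
  transitivity (exp (Re z) * exp (Re z) *
    (sin (Im z) * sin (Im z) + cos (Im z) * cos (Im z))); first ring.
  by rewrite H; ring.
Qed.

Lemma cexp_0 : cexp 0 = 1.
Proof. by apply: C_ext; rewrite /cexp /Re /Im /= exp_0 ?cos_0 ?sin_0; ring. Qed.

Lemma im_le_Cmod (z : C) : Rabs (Im z) <= Cmod z.
Proof. by apply: Rle_trans (Rmax_Cmod z); apply: Rmax_r. Qed.

Lemma Cmod_le_sum (z : C) : Cmod z <= Rabs (Re z) + Rabs (Im z).
Proof.
  have {1}-> : z = (RtoC (Re z) + Ci * RtoC (Im z))%C.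
    by apply: C_ext; rewrite /Re /Im /=; ring.
  apply: Rle_trans (Cmod_triangle _ _) _.
  rewrite Cmod_mult Cmod_Ci !Cmod_R; lra.
Qed.

Lemma exp_le (x y : R) : x <= y -> exp x <= exp y.
Proof. by case=> [/exp_increasing|->]; [left | right]. Qed.

Lemma Cmod_minus_le (x y : C) : Cmod (x - y) <= Cmod x + Cmod y.
Proof. by have := Cmod_triangle x (- y)%C; rewrite Cmod_opp. Qed.

Lemma Cmod_div_le (z w : C) (B r : R) : 0 < r -> r <= Cmod w -> Cmod z <= B ->
  Cmod (z / w) <= B / r.
Proof.
  move=> Hr Hw Hz; rewrite Cmod_div; last by apply/Cmod_gt_0; lra.
  apply: Rmult_le_compat => //; first exact: Cmod_ge_0.
    by left; apply: Rinv_pos; lra.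
  exact: Rinv_le_contravar.
Qed.

Lemma mean_value (f df : R -> R) (a b : R) :
  (forall x, Rmin a b <= x <= Rmax a b -> is_derive f x (df x)) ->
  exists c, Rmin a b <= c <= Rmax a b /\ f b - f a = df c * (b - a).
Proof.
  move=> H; apply: MVT_gen => x Hx; first by apply: H; lra.
  by apply: derivable_continuous_pt; exists (df x); apply/is_derive_Reals; apply: H.
Qed.

(** The upper bound comes from [exp (- a) >= 1 - a], that is [exp a * (1 - a) <= 1], combined with
    [1 - a >= 1 / 2]. *)
Lemma exp_bound2 (a : R) : Rabs a <= 1 / 2 -> 0 <= exp a - 1 - a <= 2 * a ^ 2.
Proof.
  move=> /Rabs_le_between Ha.
  have H1 := exp_ineq1_le a.
  have H2 := exp_ineq1_le (- a).
  have Hp := exp_pos a.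
  have H3 : exp a * exp (- a) = 1 by rewrite -exp_plus Rplus_opp_r exp_0.
  have H4 : exp a * (1 - a) <= 1 by nra.
  split; first lra.
  apply: (Rmult_le_reg_r (1 - a)); first lra.
  nra.
Qed.

Lemma Rabs_sin_le (b : R) : Rabs (sin b) <= Rabs b.
Proof.
  have [c [H2 H1]] := mean_value sin cos 0 b (fun x _ => ltac:(auto_derive; [done | ring])).
  rewrite sin_0 !Rminus_0_r in H1; rewrite H1 Rabs_mult.
  have Hc : Rabs (cos c) <= 1 by apply/Rabs_le_between; apply: COS_bound.
  have := Rabs_pos b; nra.
Qed.

Lemma cos_bound2 (b : R) : Rabs (cos b - 1) <= b ^ 2 / 2.
Proof.
  have Hs := Rabs_sin_le (b / 2).
  have Hc : cos b - 1 = - (2 * (sin (b / 2)) ^ 2).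
    have -> : b = 2 * (b / 2) by field.
    rewrite cos_2a_sin; have -> : 2 * (b / 2) / 2 = b / 2 by field.
    ring.
  rewrite Hc Rabs_Ropp Rabs_pos_eq; last nra.
  have := pow_maj_Rabs _ _ 2 Hs; rewrite pow2_abs; lra.
Qed.

Lemma sin_bound2 (b : R) : Rabs b <= 1 -> Rabs (sin b - b) <= b ^ 2.
Proof.
  move=> Hb.
  have [c [Hc2 Hc1]] := mean_value (fun x => sin x - x) (fun x => cos x - 1) 0 b
    (fun x _ => ltac:(auto_derive; [done | ring])).
  rewrite sin_0 in Hc1; have -> : sin b - b = (cos c - 1) * b by lra.
  rewrite Rabs_mult -(pow2_abs b).
  have := cos_bound2 c.
  have Hcb : Rabs c <= Rabs b.
    move: Hc2; rewrite /Rmin /Rmax; case: Rle_dec => ? ?; rewrite /Rabs;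
    case: Rcase_abs; case: Rcase_abs; lra.
  have := pow_maj_Rabs _ _ 2 Hcb; rewrite pow2_abs => ? ?.
  have := Rabs_pos b; have := Rabs_pos c; nra.
Qed.

(** With [h = a + i b], the real part of the remainder is at most [2 a^2 + b^2] and the imaginary
    part at most [2 a^2 + 3 b^2], which explains the constant 4. *)
Lemma cexp_taylor (h : C) : Cmod h <= 1 / 2 ->
  Cmod (cexp h - 1 - h) <= 4 * Cmod h ^ 2.
Proof.
  move=> Hh; have := re_le_Cmod h; have := im_le_Cmod h.
  rewrite Cmod2_alt.
  set a := Re h; set b := Im h => Hb Ha.
  apply: Rle_trans (Cmod_le_sum _) _.
  have -> : Re (cexp h - 1 - h) = (exp a - 1 - a) + exp a * (cos b - 1).
    by rewrite /cexp /a /b /Re /Im /=; ring.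
  have -> : Im (cexp h - 1 - h) = (exp a - 1) * sin b + (sin b - b).
    by rewrite /cexp /a /b /Re /Im /=; ring.
  have Ha2 : Rabs a <= 1 / 2 by lra.
  have Hb2 : Rabs b <= 1 by lra.
  have [E1 E2] := exp_bound2 a Ha2.
  have C1 := cos_bound2 b; have S1 := sin_bound2 b Hb2.
  move: (Ha2); rewrite Rabs_le_between => A.
  have X1 : Rabs (exp a - 1 - a + exp a * (cos b - 1)) <= 2 * a ^ 2 + b ^ 2.
    apply: Rle_trans (Rabs_triang _ _) _.
    rewrite (Rabs_pos_eq (exp a - 1 - a)) // Rabs_mult (Rabs_pos_eq (exp a)); last exact: exp_ge0.
    have E3 : exp a <= 2 by nra.
    have := Rabs_pos (cos b - 1); have := exp_pos a; nra.
  have X2 : Rabs (exp a - 1) <= 2 * Rabs a.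
    have -> : exp a - 1 = (exp a - 1 - a) + a by ring.
    apply: Rle_trans (Rabs_triang _ _) _; rewrite (Rabs_pos_eq (exp a - 1 - a)) //.
    move: E2; rewrite -(pow2_abs a); have := Rabs_pos a; nra.
  have X3 : Rabs (sin b) <= 2 * Rabs b.
    have -> : sin b = (sin b - b) + b by ring.
    apply: Rle_trans (Rabs_triang _ _) _; rewrite -(pow2_abs b) in S1.
    have := Rabs_pos b; nra.
  have X4 : Rabs ((exp a - 1) * sin b + (sin b - b)) <= 2 * a ^ 2 + 3 * b ^ 2.
    apply: Rle_trans (Rabs_triang _ _) _; rewrite Rabs_mult.
    have H4 : Rabs (exp a - 1) * Rabs (sin b) <= (2 * Rabs a) * (2 * Rabs b).
      by apply: Rmult_le_compat => //; apply: Rabs_pos.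
    have := pow2_ge_0 (Rabs a - Rabs b).
    move: H4 S1; rewrite -(pow2_abs b) -(pow2_abs a); lra.
  nra.
Qed.

(** * Complex differentiability *)

(* Complex differentiability with a locally uniform quadratic error term; the
   uniformity makes the derivative continuous. *)
Definition holo (f : C -> C) (z0 : C) : Prop :=
  exists (rho K : R) (g : C -> C), 0 < rho /\ 0 < K /\
    forall y z : C, Cmod (y - z0) < rho -> Cmod (z - z0) < rho ->
      Cmod (f z - f y - g y * (z - y)) <= K * Cmod (z - y) ^ 2.

(** Adding the error estimates based at [y] and at [z] cancels the values of [f] and leaves
    [(g z - g y) * (z - y)], so the derivative [g] is Lipschitz. Collecting all bounds under one
    constant makes the closure properties below short. *)
Lemma holo_bounds (f : C -> C) (z0 : C) : holo f z0 ->
  exists (rho K : R) (g : C -> C), 0 < rho /\ 0 < K /\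
    forall y z : C, Cmod (y - z0) < rho -> Cmod (z - z0) < rho ->
      [/\ Cmod (f z - f y - g y * (z - y)) <= K * Cmod (z - y) ^ 2,
          Cmod (f z - f y) <= K * Cmod (z - y),
          Cmod (g z - g y) <= K * Cmod (z - y), Cmod (f y) <= K & Cmod (g y) <= K].
Proof.
  move=> [rho [K [g [Hr [HK H]]]]].
  (* A radius of at most 1 keeps [|z - y| <= 2], so that quadratic errors can be absorbed into
     linear ones. *)
  pose r1 := Rmin rho 1.
  have Hr1 : 0 < r1 by apply: Rmin_pos; lra.
  have Hr1a : r1 <= rho by apply: Rmin_l.
  have Hr1b : r1 <= 1 by apply: Rmin_r.
  have Hdist y z : Cmod (y - z0) < r1 -> Cmod (z - z0) < r1 -> Cmod (z - y) <= 2.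
    move=> Hy Hz; have -> : (z - y = (z - z0) - (y - z0))%C by ring.
    apply: Rle_trans (Cmod_minus_le _ _) _; lra.
  have Hz0 : Cmod (z0 - z0) < r1.
    have -> : (z0 - z0 = 0)%C by ring.
    by rewrite Cmod_0.
  have Hg y z : Cmod (y - z0) < r1 -> Cmod (z - z0) < r1 ->
      Cmod (g z - g y) <= 2 * K * Cmod (z - y).
    move=> Hy Hz.
    have [E|E] := Ceq_dec z y.
      rewrite E; have -> : (g y - g y = 0)%C by ring.
      have -> : (y - y = 0)%C by ring.
      by rewrite Cmod_0; lra.
    have Hp : 0 < Cmod (z - y).
      apply/Cmod_gt_0 => E2; apply: E.
      have -> : (z = (z - y) + y)%C by ring.
      by rewrite E2; ring.
    apply: (Rmult_le_reg_r (Cmod (z - y))) => //.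
    rewrite -Cmod_mult.
    have -> : ((g z - g y) * (z - y) = (f z - f y - g y * (z - y)) +
       (f y - f z - g z * (y - z)))%C by ring.
    apply: Rle_trans (Cmod_triangle _ _) _.
    have H1 := H y z by_lra by_lra.
    have H2 := H z y by_lra by_lra.
    have E3 : Cmod (y - z) = Cmod (z - y).
      by rewrite -Cmod_opp; congr Cmod; ring.
    rewrite E3 in H2; lra.
  have Hgb y : Cmod (y - z0) < r1 -> Cmod (g y) <= Cmod (g z0) + 2 * K.
    move=> Hy; have -> : (g y = g z0 + (g y - g z0))%C by ring.
    apply: Rle_trans (Cmod_triangle _ _) _.
    have := Hg z0 y Hz0 Hy; nra.
  have Hf y z : Cmod (y - z0) < r1 -> Cmod (z - z0) < r1 ->
      Cmod (f z - f y) <= (Cmod (g z0) + 4 * K) * Cmod (z - y).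
    move=> Hy Hz.
    have -> : (f z - f y = (f z - f y - g y * (z - y)) + g y * (z - y))%C by ring.
    apply: Rle_trans (Cmod_triangle _ _) _; rewrite Cmod_mult.
    have := H y z by_lra by_lra; have := Hgb y Hy; have := Hdist y z Hy Hz.
    have := Cmod_ge_0 (z - y); set m := Cmod (z - y) => Hm Hm2 Hg1 Hq.
    have : m * m <= 2 * m by apply: Rmult_le_compat_r.
    have : Cmod (g y) * m <= (Cmod (g z0) + 2 * K) * m by apply: Rmult_le_compat_r.
    nra.
  have HG := Cmod_ge_0 (g z0); have HF := Cmod_ge_0 (f z0).
  exists r1, (Cmod (g z0) + Cmod (f z0) + Cmod (g z0) + 4 * K), g; split => //.
  split; first lra.
  move=> y z Hy Hz; have Hm := Cmod_ge_0 (z - y); split.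
  - apply: Rle_trans (H y z by_lra by_lra) _.
    by apply: Rmult_le_compat_r; [apply: pow2_ge_0 | lra].
  - by apply: Rle_trans (Hf y z Hy Hz) _; apply: Rmult_le_compat_r; lra.
  - by apply: Rle_trans (Hg y z Hy Hz) _; apply: Rmult_le_compat_r; lra.
  - have -> : (f y = f z0 + (f y - f z0))%C by ring.
    apply: Rle_trans (Cmod_triangle _ _) _.
    have := Hf z0 y Hz0 Hy; have : Cmod (y - z0) <= 1 by lra.
    have := Cmod_ge_0 (y - z0); nra.
  - have := Hgb y Hy; lra.
Qed.

Lemma holo_const (c z0 : C) : holo (fun _ => c) z0.
Proof.
  exists 1, 1, (fun _ => RtoC 0); split; first lra.
  split; first lra.
  move=> y z _ _; have -> : (c - c - 0 * (z - y) = 0)%C by ring.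
  rewrite Cmod_0; have := Cmod_ge_0 (z - y); nra.
Qed.

Lemma holo_id (z0 : C) : holo (fun z => z) z0.
Proof.
  exists 1, 1, (fun _ => RtoC 1); split; first lra.
  split; first lra.
  move=> y z _ _; have -> : (z - y - 1 * (z - y) = 0)%C by ring.
  rewrite Cmod_0; have := Cmod_ge_0 (z - y); nra.
Qed.

Lemma holo_plus (f1 f2 : C -> C) (z0 : C) :
  holo f1 z0 -> holo f2 z0 -> holo (fun z => f1 z + f2 z)%C z0.
Proof.
  move=> [r1 [K1 [g1 [Hr1 [HK1 H1]]]]] [r2 [K2 [g2 [Hr2 [HK2 H2]]]]].
  exists (Rmin r1 r2), (K1 + K2), (fun z => g1 z + g2 z)%C.
  split; first by apply: Rmin_pos.
  split; first lra.
  move=> y z Hy Hz; have Hl := Rmin_l r1 r2; have Hr := Rmin_r r1 r2.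
  have -> : (f1 z + f2 z - (f1 y + f2 y) - (g1 y + g2 y) * (z - y) =
    (f1 z - f1 y - g1 y * (z - y)) + (f2 z - f2 y - g2 y * (z - y)))%C by ring.
  apply: Rle_trans (Cmod_triangle _ _) _.
  have := H1 y z by_lra by_lra; have := H2 y z by_lra by_lra; lra.
Qed.

Lemma holo_mult (f1 f2 : C -> C) (z0 : C) :
  holo f1 z0 -> holo f2 z0 -> holo (fun z => f1 z * f2 z)%C z0.
Proof.
  move=> /holo_bounds [r1 [K1 [g1 [Hr1 [HK1 H1]]]]].
  move=> /holo_bounds [r2 [K2 [g2 [Hr2 [HK2 H2]]]]].
  exists (Rmin r1 r2), (3 * K1 * K2), (fun z => g1 z * f2 z + f1 z * g2 z)%C.
  split; first by apply: Rmin_pos.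
  split; first nra.
  move=> y z Hy Hz; have Hl := Rmin_l r1 r2; have Hr := Rmin_r r1 r2.
  have -> : (f1 z * f2 z - f1 y * f2 y - (g1 y * f2 y + f1 y * g2 y) * (z - y) =
    (f1 z - f1 y - g1 y * (z - y)) * f2 z + g1 y * (z - y) * (f2 z - f2 y) +
    f1 y * (f2 z - f2 y - g2 y * (z - y)))%C by ring.
  apply: Rle_trans (Cmod_triangle _ _) _.
  apply: Rle_trans (Rplus_le_compat_r _ _ _ (Cmod_triangle _ _)) _.
  rewrite !Cmod_mult.
  have [A1 A2 _ A3 A4] := H1 y z by_lra by_lra.
  have [B1 B2 _ B3 B4] := H2 y z by_lra by_lra.
  have [_ _ _ B5 _] := H2 z y by_lra by_lra.
  set m := Cmod (z - y) in A1 A2 B1 B2 *.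
  have Hm : 0 <= m by exact: Cmod_ge_0.
  have X1 : Cmod (f1 z - f1 y - g1 y * (z - y)) * Cmod (f2 z) <= (K1 * m ^ 2) * K2.
    by apply: Rmult_le_compat => //; apply: Cmod_ge_0.
  have X2 : Cmod (g1 y) * m * Cmod (f2 z - f2 y) <= (K1 * m) * (K2 * m).
    apply: Rmult_le_compat => //; last by apply: Rmult_le_compat_r.
      by apply: Rmult_le_pos => //; apply: Cmod_ge_0.
    exact: Cmod_ge_0.
  have X3 : Cmod (f1 y) * Cmod (f2 z - f2 y - g2 y * (z - y)) <= K1 * (K2 * m ^ 2).
    by apply: Rmult_le_compat => //; apply: Cmod_ge_0.
  lra.
Qed.

Lemma holo_cexp (f : C -> C) (z0 : C) : holo f z0 -> holo (fun z => cexp (f z)) z0.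
Proof.
  move=> /holo_bounds [r1 [K [g [Hr1 [HK H]]]]].
  (* Within radius [/ (4 * K)] one has [|z - y| <= / (2 * K)], so the increment of [f] is at most
     1/2, the range in which [cexp_taylor] applies. *)
  exists (Rmin r1 (/ (4 * K))), (exp K * (4 * K ^ 2 + K)), (fun z => cexp (f z) * g z)%C.
  have HK4 : 0 < / (4 * K) by apply: Rinv_pos; lra.
  split; first by apply: Rmin_pos.
  have He := exp_pos K; split; first nra.
  move=> y z Hy Hz; have Hl := Rmin_l r1 (/ (4 * K)); have Hr := Rmin_r r1 (/ (4 * K)).
  have [A1 A2 _ A3 A4] := H y z by_lra by_lra.
  have Hm : Cmod (z - y) <= / (2 * K).
    have -> : (z - y = (z - z0) - (y - z0))%C by ring.
    apply: Rle_trans (Cmod_minus_le _ _) _.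
    have -> : / (2 * K) = / (4 * K) + / (4 * K) by field; lra.
    lra.
  set u := (f z - f y)%C in A1 A2 *.
  have Hu : Cmod u <= 1 / 2.
    apply: Rle_trans A2 _; have -> : 1 / 2 = K * / (2 * K) by field; lra.
    by apply: Rmult_le_compat_l; lra.
  have -> : cexp (f z) = (cexp (f y) * cexp u)%C.
    by rewrite -cexp_plus; congr cexp; rewrite /u; ring.
  have -> : (cexp (f y) * cexp u - cexp (f y) - cexp (f y) * g y * (z - y) =
     cexp (f y) * ((cexp u - 1 - u) + (u - g y * (z - y))))%C by ring.
  rewrite Cmod_mult Cmod_cexp Rmult_assoc.
  apply: Rmult_le_compat => //; first exact: exp_ge0.
  - exact: Cmod_ge_0.
  - apply: exp_le.
    by apply: Rle_trans A3; apply: Rle_trans (re_le_Cmod _); apply: Rle_abs.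
  - apply: Rle_trans (Cmod_triangle _ _) _.
    have := cexp_taylor u Hu; have := Cmod_ge_0 u; have := Cmod_ge_0 (z - y).
    move=> *; have : Cmod u ^ 2 <= (K * Cmod (z - y)) ^ 2 by apply: pow_incr.
    lra.
Qed.

(** The remainder is exactly [(z - y)^2 / (z y^2)], and on the disc of radius [m / 2] each of the
    three factors of the denominator has modulus at least [m / 2]. *)
Lemma holo_inv (z0 : C) : z0 <> 0 -> holo (fun z => / z)%C z0.
Proof.
  move=> /Cmod_gt_0; set m := Cmod z0 => Hm.
  exists (m / 2), (8 / m ^ 3), (fun z => - / (z * z))%C.
  split; first lra.
  split; first by apply: Rdiv_pos_pos; [lra | apply: pow_lt].
  have Hb z : Cmod (z - z0) < m / 2 -> m / 2 <= Cmod z.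
    move=> Hz; have : m <= Cmod z + Cmod (z - z0).
      rewrite /m; have -> : (z0 = z - (z - z0))%C by ring.
      have -> : (z - (z - (z - z0)) = z - z0)%C by ring.
      exact: Cmod_minus_le.
    lra.
  move=> y z /Hb Hy /Hb Hz.
  have Ny : y <> 0 by apply/Cmod_gt_0; lra.
  have Nz : z <> 0 by apply/Cmod_gt_0; lra.
  have -> : (/ z - / y - - / (y * y) * (z - y) = (z - y) * (z - y) * / (z * y * y))%C.
    by field.
  rewrite !Cmod_mult Cmod_inv; last first.
    by apply: Cmult_neq_0 => //; apply: Cmult_neq_0.
  rewrite !Cmod_mult.
  have -> : 8 / m ^ 3 * Cmod (z - y) ^ 2 =
     Cmod (z - y) * Cmod (z - y) * / ((m / 2) * (m / 2) * (m / 2)) by field; lra.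
  apply: Rmult_le_compat_l; first by apply: Rmult_le_pos; apply: Cmod_ge_0.
  apply: Rinv_le_contravar; first by apply: Rmult_lt_0_compat; nra.
  by apply: Rmult_le_compat => //; nra.
Qed.

Lemma holo_shift (f : C -> C) (s w : C) :
  holo f (s + w)%C -> holo (fun w => f (s + w)%C) w.
Proof.
  move=> [r [K [g [Hr [HK H]]]]]; exists r, K, (fun w => g (s + w)%C).
  do 2 split => //; move=> y z Hy Hz.
  have E a b : ((s + a) - (s + b) = a - b)%C by ring.
  have := H (s + y)%C (s + z)%C; rewrite !E; exact.
Qed.

Lemma holo_opp (f : C -> C) (z0 : C) : holo f z0 -> holo (fun z => - f z)%C z0.
Proof.
  move=> [r [K [g [Hr [HK H]]]]]; exists r, K, (fun w => - g w)%C.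
  do 2 split => //; move=> y z Hy Hz.
  have -> : (- f z - - f y - - g y * (z - y) = - (f z - f y - g y * (z - y)))%C by ring.
  by rewrite Cmod_opp; apply: H.
Qed.

Lemma holo_pow (f : C -> C) (z0 : C) (n : nat) :
  holo f z0 -> holo (fun z => f z ^ n)%C z0.
Proof.
  move=> Hf; elim: n => [|n IH] /=; first by apply: holo_const.
  exact: holo_mult.
Qed.

(** * Complex series, and holomorphy of analytic functions *)

Lemma is_series_C_lim (u : nat -> C) (l : C) :
  is_seriesC u l ->
  forall eps : R, 0 < eps -> exists N : nat, forall n : nat, (N <= n)%coq_nat ->
    Cmod (sum_n u n - l) < eps.
Proof.
  move=> Hu eps He.
  have := proj1 (filterlim_locally_ball_norm (K := C_AbsRing) (U := C_NormedModule)
    (sum_n u) l) Hu (mkposreal eps He).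
  by move=> [N HN]; exists N => n Hn; apply: HN.
Qed.

Lemma Cmod_sum_n_le (u : nat -> C) (b : nat -> R) (N : nat) :
  (forall n, Cmod (u n) <= b n) -> Cmod (sum_n u N) <= sum_n b N.
Proof.
  move=> H; elim: N => [|N IH]; first by rewrite !sum_O.
  rewrite !sum_Sn; apply: Rle_trans (Cmod_triangle _ _) _.
  by apply: Rplus_le_compat.
Qed.

Lemma sum_n_le_is_series (b : nat -> R) (B : R) (N : nat) :
  (forall n, 0 <= b n) -> is_series b B -> sum_n b N <= B.
Proof.
  move=> Hb HB.
  apply: (is_lim_seq_incr_compare (sum_n b) B HB) => n.
  by rewrite sum_Sn; have := Hb n.+1; rewrite /plus /=; lra.
Qed.

Lemma is_series_Cmod_le (u : nat -> C) (l : C) (b : nat -> R) (B : R) :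
  is_seriesC u l ->
  (forall n, Cmod (u n) <= b n) -> is_series b B -> Cmod l <= B.
Proof.
  move=> Hu Hb HB; apply: le_epsilon => eps He.
  have [N HN] := is_series_C_lim u l Hu eps He.
  have -> : (l = sum_n u N - (sum_n u N - l))%C by ring.
  apply: Rle_trans (Cmod_minus_le _ _) _.
  have := HN N (le_n N); have := Cmod_sum_n_le u b N Hb.
  have Hb0 n : 0 <= b n by apply: Rle_trans (Hb n); apply: Cmod_ge_0.
  have := sum_n_le_is_series b B N Hb0 HB; lra.
Qed.

Lemma is_series_tail (u : nat -> C) (l : C) :
  is_seriesC u l ->
  is_seriesC (fun k => u k.+1) (l - u O)%C.
Proof.
  move=> H; apply: is_series_incr_1.
  by have -> : plus (l - u O : C_NormedModule)%C (u O) = l by rewrite /plus /=; ring.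
Qed.

Lemma pow_n_Cpow (x : C) (n : nat) : pow_n (K := C_AbsRing) x n = (x ^ n)%C.
Proof. by elim: n => [|n IH] //=; rewrite IH. Qed.

(** The natural bound carries [rho ^ (n - 1)]. Multiplying by [rho] avoids the exponent [-1] at
    [n = 0] as well as a division by a possibly vanishing [rho]. *)
Lemma Cpow_taylor (y z : C) (rho : R) (n : nat) :
  Cmod y <= rho -> Cmod z <= rho ->
  rho * Cmod (z ^ n.+1 - y ^ n.+1 - INR n.+1 * y ^ n * (z - y)) <=
    (INR n.+1) ^ 2 * rho ^ n * Cmod (z - y) ^ 2.
Proof.
  move=> Hy Hz; have Hr : 0 <= rho by apply: Rle_trans Hy; apply: Cmod_ge_0.
  have Hh := pow2_ge_0 (Cmod (z - y)).
  elim: n => [|n IH].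
    have -> : (z ^ 1 - y ^ 1 - INR 1 * y ^ 0 * (z - y) = 0)%C.
      by rewrite /=; ring.
    by rewrite Cmod_0 Rmult_0_r /=; nra.
  have -> : (z ^ n.+2 - y ^ n.+2 - INR n.+2 * y ^ n.+1 * (z - y) =
    z * (z ^ n.+1 - y ^ n.+1 - INR n.+1 * y ^ n * (z - y)) +
    INR n.+1 * y ^ n * ((z - y) * (z - y)))%C.
    rewrite (S_INR n.+1) RtoC_plus; simpl Cpow; ring.
  have Hn := pos_INR n.+1.
  have Hp := pow_le _ n Hr.
  have Hyn : Cmod (y ^ n) <= rho ^ n.
    by rewrite Cmod_pow; apply: pow_incr; split; [apply: Cmod_ge_0 |].
  apply: Rle_trans (Rmult_le_compat_l _ _ _ Hr (Cmod_triangle _ _)) _.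
  rewrite !Cmod_mult Cmod_R (Rabs_pos_eq _ Hn).
  move: IH Hh; set D := Cmod (_ - _ - _); have : 0 <= D by exact: Cmod_ge_0.
  set h := Cmod (z - y); move=> HD IH Hh.
  have X1 : rho * (Cmod z * D) <= rho * (INR n.+1 ^ 2 * rho ^ n * h ^ 2).
    apply: Rle_trans (_ : rho * (rho * D) <= _); last by apply: Rmult_le_compat_l.
    by apply: Rmult_le_compat_l => //; apply: Rmult_le_compat_r.
  have X2 : rho * (INR n.+1 * Cmod (y ^ n) * (h * h)) <= rho * (INR n.+1 * rho ^ n * h ^ 2).
    apply: Rmult_le_compat_l => //; have -> : h * h = h ^ 2 by ring.
    by apply: Rmult_le_compat_r => //; apply: Rmult_le_compat_l.
  have X3 : 0 <= rho * rho ^ n * h ^ 2 * (INR n.+1 + 1).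
    by repeat apply: Rmult_le_pos => //; lra.
  rewrite (S_INR n.+1).
  have -> : (INR n.+1 + 1) ^ 2 * rho ^ n.+1 * h ^ 2 = rho * (INR n.+1 ^ 2 * rho ^ n * h ^ 2) +
    rho * (INR n.+1 * rho ^ n * h ^ 2) + rho * rho ^ n * h ^ 2 * (INR n.+1 + 1).
    by rewrite [rho ^ n.+1]/=; ring.
  lra.
Qed.

(** Convergence at distance [q] bounds [|a n| q^n]. On the much smaller disc of radius [rho = q / 8]
    the Taylor remainders of the single terms are dominated by a geometric series:
    [(n + 1)^2 <= 4^n] still leaves the ratio [4 / 8]. *)
Lemma analytic_at_holo (f : C -> C) (z0 : C) : analytic_at f z0 -> holo f z0.
Proof.
  move=> [a [r [Hr Hf]]].
  pose q := r / 2; pose rho := q / 8.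
  have [M HM] : exists M, forall n, Cmod (a n) * q ^ n <= M.
    have Hz : Cmod (z0 + q - z0) < r.
      have -> : (z0 + q - z0 = q)%C by ring.
      by rewrite Cmod_R Rabs_pos_eq /q; lra.
    have [M HM] := filterlim_bounded (K := C_AbsRing) (V := C_NormedModule) _
      (ex_intro _ _ (Hf _ Hz)).
    (* The bound available is on partial sums; a term is the difference of two consecutive ones. *)
    exists (2 * M) => n.
    have -> : Cmod (a n) * q ^ n =
      Cmod (scal (pow_n (K := C_AbsRing) (z0 + q - z0)%C n) (a n : C_NormedModule)).
      have -> : (z0 + q - z0 = q)%C by ring.
      rewrite pow_n_Cpow /scal /= /mult /= Cmod_mult Cmod_pow Cmod_R Rabs_pos_eq.
        by rewrite Rmult_comm.
      by rewrite /q; lra.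
    move: HM; set u := (fun k => scal _ _); rewrite -/(u n) => HM.
    have {}HM : forall n, Cmod (sum_n u n) <= M := HM.
    have H0 : 0 <= M := Rle_trans _ _ _ (Cmod_ge_0 _) (HM O).
    case: n => [|n].
      by have := HM O; rewrite sum_O; lra.
    have E : u n.+1 = (sum_n u n.+1 - sum_n u n)%C.
      rewrite sum_Sn; have Hxy (x y : C) : (y = x + y - x)%C by ring.
      exact: Hxy.
    rewrite E; apply: Rle_trans (Cmod_minus_le _ _) _.
    by have := HM n.+1; have := HM n; lra.
  have Hq : 0 < q by rewrite /q; lra.
  have Hrho : 0 < rho by rewrite /rho; lra.
  have HM0 : 0 <= M.
    by apply: Rle_trans (HM O); rewrite /= Rmult_1_r; apply: Cmod_ge_0.
  have Hn1 (n : nat) : 1 <= INR n.+1 by rewrite S_INR; have := pos_INR n; lra.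
  have Hn4 (n : nat) : INR n.+1 ^ 2 <= 4 ^ n.
    elim: n => [|n IH]; first by rewrite /=; lra.
    rewrite (S_INR n.+1) [4 ^ n.+1]/=; have := Hn1 n; nra.
  have Ha (n : nat) : Cmod (a n.+1) * rho ^ n * INR n.+1 ^ 2 <= M / q * (/ 2) ^ n.
    apply: (Rmult_le_reg_r (q * 8 ^ n)).
      by apply: Rmult_lt_0_compat => //; apply: pow_lt; lra.
    have -> : M / q * (/ 2) ^ n * (q * 8 ^ n) = M * 4 ^ n.
      have -> : 4 = / 2 * 8 by field.
      by rewrite Rpow_mult_distr; field; lra.
    have -> : Cmod (a n.+1) * rho ^ n * INR n.+1 ^ 2 * (q * 8 ^ n) =
       Cmod (a n.+1) * q ^ n.+1 * INR n.+1 ^ 2.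
      have -> : q ^ n.+1 = q * (rho ^ n * 8 ^ n).
        by rewrite -Rpow_mult_distr /rho /=; do 2 f_equal; field.
      by ring.
    apply: Rmult_le_compat => //; last by apply: pow2_ge_0.
    by apply: Rmult_le_pos; [apply: Cmod_ge_0 | apply: pow_le; lra].
  pose t (y : C) (n : nat) := (INR n.+1 * a n.+1 * (y - z0) ^ n)%C.
  pose g (y : C) := epsilon (inhabits (RtoC 0))
    (fun l : C => is_seriesC (t y) l).
  have Hgeom : is_series (fun n => (/ 2) ^ n) 2.
    have G := is_series_geom (/ 2) (ltac:(rewrite Rabs_pos_eq; lra)).
    by have E : / (1 - / 2) = 2; [field | rewrite E in G].
  have Hg y : Cmod (y - z0) < rho ->
      is_seriesC (t y) (g y).
    move=> Hy; apply: (epsilon_spec (inhabits (RtoC 0))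
      (fun l : C => is_seriesC (t y) l)).
    apply: (ex_series_le (K := C_AbsRing) (V := C_CompleteNormedModule) _
      (fun n => M / q * (/ 2) ^ n)).
      move=> n; apply: Rle_trans (Ha n); rewrite -[norm _]/(Cmod (t y n)) /t.
      rewrite !Cmod_mult Cmod_R Rabs_pos_eq; last by have := Hn1 n; lra.
      rewrite Cmod_pow.
      have X : Cmod (y - z0) ^ n <= rho ^ n.
        by apply: pow_incr; split; [apply: Cmod_ge_0 | lra].
      have Y : INR n.+1 <= INR n.+1 ^ 2 by have := Hn1 n; nra.
      have -> : INR n.+1 * Cmod (a n.+1) * Cmod (y - z0) ^ n =
        Cmod (a n.+1) * Cmod (y - z0) ^ n * INR n.+1 by ring.
      apply: Rmult_le_compat => //.
      - by apply: Rmult_le_pos; [apply: Cmod_ge_0 | apply: pow_le; apply: Cmod_ge_0].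
      - by have := Hn1 n; lra.
      - by apply: Rmult_le_compat_l => //; apply: Cmod_ge_0.
    by exists (M / q * 2); apply: (is_series_scal (K := R_AbsRing) (V := R_NormedModule) (M / q) _ _ Hgeom).
  exists rho, (M / q * / rho * 2 + 1), g; split => //.
  have HMq : 0 <= M / q * / rho.
    apply: Rmult_le_pos; last by left; apply: Rinv_pos.
    by apply: Rmult_le_pos => //; left; apply: Rinv_pos.
  split; first lra.
  move=> y z Hy Hz.
  have Hlt w : Cmod (w - z0) < rho -> Cmod (w - z0) < r by rewrite /rho /q; lra.
  have Fy := is_series_tail
    (fun n => scal (pow_n (K := C_AbsRing) (y - z0)%C n) (a n : C_NormedModule)) _ (Hf y (Hlt y Hy)).
  have Fz := is_series_tail
    (fun n => scal (pow_n (K := C_AbsRing) (z - z0)%C n) (a n : C_NormedModule)) _ (Hf z (Hlt z Hz)).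
  have G := is_series_scal (K := C_AbsRing) (V := C_NormedModule) (z - y)%C _ _ (Hg y Hy).
  have S := is_series_minus _ _ _ _ (is_series_minus _ _ _ _ Fz Fy) G.
  apply: Rle_trans (_ : M / q * / rho * Cmod (z - y) ^ 2 * 2 <= _); last first.
    have := pow2_ge_0 (Cmod (z - y)); nra.
  apply: (is_series_Cmod_le _ _ (fun n => M / q * / rho * Cmod (z - y) ^ 2 * (/ 2) ^ n)).
  - move: S; congr is_series.
    rewrite /minus /plus /opp /scal /= /mult /= /one /=; ring.
  - move=> n; rewrite [X in Cmod X <= _](_ : _ =
      (a n.+1 * ((z - z0) ^ n.+1 - (y - z0) ^ n.+1 -
        INR n.+1 * (y - z0) ^ n * ((z - z0) - (y - z0))))%C); last first.
      rewrite !pow_n_Cpow /minus /plus /opp /scal /= /mult /= /t /=; ring.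
    rewrite Cmod_mult.
    have T := Cpow_taylor (y - z0) (z - z0) rho n (Rlt_le _ _ Hy) (Rlt_le _ _ Hz).
    have E3 : ((z - z0) - (y - z0) = z - y)%C by ring.
    rewrite E3 in T *.
    move: T; set D := Cmod (_ - _ - _) => T.
    have -> : M / q * / rho * Cmod (z - y) ^ 2 * (/ 2) ^ n =
      (M / q * (/ 2) ^ n) * (/ rho * Cmod (z - y) ^ 2) by ring.
    apply: Rle_trans (_ : (Cmod (a n.+1) * rho ^ n * INR n.+1 ^ 2) *
       (/ rho * Cmod (z - y) ^ 2) <= _); last first.
      apply: Rmult_le_compat_r => //.
      by apply: Rmult_le_pos; [left; apply: Rinv_pos | apply: pow2_ge_0].
    have -> : Cmod (a n.+1) * rho ^ n * INR n.+1 ^ 2 * (/ rho * Cmod (z - y) ^ 2) =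
      Cmod (a n.+1) * ((INR n.+1 ^ 2 * rho ^ n * Cmod (z - y) ^ 2) / rho).
      by rewrite /Rdiv; ring.
    apply: Rmult_le_compat_l; first exact: Cmod_ge_0.
    apply: (Rmult_le_reg_l rho) => //.
    apply: Rle_trans T _; right; field; lra.
  - exact: (is_series_scal (K := R_AbsRing) (V := R_NormedModule) _ _ _ Hgeom).
Qed.

(** * Integrals of complex-valued functions of a real variable *)

Definition ctn (f : R -> C) (t : R) : Prop :=
  continuous (fun u => Re (f u)) t /\ continuous (fun u => Im (f u)) t.

Definition CInt (f : R -> C) (a b : R) : C :=
  (RInt (fun u => Re (f u)) a b, RInt (fun u => Im (f u)) a b).

Lemma continuous_eps (h : R -> R) (t : R) :
  (forall eps, 0 < eps -> exists delta, 0 < delta /\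
    forall u, Rabs (u - t) < delta -> Rabs (h u - h t) < eps) -> continuous h t.
Proof.
  move=> H; apply/filterlim_locally => eps.
  have [d [Hd H1]] := H eps (cond_pos eps).
  by exists (mkposreal d Hd) => u Hu; apply: H1.
Qed.

Lemma continuous_eps_inv (h : R -> R) (t : R) : continuous h t ->
  forall eps, 0 < eps -> exists delta, 0 < delta /\
    forall u, Rabs (u - t) < delta -> Rabs (h u - h t) < eps.
Proof.
  move=> /filterlim_locally H eps He.
  have [d Hd] := H (mkposreal eps He).
  by exists d; split; [apply: cond_pos | move=> u Hu; apply: Hd].
Qed.

Lemma ctn_eps (f : R -> C) (t : R) :
  (forall eps, 0 < eps -> exists delta, 0 < delta /\
    forall u, Rabs (u - t) < delta -> Cmod (f u - f t) < eps) -> ctn f t.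
Proof.
  move=> H; split; apply: continuous_eps => eps He; have [d [Hd H1]] := H eps He;
    exists d; split => // u /H1; apply: Rle_lt_trans.
  - exact: (re_le_Cmod (f u - f t)%C).
  - exact: (im_le_Cmod (f u - f t)%C).
Qed.

Lemma ctn_eps_inv (f : R -> C) (t : R) : ctn f t ->
  forall eps, 0 < eps -> exists delta, 0 < delta /\
    forall u, Rabs (u - t) < delta -> Cmod (f u - f t) < eps.
Proof.
  move=> [H1 H2] eps He.
  have [d1 [Hd1 A1]] := continuous_eps_inv _ _ H1 (eps / 2) by_lra.
  have [d2 [Hd2 A2]] := continuous_eps_inv _ _ H2 (eps / 2) by_lra.
  exists (Rmin d1 d2); split; first by apply: Rmin_pos.
  move=> u Hu; have := Rmin_l d1 d2; have := Rmin_r d1 d2 => M2 M1.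
  have B1 := A1 u by_lra; have B2 := A2 u by_lra.
  apply: Rle_lt_trans (Cmod_le_sum _) _.
  have -> : Re (f u - f t) = Re (f u) - Re (f t) by [].
  have -> : Im (f u - f t) = Im (f u) - Im (f t) by [].
  lra.
Qed.

Lemma ctn_const (c : C) (t : R) : ctn (fun _ => c) t.
Proof. by split; apply: continuous_const. Qed.

Lemma ctn_pair (f g : R -> R) (t : R) :
  continuous f t -> continuous g t -> ctn (fun u => (f u, g u)) t.
Proof. by []. Qed.

Lemma ctn_vert (x v : R) : ctn (fun v => (x, v)) v.
Proof. by apply: ctn_pair; [apply: continuous_const | apply: continuous_id]. Qed.

Lemma ctn_horiz (y x : R) : ctn (fun x => (x, y)) x.
Proof. by apply: ctn_pair; [apply: continuous_id | apply: continuous_const]. Qed.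

Lemma pair_neq0 (x y : R) : x <> 0 \/ y <> 0 -> (x, y) <> RtoC 0.
Proof.
  by move=> [N|N] E; apply: N; [apply: (f_equal fst E) | apply: (f_equal snd E)].
Qed.

Lemma ctn_plus (f g : R -> C) (t : R) : ctn f t -> ctn g t -> ctn (fun u => f u + g u)%C t.
Proof.
  by move=> [F1 F2] [G1 G2]; split;
    apply: continuousD.
Qed.

Lemma ctn_opp (f : R -> C) (t : R) : ctn f t -> ctn (fun u => - f u)%C t.
Proof.
  by move=> [F1 F2]; split;
    apply: (continuous_opp (K := R_AbsRing) (V := R_NormedModule)).
Qed.

Lemma ctn_mult (f g : R -> C) (t : R) : ctn f t -> ctn g t -> ctn (fun u => f u * g u)%C t.
Proof.
  move=> [F1 F2] [G1 G2]; split.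
  - by apply: (continuous_minus (K := R_AbsRing) (V := R_NormedModule));
      apply: continuousM.
  - by apply: continuousD;
      apply: continuousM.
Qed.

Lemma holo_ctn (f : C -> C) (gam : R -> C) (t : R) :
  holo f (gam t) -> ctn gam t -> ctn (fun u => f (gam u)) t.
Proof.
  move=> /holo_bounds [r [K [g [Hr [HK H]]]]] /ctn_eps_inv G.
  apply: ctn_eps => eps He.
  have Hm : 0 < Rmin r (eps / K) by apply: Rmin_pos => //; apply: Rdiv_pos_pos.
  have [d [Hd Hu]] := G _ Hm.
  exists d; split => // u /Hu X.
  have := Rmin_l r (eps / K); have := Rmin_r r (eps / K) => M2 M1.
  have Z : Cmod (gam t - gam t) < r.
    have -> : (gam t - gam t = 0)%C by ring.
    by rewrite Cmod_0.
  have [_ Y _ _ _] := H (gam t) (gam u) Z by_lra.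
  apply: Rle_lt_trans Y _.
  apply: (Rlt_le_trans _ (K * (eps / K))); last by right; field; lra.
  by apply: Rmult_lt_compat_l => //; lra.
Qed.

Lemma ctn_inv (f : R -> C) (t : R) : f t <> 0 -> ctn f t -> ctn (fun u => / f u)%C t.
Proof. by move=> Hf; apply: holo_ctn; apply: holo_inv. Qed.

Lemma ctn_div (f g : R -> C) (t : R) :
  ctn f t -> ctn g t -> g t <> 0 -> ctn (fun u => f u / g u)%C t.
Proof. by move=> F G N; apply: ctn_mult => //; apply: ctn_inv. Qed.

Lemma ctn_Cmod (f : R -> C) (t : R) : ctn f t -> continuous (fun u => Cmod (f u)) t.
Proof.
  move=> /ctn_eps_inv H; apply: continuous_eps => eps He.
  have [d [Hd H1]] := H eps He; exists d; split => // u /H1; apply: Rle_lt_trans.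
  have A : Cmod (f u) <= Cmod (f t) + Cmod (f u - f t).
    have {1}-> : (f u = f t + (f u - f t))%C by ring.
    exact: Cmod_triangle.
  have B : Cmod (f t) <= Cmod (f u) + Cmod (f u - f t).
    have {1}-> : (f t = f u - (f u - f t))%C by ring.
    exact: Cmod_minus_le.
  by apply/Rabs_le_between; lra.
Qed.

Lemma ex_RInt_on (h : R -> R) (a b : R) : a <= b ->
  (forall t, a <= t <= b -> continuous h t) -> ex_RInt h a b.
Proof.
  move=> Hab H; apply: (ex_RInt_contR) => z.
  by rewrite Rmin_left // Rmax_right //; apply: H.
Qed.

Section CIntTheory.
Variables (a b : R).
Hypothesis Hab : a <= b.

Definition con (f : R -> C) : Prop := forall t, a <= t <= b -> ctn f t.

Lemma con_ex (f : R -> C) : con f ->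
  ex_RInt (fun u => Re (f u)) a b /\ ex_RInt (fun u => Im (f u)) a b.
Proof. by move=> H; split; apply: ex_RInt_on => // t /H []. Qed.

Lemma CInt_ext (f g : R -> C) : (forall t, a <= t <= b -> f t = g t) ->
  CInt f a b = CInt g a b.
Proof.
  move=> H; congr pair; apply: RInt_ext => x;
    rewrite Rmin_left // Rmax_right // => Hx; rewrite H //; lra.
Qed.

Lemma RInt_Rplus (f g : R -> R) : ex_RInt f a b -> ex_RInt g a b ->
  RInt (fun t => f t + g t) a b = RInt f a b + RInt g a b.
Proof. exact: (RInt_plus (V := R_CompleteNormedModule)). Qed.

Lemma RInt_Rminus (f g : R -> R) : ex_RInt f a b -> ex_RInt g a b ->
  RInt (fun t => f t - g t) a b = RInt f a b - RInt g a b.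
Proof. exact: (RInt_minus (V := R_CompleteNormedModule)). Qed.

Lemma RInt_Rscal (k : R) (f : R -> R) : ex_RInt f a b ->
  RInt (fun t => k * f t) a b = k * RInt f a b.
Proof. exact: (RInt_scal (V := R_CompleteNormedModule)). Qed.

Lemma ex_RInt_Rscal (k : R) (f : R -> R) : ex_RInt f a b -> ex_RInt (fun t => k * f t) a b.
Proof. exact: (ex_RInt_scal (V := R_NormedModule)). Qed.

Lemma CInt_plus (f g : R -> C) : con f -> con g ->
  CInt (fun t => f t + g t)%C a b = (CInt f a b + CInt g a b)%C.
Proof.
  move=> /con_ex [F1 F2] /con_ex [G1 G2].
  by apply: C_ext; rewrite /CInt {1}/Re {1}/Im /= RInt_Rplus.
Qed.

Lemma CInt_scal (c : C) (f : R -> C) : con f ->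
  CInt (fun t => c * f t)%C a b = (c * CInt f a b)%C.
Proof.
  move=> /con_ex [F1 F2].
  apply: C_ext; rewrite /CInt {1}/Re {1}/Im /=.
  - by rewrite RInt_Rminus ?RInt_Rscal //; apply: ex_RInt_Rscal.
  - by rewrite RInt_Rplus ?RInt_Rscal //; apply: ex_RInt_Rscal.
Qed.

Lemma con_plus (f g : R -> C) : con f -> con g -> con (fun t => f t + g t)%C.
Proof. by move=> F G t Ht; apply: ctn_plus; [apply: F | apply: G]. Qed.

Lemma con_opp (f : R -> C) : con f -> con (fun t => - f t)%C.
Proof. by move=> F t Ht; apply: ctn_opp; apply: F. Qed.

Lemma con_scal (c : C) (f : R -> C) : con f -> con (fun t => c * f t)%C.
Proof. by move=> F t Ht; apply: ctn_mult; [apply: ctn_const | apply: F]. Qed.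

Lemma CInt_opp (f : R -> C) : con f -> CInt (fun t => - f t)%C a b = (- CInt f a b)%C.
Proof.
  move=> F; rewrite (CInt_ext _ (fun t => (- (1)) * f t)%C); last by move=> t _; ring.
  by rewrite CInt_scal //; ring.
Qed.

Lemma CInt_minus (f g : R -> C) : con f -> con g ->
  CInt (fun t => f t - g t)%C a b = (CInt f a b - CInt g a b)%C.
Proof. by move=> F G; rewrite CInt_plus ?CInt_opp //; apply: con_opp. Qed.

(** The factor 2 is the price of bounding the two components separately; it is harmless because only
    orders of magnitude matter later. *)
Lemma CInt_bound (f : R -> C) (h : R -> R) : con f -> ex_RInt h a b ->
  (forall t, a <= t <= b -> Cmod (f t) <= h t) ->
  Cmod (CInt f a b) <= 2 * RInt h a b.
Proof.
  move=> /con_ex [F1 F2] Hh H; apply: Rle_trans (Cmod_le_sum _) _.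
  rewrite /CInt {1}/Re {1}/Im /=.
  have X k : ex_RInt k a b -> (forall t, a <= t <= b -> Rabs (k t) <= h t) ->
      Rabs (RInt k a b) <= RInt h a b.
    move=> Hk Hkh; apply: (norm_RInt_le (V := R_NormedModule) k h a b) => //;
      exact: RInt_correctR.
  have A1 := X _ F1 (fun t Ht => Rle_trans _ _ _ (re_le_Cmod (f t)) (H t Ht)).
  have A2 := X _ F2 (fun t Ht => Rle_trans _ _ _ (im_le_Cmod (f t)) (H t Ht)).
  lra.
Qed.

Lemma CInt_bound_const (f : R -> C) (M : R) : con f ->
  (forall t, a <= t <= b -> Cmod (f t) <= M) ->
  Cmod (CInt f a b) <= 2 * ((b - a) * M).
Proof.
  move=> F H; have -> : (b - a) * M = RInt (fun _ => M) a b by rewrite RInt_const.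
  by apply: CInt_bound => //; apply: ex_RInt_const.
Qed.

End CIntTheory.

(** * Cauchy's formula for the centre of a rectangle *)

Lemma is_derive_quad (h : R -> R) (t l rho K : R) : 0 < rho -> 0 < K ->
  (forall u, Rabs (u - t) < rho -> Rabs (h u - h t - l * (u - t)) <= K * (u - t) ^ 2) ->
  is_derive h t l.
Proof.
  move=> Hr HK H; apply/is_derive_Reals => eps He.
  have Hd : 0 < Rmin rho (eps / (2 * K)).
    by apply: Rmin_pos => //; apply: Rdiv_pos_pos; lra.
  exists (mkposreal _ Hd) => u Hu0 /= Hu.
  have M1 := Rmin_l rho (eps / (2 * K)); have M2 := Rmin_r rho (eps / (2 * K)).
  have := H (t + u); have -> : t + u - t = u by ring.
  move=> X; have {}X := X by_lra.
  have Hp : 0 < Rabs u by apply: Rabs_pos_lt.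
  have -> : (h (t + u) - h t) / u - l = (h (t + u) - h t - l * u) / u by field.
  rewrite Rabs_div //; apply: (Rle_lt_trans _ (K * Rabs u)).
    apply: (Rmult_le_reg_r (Rabs u)) => //.
    have -> : Rabs (h (t + u) - h t - l * u) / Rabs u * Rabs u =
      Rabs (h (t + u) - h t - l * u) by field; lra.
    by move: X; rewrite -(pow2_abs u); lra.
  apply: (Rle_lt_trans _ (K * (eps / (2 * K)))); first by apply: Rmult_le_compat_l; lra.
  have -> : K * (eps / (2 * K)) = eps / 2 by field; lra.
  lra.
Qed.

Definition quad_at (f : C -> C) (z l : C) : Prop :=
  exists rho K, 0 < rho /\ 0 < K /\ forall w, Cmod (w - z) < rho ->
    Cmod (f w - f z - l * (w - z)) <= K * Cmod (w - z) ^ 2.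

Lemma quad_at_unique (f : C -> C) (z l1 l2 : C) :
  quad_at f z l1 -> quad_at f z l2 -> l1 = l2.
Proof.
  move=> [r1 [K1 [Hr1 [HK1 H1]]]] [r2 [K2 [Hr2 [HK2 H2]]]].
  have X : Cmod (l1 - l2) <= 0.
    apply: le_epsilon => eps He; rewrite Rplus_0_l.
    pose d := Rmin (Rmin (r1 / 2) (r2 / 2)) (eps / (K1 + K2)).
    have Hd : 0 < d.
      by repeat apply: Rmin_pos; try lra; apply: Rdiv_pos_pos; lra.
    have D1 : d <= r1 / 2 by apply: Rle_trans (Rmin_l _ _) (Rmin_l _ _).
    have D2 : d <= r2 / 2 by apply: Rle_trans (Rmin_l _ _) (Rmin_r _ _).
    have D3 : d <= eps / (K1 + K2) by apply: Rmin_r.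
    have E : (z + d - z = d)%C by ring.
    have Em : Cmod d = d by rewrite Cmod_R Rabs_pos_eq; lra.
    have := H1 (z + d)%C; have := H2 (z + d)%C; rewrite E Em => A2 A1.
    have {}A1 := A1 by_lra; have {}A2 := A2 by_lra.
    apply: (Rmult_le_reg_r d) => //; rewrite -{1}Em -Cmod_mult.
    have -> : ((l1 - l2) * d = (f (z + d)%C - f z - l2 * d) - (f (z + d)%C - f z - l1 * d))%C.
      by ring.
    apply: Rle_trans (Cmod_minus_le _ _) _.
    have D4 : d * (K1 + K2) <= eps.
      have -> : eps = eps / (K1 + K2) * (K1 + K2) by field; lra.
      by apply: Rmult_le_compat_r; lra.
    nra.
  have X0 : Cmod (l1 - l2) = 0 by have := Cmod_ge_0 (l1 - l2); lra.
  have -> : (l1 = (l1 - l2) + l2)%C by ring.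
  by rewrite (Cmod_eq_0 _ X0); ring.
Qed.

(** Every witness of [holo] brings its own local derivative. Choosing one value at each point, with
    [quad_at_unique] to identify it, glues them into a single function that can be integrated along
    a contour. *)
Definition Cd (f : C -> C) (z : C) : C := epsilon (inhabits (RtoC 0)) (quad_at f z).

(** A single parameter is both the radius and the inverse of the constant: decreasing [rho] weakens
    the statement in both respects, so the compactness argument below has only one positive function
    to control. *)
Lemma holo_Cd (f : C -> C) (z0 : C) : holo f z0 ->
  exists rho, 0 < rho /\ forall y z, Cmod (y - z0) < rho -> Cmod (z - z0) < rho ->
    Cmod (f z - f y - Cd f y * (z - y)) <= Cmod (z - y) ^ 2 / rho /\
    Cmod (Cd f z - Cd f y) <= Cmod (z - y) / rho.
Proof.
  move=> /holo_bounds [r [K [g [Hr [HK H]]]]].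
  have Hg y : Cmod (y - z0) < r -> Cd f y = g y.
    move=> Hy; have Q : quad_at f y (g y).
      exists (r - Cmod (y - z0)), K; split; first lra.
      split => // w Hw; have Hwz : Cmod (w - z0) < r.
        have -> : (w - z0 = (w - y) + (y - z0))%C by ring.
        apply: Rle_lt_trans (Cmod_triangle _ _) _; lra.
      by have [] := H y w Hy Hwz.
    by apply: (quad_at_unique f y) => //; apply: epsilon_spec; exists (g y).
  exists (Rmin r (/ K)); have HK2 : 0 < / K by apply: Rinv_pos.
  have Hm : 0 < Rmin r (/ K) by apply: Rmin_pos.
  have M1 := Rmin_l r (/ K); have M2 := Rmin_r r (/ K).
  split => // y z Hy Hz; rewrite !Hg; try lra.
  have [A1 _ A3 _ _] := H y z by_lra by_lra.
  have HKm : K <= / Rmin r (/ K).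
    by rewrite -{1}(Rinv_inv K); apply: Rinv_le_contravar.
  have P := Cmod_ge_0 (z - y); split.
  - apply: Rle_trans A1 _; rewrite Rmult_comm; apply: Rmult_le_compat_l => //.
    exact: pow2_ge_0.
  - by apply: Rle_trans A3 _; rewrite Rmult_comm; apply: Rmult_le_compat_l.
Qed.

Lemma ctn_Cd (f : C -> C) (gam : R -> C) (t : R) :
  holo f (gam t) -> ctn gam t -> ctn (fun u => Cd f (gam u)) t.
Proof.
  move=> /holo_Cd [r [Hr H]] /ctn_eps_inv G; apply: ctn_eps => eps He.
  have Hm : 0 < Rmin r (eps * r) by apply: Rmin_pos => //; apply: Rmult_lt_0_compat.
  have [d [Hd Hu]] := G _ Hm; exists d; split => // u /Hu X.
  have M1 := Rmin_l r (eps * r); have M2 := Rmin_r r (eps * r).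
  have Z : Cmod (gam t - gam t) < r.
    have -> : (gam t - gam t = 0)%C by ring.
    by rewrite Cmod_0.
  have [_ Y] := H (gam t) (gam u) Z by_lra.
  apply: Rle_lt_trans Y _; apply: (Rmult_lt_reg_r r) => //.
  have -> : Cmod (gam u - gam t) / r * r = Cmod (gam u - gam t) by field; lra.
  lra.
Qed.

Lemma ctn_line (p q : C) (t : R) : ctn (fun v => p + RtoC v * q)%C t.
Proof.
  apply: ctn_plus; first by apply: ctn_const.
  apply: ctn_mult; last by apply: ctn_const.
  by split; [apply: continuous_id | apply: continuous_const].
Qed.

Lemma Cd_FTC (f : C -> C) (p q : C) (a b : R) : a <= b ->
  (forall v, a <= v <= b -> holo f (p + RtoC v * q)) ->
  CInt (fun v => Cd f (p + RtoC v * q) * q)%C a b = (f (p + b * q)%C - f (p + a * q)%C)%C.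
Proof.
  move=> Hab H.
  have Q v : a <= v <= b -> exists rho K, 0 < rho /\ 0 < K /\
      forall u, Rabs (u - v) < rho ->
      Cmod (f (p + RtoC u * q)%C - f (p + RtoC v * q)%C - Cd f (p + RtoC v * q) * q * RtoC (u - v))
       <= K * (u - v) ^ 2.
    move=> /H /holo_Cd [r [Hr Hf]].
    have Hq := Cmod_ge_0 q.
    exists (r / (Cmod q + 1)), ((Cmod q ^ 2 + 1) / r).
    split; first by apply: Rdiv_pos_pos; lra.
    split; first by apply: Rdiv_pos_pos => //; have := pow2_ge_0 (Cmod q); lra.
    move=> u Hu.
    have E : (p + RtoC u * q - (p + RtoC v * q) = RtoC (u - v) * q)%C.
      by rewrite RtoC_minus; ring.
    have Em : Cmod (RtoC (u - v) * q) = Rabs (u - v) * Cmod q.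
      by rewrite Cmod_mult Cmod_R.
    have Z : Cmod (p + RtoC v * q - (p + RtoC v * q)) < r.
      have -> : (p + RtoC v * q - (p + RtoC v * q) = 0)%C by ring.
      by rewrite Cmod_0.
    have Y : Cmod (p + RtoC u * q - (p + RtoC v * q)) < r.
      rewrite E Em.
      have : Rabs (u - v) * (Cmod q + 1) < r.
        have -> : r = r / (Cmod q + 1) * (Cmod q + 1) by field; lra.
        by apply: Rmult_lt_compat_r; lra.
      have := Rabs_pos (u - v); nra.
    have [A _] := Hf _ _ Z Y.
    rewrite E Em in A.
    have -> : (Cd f (p + RtoC v * q) * q * RtoC (u - v) =
      Cd f (p + RtoC v * q) * (RtoC (u - v) * q))%C by ring.
    apply: Rle_trans A _.
    rewrite Rpow_mult_distr pow2_abs /Rdiv.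
    have := pow2_ge_0 (u - v); have : 0 < / r by apply: Rinv_pos.
    move=> A1 A2; have : 0 <= / r * (u - v) ^ 2 by apply: Rmult_le_pos; lra.
    lra.
  have K := fun v Hv => ctn_mult _ (fun _ => q) v
      (ctn_Cd f _ v (H v Hv) (ctn_line p q v)) (ctn_const q v).
  apply: C_ext; rewrite /CInt {1}/Re {1}/Im /=; apply: is_RInt_unique.
  - apply: (is_RInt_deriveR (fun v => Re (f (p + RtoC v * q)%C))) => v; rewrite Rmin_left // Rmax_right // => Hv.
      have [rho [k [Hr [Hk X]]]] := Q v Hv.
      apply: (is_derive_quad _ _ _ rho k) => // u /X; apply: Rle_trans.
      apply: Rle_trans (re_le_Cmod _); right; congr Rabs.
      by rewrite /Re /=; ring.
    by have [] := K v Hv.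
  - apply: (is_RInt_deriveR (fun v => Im (f (p + RtoC v * q)%C))) => v; rewrite Rmin_left // Rmax_right // => Hv.
      have [rho [k [Hr [Hk X]]]] := Q v Hv.
      apply: (is_derive_quad _ _ _ rho k) => // u /X; apply: Rle_trans.
      apply: Rle_trans (im_le_Cmod _); right; congr Rabs.
      by rewrite /Im /=; ring.
    by have [] := K v Hv.
Qed.

(** Compactness of the parameter interval, in the form of a Lebesgue number for the discs on which
    the local estimates hold. *)
Lemma holo_segment_uniform (f : C -> C) (p q : C) (a b : R) :
  (forall v, a <= v <= b -> holo f (p + RtoC v * q)) ->
  exists d, 0 < d /\ forall v, a <= v <= b ->
   forall y z, Cmod (y - (p + RtoC v * q)) < d -> Cmod (z - (p + RtoC v * q)) < d ->
    Cmod (f z - f y - Cd f y * (z - y)) <= Cmod (z - y) ^ 2 / d.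
Proof.
  move=> H.
  pose P (v : R) (rho : R) := 0 < rho /\
    forall y z, Cmod (y - (p + RtoC v * q)) < rho -> Cmod (z - (p + RtoC v * q)) < rho ->
    Cmod (f z - f y - Cd f y * (z - y)) <= Cmod (z - y) ^ 2 / rho.
  pose r v := epsilon (inhabits 0) (P v).
  have Hr v : a <= v <= b -> P v (r v).
    move=> /H /holo_Cd [rho [Hrho X]]; apply: (epsilon_spec (inhabits 0) (P v)).
    by exists rho; split => // y z Hy Hz; have [] := X y z Hy Hz.
  have Hq := Cmod_ge_0 q.
  (* Half of the radius [r v] is spent on moving the centre along the segment, the other half on the
     disc around the new centre; the summand 1 guards against [q = 0]. The gauge 1 is a default for
     [v] outside the interval, where the sign of [r v] is unknown. *)
  pose dl (v : R) : posreal := match Rlt_dec 0 (r v / (2 * (Cmod q + 1))) with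
    | left h => mkposreal _ h | right _ => mkposreal 1 Rlt_0_1 end.
  have Hdl v : a <= v <= b -> pos (dl v) = r v / (2 * (Cmod q + 1)).
    move=> /Hr [Hp _]; rewrite /dl; case: Rlt_dec => //= X; exfalso; apply: X.
    by apply: Rdiv_pos_pos; lra.
  have [d Hd] := compactness_value_1d a b dl.
  exists d; split; first by apply: cond_pos.
  move=> v Hv y z Hy Hz; apply: NNPP => N; apply: (Hd v Hv) => -[t [Ht [A1 A2]]].
  apply: N; rewrite Hdl // in A1 A2.
  have [Hp X] := Hr t Ht.
  have E1 : r t / (2 * (Cmod q + 1)) * (Cmod q + 1) = r t / 2 by field; lra.
  have Hpos : 0 < r t / (2 * (Cmod q + 1)) by apply: Rdiv_pos_pos; lra.
  have D1 : d <= r t / 2 by nra.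
  have D2 : Cmod (p + RtoC v * q - (p + RtoC t * q)) <= r t / 2.
    have -> : (p + RtoC v * q - (p + RtoC t * q) = RtoC (v - t) * q)%C.
      by rewrite RtoC_minus; ring.
    rewrite Cmod_mult Cmod_R; have := Rabs_pos (v - t); nra.
  have D3 w : Cmod (w - (p + RtoC v * q)) < d -> Cmod (w - (p + RtoC t * q)) < r t.
    move=> Hw; have -> : (w - (p + RtoC t * q) = (w - (p + RtoC v * q)) +
      (p + RtoC v * q - (p + RtoC t * q)))%C by ring.
    apply: Rle_lt_trans (Cmod_triangle _ _) _; lra.
  apply: Rle_trans (X y z (D3 y Hy) (D3 z Hz)) _.
  apply: Rmult_le_compat_l; first by apply: pow2_ge_0.
  apply: Rinv_le_contravar; [apply: cond_pos | lra].
Qed.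

(** The contribution of the segment [w = p + v q] to the contour integral of [f (lam w) / w]. *)
Definition side (f : C -> C) (p q : C) (a b lam : R) : C :=
  CInt (fun v => f (RtoC lam * (p + RtoC v * q))%C * (q / (p + RtoC v * q)))%C a b.

Lemma line_scale (lam v : R) (p q : C) :
  (RtoC lam * (p + RtoC v * q) = RtoC lam * p + RtoC v * (RtoC lam * q))%C.
Proof. by ring. Qed.

(* Differentiation of the dilated contour integral in the dilation parameter:
   the derivative no longer contains the singular factor. *)
Lemma side_derive (f : C -> C) (p q : C) (a b lam : R) : a <= b ->
  (forall v, a <= v <= b -> p + RtoC v * q <> 0)%C ->
  (forall v, a <= v <= b -> holo f (RtoC lam * (p + RtoC v * q))) ->
  exists rho K, 0 < rho /\ 0 < K /\ forall mu, Rabs (mu - lam) < rho ->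
    Cmod (side f p q a b mu - side f p q a b lam -
      CInt (fun v => Cd f (RtoC lam * (p + RtoC v * q)) * q)%C a b * RtoC (mu - lam)) <=
    K * (mu - lam) ^ 2.
Proof.
  move=> Hab N H.
  have H' v : a <= v <= b -> holo f (RtoC lam * p + RtoC v * (RtoC lam * q)).
    by move=> /H; rewrite line_scale.
  have [d [Hd U]] := holo_segment_uniform f _ _ a b H'.
  pose G := Cmod p + (Rabs a + Rabs b) * Cmod q + 1.
  have HG v : a <= v <= b -> Cmod (p + RtoC v * q) <= G.
    move=> Hv; apply: Rle_trans (Cmod_triangle _ _) _; rewrite Cmod_mult Cmod_R.
    have : Rabs v <= Rabs a + Rabs b.
      by rewrite /Rabs; do 3 case: Rcase_abs; lra.
    have := Cmod_ge_0 q; rewrite /G; nra.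
  have HG0 : 0 < G.
    have := Cmod_ge_0 q; have := Cmod_ge_0 p; have := Rabs_pos a; have := Rabs_pos b.
    rewrite /G; nra.
  exists (d / G), (2 * ((b - a) * (G * Cmod q / d)) + 1).
  split; first by apply: Rdiv_pos_pos.
  have K0 : 0 <= G * Cmod q / d.
    apply: Rmult_le_pos; last by left; apply: Rinv_pos.
    by apply: Rmult_le_pos; [lra | apply: Cmod_ge_0].
  split; first by have : 0 <= (b - a) * (G * Cmod q / d) by [apply: Rmult_le_pos; lra]; lra.
  move=> mu Hmu.
  have near v : a <= v <= b ->
      Cmod (RtoC mu * (p + RtoC v * q) - (RtoC lam * p + RtoC v * (RtoC lam * q))) < d.
    move=> Hv; rewrite -line_scale.
    have -> : (RtoC mu * (p + RtoC v * q) - RtoC lam * (p + RtoC v * q) =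
      RtoC (mu - lam) * (p + RtoC v * q))%C by rewrite RtoC_minus; ring.
    rewrite Cmod_mult Cmod_R.
    apply: (Rle_lt_trans _ (Rabs (mu - lam) * G)).
      by apply: Rmult_le_compat_l; [apply: Rabs_pos | apply: HG].
    have -> : d = d / G * G by field; lra.
    by apply: Rmult_lt_compat_r.
  have zero v : Cmod (RtoC lam * (p + RtoC v * q) - (RtoC lam * p + RtoC v * (RtoC lam * q))) < d.
    rewrite line_scale; have -> : (RtoC lam * p + RtoC v * (RtoC lam * q) -
      (RtoC lam * p + RtoC v * (RtoC lam * q)) = 0)%C by ring.
    by rewrite Cmod_0.
  have Hmuh v : a <= v <= b -> holo f (RtoC mu * (p + RtoC v * q)).
    move=> Hv; have Hn := near v Hv.
    move: Hn; set w := (RtoC mu * _)%C; set w0 := (_ + _)%C => Hn.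
    exists (d - Cmod (w - w0)), (/ d), (Cd f); split; first lra.
    split; first by apply: Rinv_pos.
    move=> y z Hy Hz; rewrite Rmult_comm.
    have T x : Cmod (x - w) < d - Cmod (w - w0) -> Cmod (x - w0) < d.
      move=> Hx; have -> : (x - w0 = (x - w) + (w - w0))%C by ring.
      apply: Rle_lt_trans (Cmod_triangle _ _) _; lra.
    by apply: (U v Hv); apply: T.
  have cl t : ctn (fun v => p + RtoC v * q)%C t by apply: ctn_line.
  have cs (k : R) : con a b (fun v => RtoC k * (p + RtoC v * q))%C.
    by apply: con_scal => t _.
  have cq : con a b (fun v => q / (p + RtoC v * q))%C.
    by move=> t Ht; apply: ctn_div; [apply: ctn_const | apply: cl | apply: N].
  have cf k : (forall v, a <= v <= b -> holo f (RtoC k * (p + RtoC v * q))) ->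
      con a b (fun v => f (RtoC k * (p + RtoC v * q))%C * (q / (p + RtoC v * q)))%C.
    move=> Hk t Ht; apply: ctn_mult; last by apply: cq.
    by apply: holo_ctn; [apply: Hk | apply: cs].
  have c1 := cf mu Hmuh; have c2 := cf lam H.
  have c3 : con a b (fun v => Cd f (RtoC lam * (p + RtoC v * q)) * q)%C.
    move=> t Ht; apply: ctn_mult; last by apply: ctn_const.
    by apply: ctn_Cd; [apply: H | apply: cs].
  rewrite (Cmult_comm _ (RtoC (mu - lam))) -(CInt_scal a b) // /side.
  rewrite -!(CInt_minus a b) //; last first.
  - by apply: con_scal.
  - by apply: con_plus => //; apply: con_opp.
  apply: Rle_trans (CInt_bound_const a b Hab _ (G * Cmod q / d * (mu - lam) ^ 2) _ _) _.
  - apply: con_plus; first by apply: con_plus => //; apply: con_opp.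
    by apply: con_opp; apply: con_scal.
  - move=> v Hv; have Hn := N v Hv.
    (* Since [q (mu - lam) = (mu - lam) w * (q / w)], the subtracted term is the linear Taylor term
       of [f] at [lam w] for the increment [(mu - lam) w]. The quadratic error then supplies
       [|w|^2], which absorbs the denominator [w]. *)
    rewrite [X in Cmod X](_ : _ = (f (RtoC mu * (p + RtoC v * q))%C - f (RtoC lam * (p + RtoC v * q))%C
      - Cd f (RtoC lam * (p + RtoC v * q)) * (RtoC mu * (p + RtoC v * q) -
        RtoC lam * (p + RtoC v * q))) * (q / (p + RtoC v * q)))%C; last first.
      by rewrite RtoC_minus; field.
    rewrite Cmod_mult Cmod_div //.
    have P0 : 0 < Cmod (p + RtoC v * q) by apply/Cmod_gt_0.
    have Y := U v Hv _ _ (zero v) (near v Hv).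
    apply: Rle_trans (Rmult_le_compat_r _ _ _ _ Y) _.
      by apply: Rmult_le_pos; [apply: Cmod_ge_0 | left; apply: Rinv_pos].
    have -> : (RtoC mu * (p + RtoC v * q) - RtoC lam * (p + RtoC v * q) =
      RtoC (mu - lam) * (p + RtoC v * q))%C by rewrite RtoC_minus; ring.
    rewrite Cmod_mult Cmod_R Rpow_mult_distr pow2_abs.
    have -> : (mu - lam) ^ 2 * Cmod (p + RtoC v * q) ^ 2 / d * (Cmod q / Cmod (p + RtoC v * q))
      = Cmod (p + RtoC v * q) * (Cmod q / d * (mu - lam) ^ 2) by field; lra.
    have -> : G * Cmod q / d * (mu - lam) ^ 2 = G * (Cmod q / d * (mu - lam) ^ 2) by field; lra.
    apply: Rmult_le_compat_r; last by apply: HG.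
    apply: Rmult_le_pos; last by apply: pow2_ge_0.
    by apply: Rmult_le_pos; [apply: Cmod_ge_0 | left; apply: Rinv_pos].
  - have := pow2_ge_0 (mu - lam); lra.
Qed.

(** The mean value theorem needs the vanishing of [D] only in the interior. The endpoint 0 is
    excluded because in the application [D lam = 0] is obtained by dividing by [lam]. *)
Lemma quad_const (h D : R -> C) :
  (forall lam, 0 <= lam <= 1 -> exists rho K, 0 < rho /\ 0 < K /\
    forall mu, Rabs (mu - lam) < rho ->
      Cmod (h mu - h lam - D lam * RtoC (mu - lam)) <= K * (mu - lam) ^ 2) ->
  (forall lam, 0 < lam <= 1 -> D lam = 0) ->
  h 1 = h 0.
Proof.
  move=> H HD.
  have R1 (phi : C -> R) : (forall x y, phi (x - y)%C = phi x - phi y) ->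
      (forall x (r : R), phi (x * RtoC r)%C = phi x * r) -> phi 0 = 0 ->
      (forall x, Rabs (phi x) <= Cmod x) -> phi (h 1) = phi (h 0).
    move=> P1 P2 P3 P4.
    have Q lam : 0 <= lam <= 1 -> is_derive (fun l => phi (h l)) lam (phi (D lam)).
      move=> /H [rho [K [Hr [HK X]]]]; apply: (is_derive_quad _ _ _ rho K) => // u /X.
      by apply: Rle_trans; apply: Rle_trans (P4 _); rewrite !P1 P2; right.
    have [c [_ ?]] := MVT_gen (fun l => phi (h l)) 0 1 (fun l => 0)
      (fun x Hx => ltac:(have Hx' : 0 < x <= 1 by [move: Hx; rewrite Rmin_left ?Rmax_right; lra];
         rewrite -P3 -(HD x Hx'); apply: Q; lra))
      (fun x Hx => ltac:(apply: derivable_continuous_pt; exists (phi (D x));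
        apply/is_derive_Reals; apply: Q; move: Hx; rewrite Rmin_left ?Rmax_right; lra)).
    lra.
  apply: C_ext; apply: R1 => //.
  - by move=> x r; rewrite /Re /=; ring.
  - exact: re_le_Cmod.
  - by move=> x r; rewrite /Im /=; ring.
  - exact: im_le_Cmod.
Qed.

(** The counterclockwise integral over the boundary of the rectangle with real parts in [[-a, c]]
    and imaginary parts in [[-h, h]]: bottom, right, then top and left with orientation reversed. *)
Definition rect_int (F : C -> C) (a c h : R) : C :=
  (CInt (fun x => F (x, (- h)%R)) (- a) c + CInt (fun v => Ci * F (c, v)) (- h) h
   - CInt (fun x => F (x, h)) (- a) c - CInt (fun v => Ci * F ((- a)%R, v)) (- h) h)%C.

Lemma RInt_atan (m a b : R) : 0 < m ->
  (RInt (fun x => m / (x ^ 2 + m ^ 2)) a b : R) = atan (b / m) - atan (a / m).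
Proof.
  move=> Hm; apply: is_RInt_unique.
  have Hp x : 0 < x ^ 2 + m ^ 2 by have := pow2_ge_0 x; have : 0 < m ^ 2 by [nra]; lra.
  apply: (is_RInt_deriveR (fun x => atan (x / m))) => x _.
    auto_derive; first lra.
    have := Hp x; rewrite /Rsqr => H; field; lra.
  apply: continuousM; first by apply: continuous_const.
  apply: continuous_Rinv_comp; last by have := Hp x; lra.
  apply: derive_continuous; auto_derive; done.
Qed.

Lemma RInt_odd_quotient (m a : R) : 0 < m -> 0 <= a ->
  (RInt (fun x => x / (x ^ 2 + m ^ 2)) (- a) a : R) = 0.
Proof.
  move=> Hm Ha; apply: is_RInt_unique.
  have Hp x : 0 < x ^ 2 + m ^ 2 by have := pow2_ge_0 x; have : 0 < m ^ 2 by [nra]; lra.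
  have -> : 0 = minus (/ 2 * ln (a ^ 2 + m ^ 2)) (/ 2 * ln ((- a) ^ 2 + m ^ 2)).
    rewrite /minus /plus /opp /=; have -> : - a * (- a * 1) = a * (a * 1) by ring.
    by ring.
  apply: (is_RInt_deriveR
    (fun x => / 2 * ln (x ^ 2 + m ^ 2))) => x _.
    by auto_derive; have := Hp x; [ | move=> H; field]; simpl; lra.
  apply: continuousM; first by apply: continuous_id.
  apply: continuous_Rinv_comp; last by have := Hp x; lra.
  apply: derive_continuous; auto_derive; done.
Qed.

Lemma atan_plus_inv (x y : R) : 0 < x -> 0 < y -> atan (x / y) + atan (y / x) = PI / 2.
Proof.
  move=> Hx Hy; have -> : y / x = / (x / y) by field; lra.
  by rewrite atan_inv; [lra | apply: Rdiv_pos_pos].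
Qed.

(** The real parts vanish: the horizontal sides cancel each other and the vertical ones are
    integrals of odd functions. The imaginary parts are arctangents of reciprocal side ratios, which
    pair up to [PI / 2] by [atan_plus_inv]. *)
Lemma rect_int_inv (a c h : R) : 0 < a -> 0 < c -> 0 < h ->
  rect_int (fun w => / w)%C a c h = (RtoC (2 * PI) * Ci)%C.
Proof.
  move=> Ha Hc Hh; rewrite /rect_int /CInt.
  have A1 := atan_plus_inv a h Ha Hh; have A2 := atan_plus_inv c h Hc Hh.
  have B1 m : 0 < m -> (RInt (fun v => m / (m ^ 2 + v ^ 2)) (- h) h : R) = 2 * atan (h / m).
    move=> Hm; transitivity (RInt (fun v => m / (v ^ 2 + m ^ 2)) (- h) h).
      by apply: RInt_ext => v _; rewrite Rplus_comm.
    rewrite RInt_atan //; have -> : - h / m = - (h / m) by field; lra.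
    by rewrite atan_opp; ring.
  have B0 m : 0 < m -> (RInt (fun v => v / (m ^ 2 + v ^ 2)) (- h) h : R) = 0.
    move=> Hm; rewrite -[RHS](RInt_odd_quotient m h) //; last lra.
    by apply: RInt_ext => v _; rewrite Rplus_comm.
  have B2 := RInt_atan h (- a) c Hh.
  have E1 : - a / h = - (a / h) by field; lra.
  rewrite E1 atan_opp in B2.
  apply: C_ext; rewrite /Re /Im /=.
  - have -> : RInt (fun u => u / (u * (u * 1) + - h * (- h * 1))) (- a) c =
        RInt (fun u => u / (u * (u * 1) + h * (h * 1))) (- a) c.
      by apply: RInt_ext => u _; congr (_ / _); ring.
    have -> : RInt (fun v => 0 * (c / (c * (c * 1) + v * (v * 1))) -
        1 * (- v / (c * (c * 1) + v * (v * 1)))) (- h) h = 0.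
      rewrite -[RHS](B0 c Hc); apply: RInt_ext => u _ /=.
      by rewrite /Rdiv; ring.
    have -> : RInt (fun v => 0 * (- a / (- a * (- a * 1) + v * (v * 1))) -
        1 * (- v / (- a * (- a * 1) + v * (v * 1)))) (- h) h = 0.
      rewrite -[RHS](B0 a Ha); apply: RInt_ext => u _ /=.
      have -> : - a * (- a * 1) = a * (a * 1) by ring.
      by rewrite /Rdiv; ring.
    by ring.
  - have -> : RInt (fun u => - - h / (u * (u * 1) + - h * (- h * 1))) (- a) c =
        atan (c / h) + atan (a / h).
      have -> : atan (c / h) + atan (a / h) = atan (c / h) - - atan (a / h) by ring.
      rewrite -B2; apply: RInt_ext => u _ /=.
      have -> : - h * (- h * 1) = h * (h * 1) by ring.
      by rewrite Ropp_involutive.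
    have -> : RInt (fun u => - h / (u * (u * 1) + h * (h * 1))) (- a) c =
        - (atan (c / h) + atan (a / h)).
      have -> : - (atan (c / h) + atan (a / h)) = -1 * (atan (c / h) - - atan (a / h)) by ring.
      rewrite -B2 -RInt_Rscal; last first.
        apply: ex_RInt_on; first lra.
        move=> x _; apply: derive_continuous; auto_derive.
        by have := pow2_ge_0 x; have : 0 < h * h by [nra]; simpl; lra.
      by apply: RInt_ext => u _ /=; rewrite /Rdiv; ring.
    have -> : RInt (fun v => 0 * (- v / (c * (c * 1) + v * (v * 1))) +
        1 * (c / (c * (c * 1) + v * (v * 1)))) (- h) h = 2 * atan (h / c).
      rewrite -(B1 c Hc); apply: RInt_ext => u _ /=.
      by rewrite /Rdiv; ring.
    have -> : RInt (fun v => 0 * (- v / (- a * (- a * 1) + v * (v * 1))) +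
        1 * (- a / (- a * (- a * 1) + v * (v * 1)))) (- h) h = - (2 * atan (h / a)).
      have -> : - (2 * atan (h / a)) = -1 * (2 * atan (h / a)) by ring.
      rewrite -(B1 a Ha) -RInt_Rscal; last first.
        apply: ex_RInt_on; first lra.
        move=> x _; apply: derive_continuous; auto_derive.
        by have := pow2_ge_0 x; have : 0 < a * a by [nra]; simpl; lra.
      apply: RInt_ext => u _ /=.
      have -> : - a * (- a * 1) = a * (a * 1) by ring.
      by rewrite /Rdiv; ring.
    lra.
Qed.

(** The rectangle is star-shaped about 0, so [f (lam w)] is defined for all [lam] in [[0, 1]]. The
    integral of [f (lam w) / w] has the [lam]-derivative given by the integral of [f' (lam w)],
    which is zero around a closed contour. Hence its value at [lam = 1] equals the one at [lam = 0],
    which is [f 0] times the integral of [1 / w]. *)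
Theorem cauchy_rect (f : C -> C) (a c h : R) : 0 < a -> 0 < c -> 0 < h ->
  (forall x y, - a <= x <= c -> - h <= y <= h -> holo f (x, y)) ->
  rect_int (fun w => f w / w)%C a c h = (RtoC (2 * PI) * Ci * f 0)%C.
Proof.
  move=> Ha Hc Hh H.
  have Hb : 0 <= c + a by lra.
  have Pb (v : R) : ((0%R, (- h)%R) + RtoC v * 1 = (v, (- h)%R))%C.
    by apply: C_ext; rewrite /Re /Im /=; ring.
  have Pr (v : R) : (RtoC c + RtoC v * Ci = (c, v))%C.
    by apply: C_ext; rewrite /Re /Im /=; ring.
  have Pt (v : R) : ((0%R, h) + RtoC v * 1 = (v, h))%C.
    by apply: C_ext; rewrite /Re /Im /=; ring.
  have Pl (v : R) : (RtoC (- a) + RtoC v * Ci = ((- a)%R, v))%C.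
    by apply: C_ext; rewrite /Re /Im /=; ring.
  have scale (lam x y : R) : (RtoC lam * (x, y) = ((lam * x)%R, (lam * y)%R))%C.
    by apply: C_ext; rewrite /Re /Im /=; ring.
  have Hl lam x y : 0 <= lam <= 1 -> - a <= x <= c -> - h <= y <= h ->
      holo f (RtoC lam * (x, y)).
    by move=> Hlam Hx Hy; rewrite scale; apply: H; nra.
  have Nb v : - a <= v <= c -> ((0%R, (- h)%R) + RtoC v * 1 <> 0)%C.
    by move=> _; rewrite Pb; apply: pair_neq0; right; lra.
  have Nr v : - h <= v <= h -> (RtoC c + RtoC v * Ci <> 0)%C.
    by move=> _; rewrite Pr; apply: pair_neq0; left; lra.
  have Nt v : - a <= v <= c -> ((0%R, h) + RtoC v * 1 <> 0)%C.
    by move=> _; rewrite Pt; apply: pair_neq0; right; lra.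
  have Nl v : - h <= v <= h -> (RtoC (- a) + RtoC v * Ci <> 0)%C.
    by move=> _; rewrite Pl; apply: pair_neq0; left; lra.
  pose S lam := (side f (0%R, (- h)%R) 1 (- a) c lam + side f (RtoC c) Ci (- h) h lam -
    side f (0%R, h) 1 (- a) c lam - side f (RtoC (- a)) Ci (- h) h lam)%C.
  pose dS p q (al be lam : R) :=
    CInt (fun v => Cd f (RtoC lam * (p + RtoC v * q)) * q)%C al be.
  pose D lam := (dS (0%R, (- h)%R) (RtoC 1) (- a)%R c lam + dS (RtoC c) Ci (- h)%R h lam -
    dS (0%R, h) (RtoC 1) (- a)%R c lam - dS (RtoC (- a)) Ci (- h)%R h lam)%C.
  have Hac : - a <= c by lra.
  have Hhh : - h <= h by lra.
  have HS : S 1 = S 0.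
    apply: (quad_const S D) => lam Hlam.
    - have [r1 [K1 [Hr1 [HK1 X1]]]] := side_derive f (0%R, (- h)%R) 1 (- a) c lam Hac Nb
        (fun v Hv => ltac:(rewrite Pb; apply: Hl; lra)).
      have [r2 [K2 [Hr2 [HK2 X2]]]] := side_derive f (RtoC c) Ci (- h) h lam Hhh Nr
        (fun v Hv => ltac:(rewrite Pr; apply: Hl; lra)).
      have [r3 [K3 [Hr3 [HK3 X3]]]] := side_derive f (0%R, h) 1 (- a) c lam Hac Nt
        (fun v Hv => ltac:(rewrite Pt; apply: Hl; lra)).
      have [r4 [K4 [Hr4 [HK4 X4]]]] := side_derive f (RtoC (- a)) Ci (- h) h lam Hhh Nl
        (fun v Hv => ltac:(rewrite Pl; apply: Hl; lra)).
      exists (Rmin (Rmin r1 r2) (Rmin r3 r4)), (K1 + K2 + K3 + K4).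
      split; first by repeat apply: Rmin_pos.
      split; first lra.
      move=> mu Hmu.
      have M1 := Rmin_l (Rmin r1 r2) (Rmin r3 r4); have M2 := Rmin_r (Rmin r1 r2) (Rmin r3 r4).
      have M3 := Rmin_l r1 r2; have M4 := Rmin_r r1 r2.
      have M5 := Rmin_l r3 r4; have M6 := Rmin_r r3 r4.
      have {}X1 := X1 mu by_lra; have {}X2 := X2 mu by_lra.
      have {}X3 := X3 mu by_lra; have {}X4 := X4 mu by_lra.
      move: X1 X2 X3 X4; rewrite /S /D.
      set s1 := side _ _ _ _ _ mu; set s1' := side _ _ _ _ _ lam.
      set s2 := side _ _ _ _ _ mu; set s2' := side _ _ _ _ _ lam.
      set s3 := side _ _ _ _ _ mu; set s3' := side _ _ _ _ _ lam.
      set s4 := side _ _ _ _ _ mu; set s4' := side _ _ _ _ _ lam.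
      set k := RtoC (mu - lam) => X1 X2 X3 X4.
      set d1 := dS _ _ _ _ _; set d2 := dS _ _ _ _ _; set d3 := dS _ _ _ _ _.
      set d4 := dS _ _ _ _ _.
      have -> : (s1 + s2 - s3 - s4 - (s1' + s2' - s3' - s4') - (d1 + d2 - d3 - d4) * k =
        (s1 - s1' - d1 * k) + (s2 - s2' - d2 * k) - (s3 - s3' - d3 * k) -
        (s4 - s4' - d4 * k))%C by ring.
      apply: Rle_trans (Cmod_minus_le _ _) _.
      apply: Rle_trans (Rplus_le_compat_r _ _ _ (Cmod_minus_le _ _)) _.
      apply: Rle_trans (Rplus_le_compat_r _ _ _ (Rplus_le_compat_r _ _ _ (Cmod_triangle _ _))) _.
      apply: Rle_trans (Rplus_le_compat _ _ _ _ (Rplus_le_compat _ _ _ _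
        (Rplus_le_compat _ _ _ _ X1 X2) X3) X4) _; lra.
    (* After multiplication by [lam], each side is an integral of a derivative and contributes the
       difference of the values of [f] at its dilated endpoints; the four differences cancel at the
       corners. *)
    - have ftc p q al be : al <= be ->
          (forall v, al <= v <= be -> holo f (RtoC lam * (p + RtoC v * q))) ->
          (RtoC lam * dS p q al be lam =
           f (RtoC lam * (p + RtoC be * q))%C - f (RtoC lam * (p + RtoC al * q))%C)%C.
        move=> Hab Hv; rewrite !line_scale -Cd_FTC //; last first.
          by move=> v /Hv; rewrite line_scale.
        rewrite /dS -(CInt_scal al be) //; last first.
          move=> v /Hv X; apply: ctn_mult; last by apply: ctn_const.
          rewrite -/(_ v); apply: (ctn_Cd f (fun v => RtoC lam * (p + RtoC v * q))%C) => //.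
          by apply: ctn_mult; [apply: ctn_const | apply: ctn_line].
        by apply: CInt_ext => // v _; rewrite line_scale; ring.
      have L0 : RtoC lam <> 0 by move=> /(f_equal fst) /=; lra.
      have : (RtoC lam * D lam = 0)%C.
        rewrite /D; have -> x y z t : (RtoC lam * (x + y - z - t) =
          RtoC lam * x + RtoC lam * y - RtoC lam * z - RtoC lam * t)%C by ring.
        rewrite !ftc ?Pb ?Pr ?Pt ?Pl //; try (move=> v Hv; rewrite ?Pb ?Pr ?Pt ?Pl; apply: Hl; lra).
        by ring.
      move=> X; have -> : D lam = (/ RtoC lam * (RtoC lam * D lam))%C by field.
      by rewrite X; ring.
  have S1 : S 1 = rect_int (fun w => f w / w)%C a c h.
    rewrite /S /rect_int /side; congr (_ + _ - _ - _)%C; apply: CInt_ext => // v _;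
      rewrite ?Pb ?Pr ?Pt ?Pl Cmult_1_l /Cdiv; ring.
  have S0 : S 0 = (f 0 * rect_int (fun w => / w) a c h)%C.
    have cinv p q al be : (forall v, al <= v <= be -> p + RtoC v * q <> 0)%C ->
        con al be (fun v => q * / (p + RtoC v * q))%C.
      move=> N v Hv; apply: ctn_mult; first by apply: ctn_const.
      by apply: ctn_inv; [apply: N | apply: ctn_line].
    have side0 p q al be : al <= be -> (forall v, al <= v <= be -> p + RtoC v * q <> 0)%C ->
        side f p q al be 0 = (f 0 * CInt (fun v => q * / (p + RtoC v * q)) al be)%C.
      move=> Hab N; rewrite -(CInt_scal al be) //; last by apply: cinv.
      by apply: CInt_ext => // v _; rewrite Cmult_0_l.
    rewrite /S !side0 // /rect_int.
    have X1 : CInt (fun v => 1 * / ((0%R, (- h)%R) + RtoC v * 1))%C (- a) c =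
      CInt (fun x => / (x, (- h)%R))%C (- a) c.
      by apply: CInt_ext => // v _; rewrite Pb; ring.
    have X2 : CInt (fun v => 1 * / ((0%R, h) + RtoC v * 1))%C (- a) c =
      CInt (fun x => / (x, h))%C (- a) c.
      by apply: CInt_ext => // v _; rewrite Pt; ring.
    have X3 : CInt (fun v => Ci * / (RtoC c + RtoC v * Ci))%C (- h) h =
      CInt (fun v => Ci * / (c, v))%C (- h) h.
      by apply: CInt_ext => // v _; rewrite Pr.
    have X4 : CInt (fun v => Ci * / (RtoC (- a) + RtoC v * Ci))%C (- h) h =
      CInt (fun v => Ci * / ((- a)%R, v))%C (- h) h.
      by apply: CInt_ext => // v _; rewrite Pl.
    rewrite X1 X2 X3 X4; ring.
  by rewrite -S1 HS S0 rect_int_inv //; ring.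
Qed.

(** * Linear growth of zeta to the right of the critical line *)

Lemma INR_S_pos (n : nat) : 1 <= INR n.+1.
Proof. by rewrite S_INR; have := pos_INR n; lra. Qed.

Lemma Rpower_pos (x y : R) : 0 < Rpower x y.
Proof. exact: exp_pos. Qed.

Lemma Rpower_ge0 (x y : R) : 0 <= Rpower x y.
Proof. by left; apply: Rpower_pos. Qed.

(** A discrete integral comparison: the induction carries the missing tail [x^(- d) / d] at
    [x = N + 1], and its step is [x^(- d) >= (x + 1)^(- d) (1 + d / (x + 1))], a consequence of
    [exp v >= 1 + v]. *)
Lemma Rpower_sum_bound (d : R) (N : nat) : 0 < d ->
  sum_n (fun n => Rpower (INR n.+1) (- (1 + d))) N <= 1 + / d.
Proof.
  move=> Hd; have Hid : 0 < / d by apply: Rinv_pos.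
  suff H : sum_n (fun n => Rpower (INR n.+1) (- (1 + d))) N <=
      1 + / d - / d * Rpower (INR N.+1) (- d).
    have := Rpower_pos (INR N.+1) (- d); nra.
  elim: N => [|N IH].
    by rewrite sum_O /Rpower ln_1 !Rmult_0_r exp_0; lra.
  rewrite sum_Sn; apply: Rle_trans (Rplus_le_compat_r _ _ _ IH) _.
  have Hx := INR_S_pos N; rewrite (S_INR N.+1); set x := INR N.+1 in Hx *.
  have Hl : ln x <= ln (x + 1) - / (x + 1).
    have := exp_ineq1_le (ln (x / (x + 1))).
    have Hq : 0 < x / (x + 1) by apply: Rdiv_pos_pos; lra.
    rewrite exp_ln // ln_div; try lra.
    have -> : x / (x + 1) = 1 - / (x + 1) by field; lra.
    lra.
  have H1 : Rpower (x + 1) (- d) * (1 + d * / (x + 1)) <= Rpower x (- d).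
    apply: (Rle_trans _ (Rpower (x + 1) (- d) * exp (d * / (x + 1)))).
      by apply: Rmult_le_compat_l; [exact: Rpower_ge0 | apply: exp_ineq1_le].
    by rewrite /Rpower -exp_plus; apply: exp_le; nra.
  have H2 : Rpower (x + 1) (- (1 + d)) = Rpower (x + 1) (- d) * / (x + 1).
    have -> : - (1 + d) = - d + Ropp 1 by ring.
    by rewrite Rpower_plus; congr (_ * _); rewrite Rpower_Ropp Rpower_1 //; lra.
  rewrite H2; move: H1; set p := Rpower (x + 1) _; set r := Rpower x _; set i := / (x + 1).
  move=> H1; apply: (Rmult_le_reg_l d) => //.
  have -> : d * (1 + / d - / d * p) = d + 1 - p by field; lra.
  have -> : d * (1 + / d - / d * r + p * i) = d + 1 - r + d * (p * i) by field; lra.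
  lra.
Qed.

Lemma ex_series_nonneg_bounded (b : nat -> R) (M : R) :
  (forall n, 0 <= b n) -> (forall N, sum_n b N <= M) -> ex_series b.
Proof.
  move=> H0 HM; have [l Hl] := ex_finite_lim_seq_incr (sum_n b) M
    (fun n => ltac:(rewrite sum_Sn /plus /=; have := H0 n.+1; lra)) HM.
  by exists l.
Qed.

Lemma ex_series_Rpower (d : R) : 0 < d ->
  ex_series (fun n => Rpower (INR n.+1) (- (1 + d))).
Proof.
  move=> Hd; apply: (ex_series_nonneg_bounded _ (1 + / d)) => n.
    exact: Rpower_ge0.
  exact: Rpower_sum_bound.
Qed.

Lemma sum_n_m_Cmod_le (u : nat -> C) (b : nat -> R) (N k : nat) :
  (forall n, Cmod (u n) <= b n) ->
  Cmod (sum_n u (N + k) - sum_n u N) <= sum_n b (N + k) - sum_n b N.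
Proof.
  move=> H; elim: k => [|k IH].
    rewrite addn0; have -> : (sum_n u N - sum_n u N = 0)%C by ring.
    by rewrite Cmod_0; lra.
  rewrite addnS !sum_Sn.
  have -> : (plus (sum_n u (N + k)) (u (N + k).+1) - sum_n u N =
    (sum_n u (N + k) - sum_n u N) + u (N + k).+1)%C by rewrite /plus /=; ring.
  apply: Rle_trans (Cmod_triangle _ _) _.
  by have := H (N + k)%nat.+1; rewrite [in X in _ -> X]/plus /=; lra.
Qed.

Lemma is_series_tail_le (u : nat -> C) (l : C) (b : nat -> R) (B : R) (N : nat) :
  is_seriesC u l ->
  (forall n, Cmod (u n) <= b n) -> is_series b B ->
  Cmod (l - sum_n u N) <= B - sum_n b N.
Proof.
  move=> Hu Hb HB; apply: le_epsilon => eps He.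
  have [M HM] := is_series_C_lim u l Hu eps He.
  have Hle : (M <= N + M)%coq_nat by apply/leP; apply: leq_addl.
  have -> : (l - sum_n u N = (sum_n u (N + M) - sum_n u N) - (sum_n u (N + M) - l))%C by ring.
  apply: Rle_trans (Cmod_minus_le _ _) _.
  have := HM _ Hle; have := sum_n_m_Cmod_le u b N M Hb.
  have Hb0 n : 0 <= b n by apply: Rle_trans (Hb n); apply: Cmod_ge_0.
  have := sum_n_le_is_series b B (N + M) Hb0 HB; lra.
Qed.

Lemma is_series_R_eps (b : nat -> R) (B eps : R) : is_series b B -> 0 < eps ->
  exists N : nat, forall n : nat, (N <= n)%nat -> Rabs (sum_n b n - B) < eps.
Proof.
  move=> /filterlim_locally H He; have [N HN] := H (mkposreal eps He).
  by exists N => n /leP /HN.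
Qed.

Lemma nat_Cpow_cexp (n : nat) (s : C) : nat_Cpow_opp n s = cexp (- s * RtoC (ln (INR n))).
Proof.
  apply: C_ext; rewrite /nat_Cpow_opp /cexp /Rpower /Re /Im /=.
  - by congr (exp _ * _); [ring | rewrite -cos_neg; congr cos; ring].
  - rewrite -Ropp_mult_distr_r_reverse -sin_neg; congr (exp _ * sin _); ring.
Qed.

Lemma Cmod_nat_Cpow (n : nat) (s : C) : Cmod (nat_Cpow_opp n s) = Rpower (INR n) (- Re s).
Proof. by rewrite nat_Cpow_cexp Cmod_cexp /Rpower /Re /=; congr exp; ring. Qed.

Definition cderive (f : R -> C) (x : R) (l : C) : Prop :=
  is_derive (fun u => Re (f u)) x (Re l) /\ is_derive (fun u => Im (f u)) x (Im l).

Lemma cderive_mvt (f df : R -> C) (a b M : R) : a <= b ->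
  (forall x, a <= x <= b -> cderive f x (df x) /\ Cmod (df x) <= M) ->
  Cmod (f b - f a) <= 2 * (M * (b - a)).
Proof.
  move=> Hab H.
  have X (phi : C -> R) : (forall x y, phi (x - y)%C = phi x - phi y) ->
      (forall x, Rabs (phi x) <= Cmod x) ->
      (forall x, a <= x <= b -> is_derive (fun u => phi (f u)) x (phi (df x))) ->
      Rabs (phi (f b - f a)%C) <= M * (b - a).
    move=> P1 P2 P3.
    have [c [Hc1 Hc2]] := mean_value (fun u => phi (f u)) (fun x => phi (df x)) a b
      (fun x Hx => P3 x (ltac:(move: Hx; rewrite Rmin_left ?Rmax_right; lra))).
    rewrite P1 Hc2 Rabs_mult (Rabs_pos_eq (b - a)); last lra.
    rewrite Rmin_left // Rmax_right // in Hc1.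
    apply: Rmult_le_compat_r; first lra.
    by apply: Rle_trans (P2 _) _; have [] := H c Hc1.
  apply: Rle_trans (Cmod_le_sum _) _.
  have := X Re (fun _ _ => erefl) re_le_Cmod (fun x Hx => proj1 (proj1 (H x Hx))).
  have := X Im (fun _ _ => erefl) im_le_Cmod (fun x Hx => proj2 (proj1 (H x Hx))).
  lra.
Qed.

Lemma cderive_mult (f g : R -> C) (x : R) (df dg : C) :
  cderive f x df -> cderive g x dg -> cderive (fun u => f u * g u)%C x (df * g x + f x * dg)%C.
Proof.
  have M (u v : R -> R) du dv : is_derive u x du -> is_derive v x dv ->
      is_derive (fun t => u t * v t) x (du * v x + u x * dv).
    by move=> U V; apply: (is_derive_mult u v x du dv U V) => n m; apply: Rmult_comm.
  move=> [F1 F2] [G1 G2]; split.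
  - have -> : Re (df * g x + f x * dg)%C =
      (Re df * Re (g x) + Re (f x) * Re dg) - (Im df * Im (g x) + Im (f x) * Im dg).
      by rewrite /Re /Im /=; ring.
    by apply: (is_derive_minus (V := R_NormedModule)); apply: M.
  - have -> : Im (df * g x + f x * dg)%C =
      (Re df * Im (g x) + Re (f x) * Im dg) + (Im df * Re (g x) + Im (f x) * Re dg).
      by rewrite /Re /Im /=; ring.
    by apply: (is_derive_plus (V := R_NormedModule)); apply: M.
Qed.

Lemma cderive_plus (f g : R -> C) (x : R) (df dg : C) :
  cderive f x df -> cderive g x dg -> cderive (fun u => f u + g u)%C x (df + dg)%C.
Proof.
  by move=> [F1 F2] [G1 G2]; split; apply: (is_derive_plus (V := R_NormedModule)).
Qed.

Lemma cderive_const (c : C) (x : R) : cderive (fun _ => c) x 0.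
Proof. by split; apply: (is_derive_const (V := R_NormedModule)). Qed.

Lemma cderive_cexp_ln (z : C) (x : R) : 0 < x ->
  cderive (fun u => cexp (z * RtoC (ln u))) x (cexp (z * RtoC (ln x)) * (z * RtoC (/ x)))%C.
Proof.
  move=> Hx; case: z => a b; split; rewrite /cexp /Re /Im /=.
  - by auto_derive; [| rewrite /Rminus; field; lra].
  - by auto_derive; [| rewrite /Rminus; field; lra].
Qed.

(** The Euler-Maclaurin approximation of lowest order: the first [N + 1] terms of the series plus
    the integral of [x^(- s)] over [x >= N + 1], continued analytically as
    [(N + 1)^(1 - s) / (s - 1)]. *)
Definition em_sum (N : nat) (s : C) : C :=
  (sum_n (fun n => nat_Cpow_opp n.+1 s) N +
   cexp ((1 - s) * RtoC (ln (INR N.+1))) * / (s - 1))%C.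

Lemma em_sum_step (N : nat) (s : C) : s <> 1 -> 0 <= Re s ->
  Cmod (em_sum N.+1 s - em_sum N s) <= 2 * (Cmod s * Rpower (INR N.+1) (- (1 + Re s))).
Proof.
  move=> Hs Hre; set x0 := INR N.+1.
  have Hx0 : 1 <= x0 by apply: INR_S_pos.
  have Hs1 : (s - 1 <> 0)%C.
    by move=> E; apply: Hs; have -> : (s = (s - 1) + 1)%C; [ring | rewrite E; ring].
  (* [phi] interpolates the two consecutive sums, up to their common terms, between [x0] and
     [x0 + 1]. In its derivative the terms [x^(- s)] cancel and only [- s (x - x0) x^(- s - 1)] is
     left. *)
  pose phi (x : R) := ((RtoC x - RtoC x0) * cexp (- s * RtoC (ln x)) +
     cexp ((1 - s) * RtoC (ln x)) * / (s - 1))%C.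
  pose dphi (x : R) := (- (RtoC x - RtoC x0) * s * RtoC (/ x) * cexp (- s * RtoC (ln x)))%C.
  have -> : (em_sum N.+1 s - em_sum N s = phi (x0 + 1)%R - phi x0)%C.
    rewrite /em_sum /phi sum_Sn (nat_Cpow_cexp N.+2) (S_INR N.+1) -/x0 RtoC_plus /plus /=.
    by ring.
  have -> : Cmod s * Rpower x0 (- (1 + Re s)) =
    (Cmod s * Rpower x0 (- (1 + Re s))) * (x0 + 1 - x0) by ring.
  apply: (cderive_mvt phi dphi); first lra.
  move=> x Hx; split.
  - have Hxp : 0 < x by lra.
    have D1 : cderive (fun u => RtoC u - RtoC x0)%C x 1.
      by split; rewrite /Re /Im /=; auto_derive; done || ring.
    have D := cderive_plus _ _ x _ _ (cderive_mult _ _ x _ _ D1 (cderive_cexp_ln (- s) x Hxp))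
      (cderive_mult _ _ x _ _ (cderive_cexp_ln (1 - s) x Hxp) (cderive_const (/ (s - 1)) x)).
    apply: (eq_ind _ (cderive phi x) D); rewrite /dphi.
    have -> : cexp ((1 - s) * RtoC (ln x)) = (RtoC x * cexp (- s * RtoC (ln x)))%C.
      have -> : ((1 - s) * RtoC (ln x) = RtoC (ln x) + - s * RtoC (ln x))%C by ring.
      rewrite cexp_plus; congr (_ * _)%C; apply: C_ext; rewrite /cexp /Re /Im /=.
        by rewrite cos_0 exp_ln //; ring.
      by rewrite sin_0; ring.
    have Nx : RtoC x <> 0 by move=> /(f_equal fst) /=; lra.
    rewrite RtoC_inv; last lra.
    by field; split.
  - rewrite /dphi !Cmod_mult Cmod_opp -RtoC_minus !Cmod_R Cmod_cexp.
    have -> : Re (- s * RtoC (ln x)) = - Re s * ln x by rewrite /Re /Im /=; ring.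
    have Hlt : 0 < / x by apply: Rinv_pos; lra.
    rewrite !Rabs_pos_eq; try lra.
    have -> : (x - x0) * Cmod s * / x * exp (- Re s * ln x) =
      Cmod s * ((x - x0) * (/ x * exp (- Re s * ln x))) by ring.
    apply: Rmult_le_compat_l; first exact: Cmod_ge_0.
    apply: (Rle_trans _ (1 * (/ x * exp (- Re s * ln x)))).
      apply: Rmult_le_compat_r; last lra.
      by apply: Rmult_le_pos; [lra | exact: exp_ge0].
    rewrite Rmult_1_l.
    have -> : / x = exp (- ln x) by rewrite exp_Ropp exp_ln; lra.
    rewrite -exp_plus /Rpower; apply: exp_le.
    have : ln x0 <= ln x by apply: ln_le; lra.
    nra.
Qed.

(** Summing the steps gives [2 |s|] times a series with exponent [5 / 4], whose sum is at most 5;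
    the case [N = 0] contributes 2, and [|s| >= 1] turns [2 + 10 |s|] into [12 |s|]. The point is
    uniformity in [N]. *)
Lemma em_sum_bound (N : nat) (s : C) : 1 / 4 <= Re s -> 1 <= Im s ->
  Cmod (em_sum N s) <= 12 * Cmod s.
Proof.
  move=> Hre Him.
  have Hs1 : 1 <= Cmod s.
    by apply: Rle_trans (im_le_Cmod s); apply: Rle_trans (Rle_abs _).
  have Hs2 : 1 <= Cmod (s - 1).
    apply: Rle_trans (im_le_Cmod _); apply: Rle_trans (Rle_abs _).
    by rewrite /Im /= in Him *; lra.
  have Ns1 : (s - 1 <> 0)%C by apply/Cmod_gt_0; lra.
  have Ns : s <> 1.
    by move=> E; apply: Ns1; rewrite E; ring.
  pose r (n : nat) := Rpower (INR n.+1) (- (1 + 1 / 4)).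
  have S : Cmod (em_sum N s) <= 2 + 2 * Cmod s * (sum_n r N - r N).
    elim: N => [|N IH].
      rewrite /em_sum !sum_O; apply: (Rle_trans _ 2); last lra.
      apply: Rle_trans (Cmod_triangle _ _) _.
      rewrite Cmod_nat_Cpow Cmod_mult Cmod_cexp Cmod_inv // /Rpower [INR 1]/=.
      rewrite ln_1 Rmult_0_r exp_0.
      have -> : Re ((1 - s) * 0) = 0 by rewrite /Re /=; ring.
      rewrite exp_0; have : / Cmod (s - 1) <= / 1 by apply: Rinv_le_contravar; lra.
      by rewrite Rinv_1; lra.
    have -> : em_sum N.+1 s = (em_sum N s + (em_sum N.+1 s - em_sum N s))%C by ring.
    apply: Rle_trans (Cmod_triangle _ _) _; rewrite sum_Sn.
    have X := em_sum_step N s Ns by_lra.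
    have Y : Rpower (INR N.+1) (- (1 + Re s)) <= r N.
      apply: Rle_Rpower; [exact: INR_S_pos | lra].
    have Z := Rmult_le_compat_l _ _ _ (Cmod_ge_0 s) Y.
    have E : plus (sum_n r N) (r N.+1) = sum_n r N + r N.+1 by [].
    by rewrite E; lra.
  have r0 : 0 < r N by apply: Rpower_pos.
  have S5 : sum_n r N <= 1 + / (1 / 4) := Rpower_sum_bound (1 / 4) N by_lra.
  have E5 : 1 + / (1 / 4) = 5 by field.
  have : 2 * Cmod s * (sum_n r N - r N) <= 2 * Cmod s * 5.
    by apply: Rmult_le_compat_l; lra.
  lra.
Qed.

(** The working form of Cauchy's formula: the factor [i] of the vertical sides is divided out, and
    the horizontal sides become an error term, where the denominator satisfies [|w| >= h]. *)
Lemma cauchy_rect_split (f : C -> C) (a c h B : R) : 0 < a -> 0 < c -> 0 < h ->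
  (forall x y, - a <= x <= c -> - h <= y <= h -> holo f (x, y)) ->
  (forall x, - a <= x <= c -> Cmod (f (x, h)) <= B /\ Cmod (f (x, (- h)%R)) <= B) ->
  Cmod (CInt (fun v => f (c, v) / (c, v)) (- h) h - RtoC (2 * PI) * f 0 -
    CInt (fun v => f ((- a)%R, v) / ((- a)%R, v)) (- h) h)%C <= 4 * ((c + a) * (B / h)).
Proof.
  move=> Ha Hc Hh H HB.
  have Hac : - a <= c by lra.
  have Hhh : - h <= h by lra.
  have cv (x : R) : - a <= x <= c -> x <> 0 ->
      con (- h) h (fun v => f (x, v) / (x, v))%C.
    move=> Hx Hx0 v Hv; have cp := ctn_vert x v.
    apply: ctn_div => //; last by apply: pair_neq0; left.
    by apply: holo_ctn => //; apply: H.
  have ch (y : R) : - h <= y <= h -> y <> 0 ->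
      con (- a) c (fun x => f (x, y) / (x, y))%C.
    move=> Hy Hy0 x Hx; have cp := ctn_horiz y x.
    apply: ctn_div => //; last by apply: pair_neq0; right.
    by apply: (holo_ctn f (fun x => (x, y))) => //; apply: H.
  have := cauchy_rect f a c h Ha Hc Hh H; rewrite /rect_int.
  rewrite !(CInt_scal (- h) h) //; try (apply: cv; lra).
  set r := CInt (fun v => f (c, v) / _)%C _ _; set l := CInt (fun v => f ((- a)%R, v) / _)%C _ _.
  set t := CInt (fun x => f (x, h) / _)%C _ _; set b := CInt _ _ _ => E.
  have bnd y : y = h \/ y = - h -> Cmod (CInt (fun x => f (x, y) / (x, y)) (- a) c)%C <=
      2 * ((c - - a) * (B / h)).
    move=> Hy; apply: CInt_bound_const => //.
      by apply: ch; case: Hy => ->; lra.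
    move=> x Hx; have [B1 B2] := HB x Hx; apply: Cmod_div_le => //; last by case: Hy => ->.
    apply: Rle_trans (im_le_Cmod _).
    by rewrite /Im /=; case: Hy => ->; rewrite ?Rabs_Ropp Rabs_pos_eq; lra.
  have -> : (r - RtoC (2 * PI) * f 0 - l = Ci * (b - t))%C.
    have C2 : (Ci * Ci = - (1))%C by apply: C_ext; rewrite /Re /Im /=; ring.
    have -> : (r - RtoC (2 * PI) * f 0 - l = (Ci * Ci) * (l + (RtoC (2 * PI) * f 0) - r))%C.
      by rewrite C2; ring.
    have -> : (Ci * Ci * (l + RtoC (2 * PI) * f 0 - r) =
      Ci * (Ci * l + RtoC (2 * PI) * Ci * f 0 - Ci * r))%C by ring.
    by rewrite -E; ring.
  rewrite Cmod_mult Cmod_Ci Rmult_1_l; apply: Rle_trans (Cmod_minus_le _ _) _.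
  have := bnd h (or_introl erefl); have := bnd (- h) (or_intror erefl); rewrite -/b -/t; lra.
Qed.

Lemma holo_ext (f g : C -> C) (z0 : C) : (forall z, f z = g z) -> holo f z0 -> holo g z0.
Proof.
  move=> E [r [K [d [Hr [HK H]]]]]; exists r, K, d; do 2 split => //.
  by move=> y z; rewrite -!E; apply: H.
Qed.

Lemma holo_sum (F : nat -> C -> C) (N : nat) (z0 : C) :
  (forall n, holo (F n) z0) -> holo (fun z => sum_n (fun n => F n z) N) z0.
Proof.
  move=> H; elim: N => [|N IH].
    by apply: holo_ext (H O) => z; rewrite sum_O.
  by apply: holo_ext (holo_plus _ _ _ IH (H N.+1)) => z; rewrite sum_Sn.
Qed.

Lemma holo_linear (a b z0 : C) : holo (fun z => a + b * z)%C z0.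
Proof.
  apply: holo_plus; first by apply: holo_const.
  by apply: holo_mult; [apply: holo_const | apply: holo_id].
Qed.

Lemma holo_nat_Cpow (n : nat) (z0 : C) : holo (nat_Cpow_opp n) z0.
Proof.
  apply: (holo_ext (fun s => cexp (0 + (- RtoC (ln (INR n))) * s)%C)).
    by move=> z; rewrite nat_Cpow_cexp; congr cexp; ring.
  by apply: holo_cexp; apply: holo_linear.
Qed.

Lemma holo_em_sum (N : nat) (z0 : C) : z0 <> 1 -> holo (em_sum N) z0.
Proof.
  move=> H; apply: holo_plus.
    by apply: holo_sum => n; apply: holo_nat_Cpow.
  apply: holo_mult.
    apply: holo_cexp; apply: (holo_ext (fun s => RtoC (ln (INR N.+1)) + (- RtoC (ln (INR N.+1))) * s)%C).
      by move=> z; ring.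
    exact: holo_linear.
  have N1 : (z0 - 1 <> 0)%C.
    by move=> E; apply: H; have -> : (z0 = (z0 - 1) + 1)%C; [ring | rewrite E; ring].
  have [r [K [g [Hr [HK X]]]]] := holo_inv _ N1.
  exists r, K, (fun z => g (z - 1)%C); do 2 split => //.
  move=> y z Hy Hz; have := X (y - 1)%C (z - 1)%C.
  have E a b : (a - 1 - (b - 1) = a - b)%C by ring.
  by rewrite !E; apply.
Qed.

Lemma continuous_bounded (h : R -> R) (a b : R) : a <= b ->
  (forall t, a <= t <= b -> continuous h t) -> exists M, forall t, a <= t <= b -> h t <= M.
Proof.
  move=> Hab H.
  have [x Hx] := continuity_ab_maj h a b Hab
    (fun t Ht => proj2 (continuity_pt_filterlim h t) (H t Ht)).
  by exists (h x) => t Ht; apply: (proj1 Hx).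
Qed.

(** * Comparison of zeta with its Euler-Maclaurin sums *)

Section ZetaGrowth.
Variable zeta : C -> C.
Hypothesis Hzeta : is_riemann_zeta zeta.

Lemma zeta_holo (s : C) : s <> 1 -> holo zeta s.
Proof. by move=> /(proj2 Hzeta) /analytic_at_holo. Qed.

Lemma Im_neq1 (s : C) : 0 < Im s -> s <> 1.
Proof. by move=> H E; move: H; rewrite E /Im /=; lra. Qed.

Lemma zeta_tail (eps : R) : 0 < eps -> exists N : nat, forall n : nat, (N <= n)%nat ->
  forall s, 2 <= Re s -> Cmod (zeta s - sum_n (fun j => nat_Cpow_opp j.+1 s) n) <= eps.
Proof.
  move=> He; have [B HB] := ex_series_Rpower 1 Rlt_0_1.
  have [N HN] := is_series_R_eps _ _ eps HB He.
  exists N => n Hn s Hs; have /Rabs_def2 [_ X] := HN n Hn.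
  have T := is_series_tail_le _ _ _ _ n (proj1 Hzeta s by_lra) (fun j => ltac:(
    rewrite Cmod_nat_Cpow; apply: (Rle_Rpower _ _ (- (1 + 1))); [exact: INR_S_pos | lra])) HB.
  lra.
Qed.

Lemma zeta_near_em_sum (eps : R) : 0 < eps -> exists N : nat, forall s, 2 <= Re s -> 1 <= Im s ->
  Cmod (zeta s - em_sum N s) <= eps.
Proof.
  move=> He; have [N1 HN1] := zeta_tail (eps / 2) by_lra.
  have [N2 HN2] := INR_unbounded (2 / eps).
  pose N := (N1 + N2)%nat; exists N => s Hre Him.
  have Ns1 : 1 <= Cmod (s - 1).
    apply: Rle_trans (im_le_Cmod _); apply: Rle_trans (Rle_abs _).
    by rewrite /Im /= in Him *; lra.
  have Ns2 : (s - 1 <> 0)%C by apply/Cmod_gt_0; lra.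
  have {}HN1 := HN1 N (leq_addr _ _) s Hre.
  have -> : (zeta s - em_sum N s = (zeta s - sum_n (fun n => nat_Cpow_opp n.+1 s) N) -
    cexp ((1 - s) * RtoC (ln (INR N.+1))) * / (s - 1))%C by rewrite /em_sum; ring.
  apply: Rle_trans (Cmod_minus_le _ _) _.
  rewrite (Cmod_mult (cexp _)) Cmod_inv // Cmod_cexp.
  have -> : Re ((1 - s) * RtoC (ln (INR N.+1))) = (1 - Re s) * ln (INR N.+1).
    by rewrite /Re /Im /=; ring.
  have HNp := INR_S_pos N.
  have L : 0 <= ln (INR N.+1) by rewrite -ln_1; apply: ln_le; lra.
  have X : exp ((1 - Re s) * ln (INR N.+1)) <= / INR N.+1.
    have -> : / INR N.+1 = exp (- ln (INR N.+1)) by rewrite exp_Ropp exp_ln; lra.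
    by apply: exp_le; nra.
  have Y := Rinv_le_contravar 1 _ Rlt_0_1 Ns1; rewrite Rinv_1 in Y.
  have Y0 : 0 < / Cmod (s - 1) by apply: Rinv_pos; lra.
  have Z : / INR N.+1 <= eps / 2.
    have -> : eps / 2 = / (2 / eps) by field; lra.
    apply: Rinv_le_contravar; first by apply: Rdiv_pos_pos; lra.
    have : INR N2 <= INR N.+1 by apply: le_INR; apply/leP; apply: leq_trans (leq_addl N1 N2) (leqnSn _).
    lra.
  have E0 := exp_pos ((1 - Re s) * ln (INR N.+1)).
  nra.
Qed.

(** The sums [em_sum N] are bounded uniformly in [N], but are known to be close to zeta only where
    the Dirichlet series converges. Cauchy's formula around [s] carries this closeness to the left.
    The rectangle reaches far enough right for [Re (s + w) >= 2], while its height 4 keeps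
    [Im (s + w) >= 1], away from the pole. The sides on which only boundedness is known are made
    small by the kernel. *)
Lemma zeta_growth (s : C) : 1 / 2 <= Re s -> 5 <= Im s -> Cmod (zeta s) <= 12 * Cmod s.
Proof.
  move=> Hre Him.
  have Hpt x y : - (1 / 4) <= x <= 3 / 2 -> -4 <= y <= 4 ->
      1 / 4 <= Re (s + (x, y)) /\ 1 <= Im (s + (x, y)).
    by move: Hre Him; rewrite /Re /Im /= => *; lra.
  have Nz x y : - (1 / 4) <= x <= 3 / 2 -> -4 <= y <= 4 -> (s + (x, y))%C <> 1.
    by move=> Hx Hy; apply: Im_neq1; have [] := Hpt x y Hx Hy; lra.
  have Hz x y : - (1 / 4) <= x <= 3 / 2 -> -4 <= y <= 4 -> holo zeta (s + (x, y))%C.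
    by move=> Hx Hy; apply: zeta_holo; apply: Nz.
  have bv x : - (1 / 4) <= x <= 3 / 2 -> exists B, forall y, -4 <= y <= 4 ->
      Cmod (zeta (s + (x, y))%C) <= B.
    move=> Hx; apply: continuous_bounded; first lra.
    move=> t Ht; apply: ctn_Cmod; apply: (holo_ctn zeta (fun y => s + (x, y))%C); first by apply: Hz.
    apply: ctn_plus; first by apply: ctn_const.
    exact: ctn_vert.
  have bh y : -4 <= y <= 4 -> exists B, forall x, - (1 / 4) <= x <= 3 / 2 ->
      Cmod (zeta (s + (x, y))%C) <= B.
    move=> Hy; apply: continuous_bounded; first lra.
    move=> t Ht; apply: ctn_Cmod; apply: (holo_ctn zeta (fun x => s + (x, y))%C); first by apply: Hz.
    apply: ctn_plus; first by apply: ctn_const.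
    exact: ctn_horiz.
  have [B1 HB1] := bv (- (1 / 4)) by_lra.
  have [B2 HB2] := bh 4 by_lra.
  have [B3 HB3] := bh (-4) by_lra.
  pose B := Rabs B1 + Rabs B2 + Rabs B3 + 12 * (Cmod s + 6).
  have Hsm x y : - (1 / 4) <= x <= 3 / 2 -> -4 <= y <= 4 -> Cmod (s + (x, y)) <= Cmod s + 6.
    move=> Hx Hy; apply: Rle_trans (Cmod_triangle _ _) _; apply: Rplus_le_compat_l.
    apply: Rle_trans (Cmod_le_sum _) _; rewrite /Re /Im /=.
    by rewrite /Rabs; do 2 case: Rcase_abs; lra.
  have em x y N : - (1 / 4) <= x <= 3 / 2 -> -4 <= y <= 4 ->
      Cmod (em_sum N (s + (x, y))) <= 12 * (Cmod s + 6).
    move=> Hx Hy; have [A1 A2] := Hpt x y Hx Hy.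
    apply: Rle_trans (em_sum_bound N _ A1 A2) _; have := Hsm x y Hx Hy; lra.
  have B0 : 0 <= B.
    have := Rabs_pos B1; have := Rabs_pos B2; have := Rabs_pos B3; have := Cmod_ge_0 s.
    rewrite /B; lra.
  apply: le_epsilon => eps He.
  (* The kernel [exp(M(w + w^2))] is exponentially small on three sides; on the
     fourth side the Dirichlet series converges. *)
  pose M := 16 / 3 * (40 * (B + 1) / eps).
  have HM : 0 < M.
    apply: Rmult_lt_0_compat; first lra.
    by apply: Rdiv_pos_pos; lra.
  (* On the left side [x = - 1 / 4] the exponent [x + x^2 - y^2] is at most [- 3 / 16]; on the
     horizontal sides it is far smaller. *)
  have HexpM : B * exp (- (3 / 16 * M)) <= eps / 40.
    have Q : exp (- (3 / 16 * M)) <= / (40 * (B + 1) / eps).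
      rewrite exp_Ropp; apply: Rinv_le_contravar.
        by apply: Rdiv_pos_pos; lra.
      apply: Rle_trans (exp_ineq1_le _).
      have -> : 3 / 16 * M = 40 * (B + 1) / eps by rewrite /M; field; lra.
      lra.
    have E0 := exp_pos (- (3 / 16 * M)).
    apply: (Rle_trans _ ((B + 1) * / (40 * (B + 1) / eps))).
      by apply: Rmult_le_compat; lra.
    by right; field; lra.
  (* [N] is chosen after [M]: on the right side the kernel can be as large as [exp (4 * M)], since
     [3 / 2 + 9 / 4 <= 4]. The bound [B] used for [M] does not involve [N], so there is no
     circularity. *)
  have [N HN] := zeta_near_em_sum (eps / 40 * exp (- (4 * M)))
    (ltac:(apply: Rmult_lt_0_compat; [lra | apply: exp_pos])).
  pose f w := ((zeta (s + w) - em_sum N (s + w)) * cexp (RtoC M * (w + w * w)))%C.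
  have Hker x y : Cmod (cexp (RtoC M * ((x, y) + (x, y) * (x, y)))) =
      exp (M * (x + (x * x - y * y))).
    by rewrite Cmod_cexp; congr exp; rewrite /Re /Im /=; ring.
  have Hf x y : - (1 / 4) <= x <= 3 / 2 -> -4 <= y <= 4 -> holo f (x, y).
    move=> Hx Hy; apply: holo_mult.
      apply: holo_plus; first by apply: holo_shift; apply: Hz.
      apply: holo_opp; apply: (holo_shift (em_sum N)).
      by apply: holo_em_sum; apply: Nz.
    apply: holo_cexp; apply: holo_mult; first by apply: holo_const.
    by apply: holo_plus; [apply: holo_id | apply: holo_mult; apply: holo_id].
  have small x y : - (1 / 4) <= x <= 3 / 2 -> -4 <= y <= 4 ->
      Cmod (zeta (s + (x, y))%C) <= Rabs B1 + Rabs B2 + Rabs B3 ->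
      x + (x * x - y * y) <= - (3 / 16) -> Cmod (f (x, y)) <= eps / 40.
    move=> Hx Hy HzB Hxy; rewrite /f Cmod_mult Hker.
    apply: Rle_trans HexpM; apply: Rmult_le_compat.
    - exact: Cmod_ge_0.
    - exact: exp_ge0.
    - apply: Rle_trans (Cmod_minus_le _ _) _.
      by have := em x y N Hx Hy; rewrite /B; lra.
    - by apply: exp_le; nra.
  have R1 := Rle_abs B1; have R2 := Rle_abs B2; have R3 := Rle_abs B3.
  have P1 := Rabs_pos B1; have P2 := Rabs_pos B2; have P3 := Rabs_pos B3.
  have Key := cauchy_rect_split f (1 / 4) (3 / 2) 4 (eps / 40) by_lra by_lra by_lra
    (fun x y Hx Hy => Hf x y by_lra by_lra)
    (fun x Hx => conj
      (small x 4 by_lra by_lra (ltac:(have := HB2 x by_lra; lra)) (ltac:(nra)))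
      (small x (-4) by_lra by_lra (ltac:(have := HB3 x by_lra; lra)) (ltac:(nra)))).
  have side_bound x : - (1 / 4) <= x <= 3 / 2 -> 1 / 4 <= Rabs x ->
      (forall y, -4 <= y <= 4 -> Cmod (f (x, y)) <= eps / 40) ->
      Cmod (CInt (fun v => f (x, v) / (x, v))%C (-4) 4) <= 2 * ((4 - -4) * (eps / 40 / (1 / 4))).
    move=> Hx Hx0 Hb; have N0 : x <> 0 by move=> E; rewrite E Rabs_R0 in Hx0; lra.
    apply: CInt_bound_const; first lra.
      move=> v Hv; have cp := ctn_vert x v.
      by apply: ctn_div; [apply: holo_ctn => //; apply: Hf | | apply: pair_neq0; left].
    move=> v Hv; apply: Cmod_div_le; [lra | | exact: Hb].
    exact: Rle_trans Hx0 (re_le_Cmod (x, v)).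
  have SL := side_bound (- (1 / 4)) by_lra (ltac:(rewrite Rabs_Ropp Rabs_pos_eq; lra))
    (fun y Hy => small (- (1 / 4)) y by_lra Hy (ltac:(have := HB1 y Hy; lra)) (ltac:(nra))).
  have SR : Cmod (CInt (fun v => f ((3 / 2)%R, v) / ((3 / 2)%R, v))%C (-4) 4) <=
      2 * ((4 - -4) * (eps / 40 / (1 / 4))).
    apply: side_bound; [lra | rewrite Rabs_pos_eq; lra |] => y Hy.
    rewrite /f Cmod_mult Hker.
    have [_ Q2] := Hpt (3 / 2) y by_lra Hy.
    have Q1 := HN (s + ((3 / 2)%R, y))%C (ltac:(move: Hre; rewrite /Re /=; lra)) Q2.
    apply: (Rle_trans _ (eps / 40 * exp (- (4 * M)) * exp (4 * M))); last first.
      by rewrite Rmult_assoc -exp_plus Rplus_opp_l exp_0; lra.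
    apply: Rmult_le_compat => //; [exact: Cmod_ge_0 | exact: exp_ge0 |].
    by apply: exp_le; nra.
  have F0 : f 0 = (zeta s - em_sum N s)%C.
    rewrite /f; have -> : (s + 0 = s)%C by ring.
    have -> : (RtoC M * (0 + 0 * 0) = 0)%C by ring.
    by rewrite cexp_0; ring.
  rewrite F0 in Key; move: Key SL SR.
  set Rr := CInt (fun v => f ((3 / 2)%R, v) / _)%C _ _.
  set L := CInt (fun v => f ((- (1 / 4))%R, v) / _)%C _ _.
  move=> Key SL SR.
  have PIp : 3 < PI by have := PI2_3_2; lra.
  have T : 2 * PI * Cmod (zeta s - em_sum N s) <= 6 * eps.
    have -> : 2 * PI * Cmod (zeta s - em_sum N s) = Cmod (RtoC (2 * PI) * (zeta s - em_sum N s)).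
      by rewrite Cmod_mult Cmod_R Rabs_pos_eq; lra.
    set X := (RtoC (2 * PI) * (zeta s - em_sum N s))%C in Key *.
    have -> : (X = (Rr - L) - (Rr - X - L))%C by ring.
    apply: Rle_trans (Cmod_minus_le _ _) _.
    have := Cmod_minus_le Rr L; lra.
  have := em_sum_bound N s by_lra by_lra.
  have := Cmod_ge_0 (zeta s - em_sum N s).
  have : Cmod (zeta s) <= Cmod (em_sum N s) + Cmod (zeta s - em_sum N s).
    have {1}-> : (zeta s = em_sum N s + (zeta s - em_sum N s))%C by ring.
    exact: Cmod_triangle.
  nra.
Qed.
End ZetaGrowth.

(** * The divisor bound *)

(* Importing [Reals] rebinds [^] on [nat] to [Nat.pow]. *)
Local Notation "m ^ n" := (expn m n) : nat_scope.

(** Each divisor of [m p^a] is a divisor of [m] times [p^i] with [i <= a]. The inequality is all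
    that is needed, so only this covering is shown. *)
Lemma size_divisors_mul_pfactor (p a m : nat) : prime p -> coprime p m -> (0 < m)%nat ->
  (size (divisors (m * p ^ a)) <= a.+1 * size (divisors m))%nat.
Proof.
  move=> Hp Hc Hm; have Hpa : (0 < p ^ a)%nat by rewrite expn_gt0 prime_gt0.
  pose s := [seq (e * p ^ i)%nat | e <- divisors m, i <- seq.iota O a.+1].
  have -> : (a.+1 * size (divisors m))%nat = size s.
    by rewrite size_allpairs size_iota mulnC.
  apply: uniq_leq_size; first exact: divisors_uniq.
  move=> x; rewrite -dvdn_divisors ?muln_gt0 ?Hm // => Hx.
  have Hx0 : (0 < x)%nat by apply: dvdn_gt0 Hx; rewrite muln_gt0 Hm.
  have [y Hy E] := pfactor_coprime Hp Hx0.
  apply/allpairsP; exists (y, logn p x); split; last by [].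
  - rewrite [(_, _).1]/= -dvdn_divisors // -(Gauss_dvdl _ (_ : coprime y (p ^ a))).
      by apply: dvdn_trans Hx; rewrite {1}E dvdn_mulr.
    by rewrite coprime_sym coprimeXl.
  - rewrite mem_iota [(_, _).2]/= leq0n add0n ltnS.
    have X : (p ^ logn p x %| p ^ a)%nat.
      have X0 : coprime (p ^ logn p x) m by rewrite coprimeXl.
      rewrite -(Gauss_dvdr _ X0).
      by apply: dvdn_trans Hx; rewrite {2}E dvdn_mull.
    by rewrite dvdn_Pexp2l ?prime_gt1 in X.
Qed.

Lemma INR_expn (p a : nat) : INR (p ^ a)%nat = INR p ^ a.
Proof. by elim: a => [|a IH] //; rewrite expnS mult_INR IH. Qed.

Lemma Rpower_mult_INR (x d : R) (a : nat) : 0 < x -> Rpower (x ^ a) d = Rpower x (INR a * d).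
Proof. by move=> Hx; rewrite -Rpower_pow // Rpower_mult. Qed.

Lemma Rpower_ge1 (x d : R) : 1 <= x -> 0 <= d -> 1 <= Rpower x d.
Proof. by move=> Hx Hd; rewrite -(Rpower_O x); [apply: Rle_Rpower | lra]. Qed.

Lemma Rpower_prod (x y d : R) : 0 < x -> 0 < y -> Rpower (x * y) d = Rpower x d * Rpower y d.
Proof. by move=> Hx Hy; rewrite /Rpower ln_mult // -exp_plus; congr exp; ring. Qed.

Section DivisorBound.
Variable d : R.
Hypothesis Hd : 0 < d.

Definition tau_le (K : R) (n : nat) : Prop := INR (size (divisors n)) <= K * Rpower (INR n) d.

(** Splitting off the full power of one prime [p] multiplies the constant by [C], the price at which
    [a + 1] is bounded by [p^(a d)] for all [a]. *)
Lemma tau_step (K C : R) (n p : nat) : 0 <= K -> 0 <= C ->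
  (forall a, INR a.+1 <= C * Rpower (INR p ^ a) d) ->
  prime p -> (0 < n)%nat -> (forall m, (0 < m)%nat -> (m %| n)%nat -> coprime p m -> tau_le K m) ->
  tau_le (C * K) n.
Proof.
  move=> HK HC Ha Hp Hn Hm.
  have [m Hc E] := pfactor_coprime Hp Hn.
  have Hm0 : (0 < m)%nat by move: Hn; rewrite E muln_gt0 => /andP [].
  have Km : tau_le K m.
    by apply: Hm => //; rewrite {1}E dvdn_mulr.
  have X := size_divisors_mul_pfactor p (logn p n) m Hp Hc Hm0.
  have Hpp : 0 < INR p by apply: lt_0_INR; apply/ltP; apply: prime_gt0.
  have Hmm : 0 < INR m by apply: lt_0_INR; apply/ltP.
  move: E X; set a := logn p n => E X; rewrite /tau_le E.
  apply: (Rle_trans _ (INR a.+1 * INR (size (divisors m)))).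
    by rewrite -mult_INR; apply: le_INR; apply/leP.
  rewrite mult_INR INR_expn Rpower_prod //; last by apply: pow_lt.
  apply: (Rle_trans _ ((C * Rpower (INR p ^ a) d) * (K * Rpower (INR m) d))).
    by apply: Rmult_le_compat => //; apply: pos_INR.
  by right; ring.
Qed.

(** Bernoulli's inequality in the form [p^(a d) >= 1 + a d log 2]. The constant is the price of one
    small prime and does not depend on that prime. *)
Lemma linear_le_exp (a : nat) (p : R) : 2 <= p ->
  INR a.+1 <= (1 + / (d * ln 2)) * Rpower (p ^ a) d.
Proof.
  move=> Hp; have L2 : 0 < ln 2 by rewrite -ln_1; apply: ln_increasing; lra.
  have Hdl : 0 < d * ln 2 by apply: Rmult_lt_0_compat.
  have Hi : 0 < / (d * ln 2) by apply: Rinv_pos.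
  rewrite Rpower_mult_INR; last lra.
  have Ha := pos_INR a.
  have X : 1 + INR a * (d * ln 2) <= Rpower p (INR a * d).
    apply: Rle_trans (exp_ineq1_le _) _; apply: exp_le.
    have : ln 2 <= ln p by apply: ln_le; lra.
    have : 0 <= INR a * d by apply: Rmult_le_pos; lra.
    nra.
  apply: (Rle_trans _ ((1 + / (d * ln 2)) * (1 + INR a * (d * ln 2)))); last first.
    by apply: Rmult_le_compat_l; lra.
  have E : / (d * ln 2) * (INR a * (d * ln 2)) = INR a by field; lra.
  rewrite S_INR; have : 0 <= INR a * (d * ln 2) by apply: Rmult_le_pos; lra.
  nra.
Qed.

Lemma tau_smooth (B : nat) : exists K, 1 <= K /\ forall n, (0 < n)%nat ->
  (forall p, prime p -> (p %| n)%nat -> (p < B)%nat) -> tau_le K n.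
Proof.
  elim: B => [|B [K [HK IH]]].
    exists 1; split; first lra.
    move=> n Hn H; have -> : n = 1%nat.
      case: n Hn H => [|[|n]] // _ H.
      by have := H (pdiv n.+2) (pdiv_prime (n := n.+2) isT) (pdiv_dvd _).
    have E : divisors 1 = [:: 1%nat] by [].
    by rewrite /tau_le E /= /Rpower ln_1 Rmult_0_r exp_0; lra.
  have [PB|PB] := boolP (prime B); last first.
    exists K; split => // n Hn H; apply: IH => // p Hp Hpn.
    have := H p Hp Hpn; rewrite ltnS leq_eqVlt => /orP [/eqP E|] //.
    by move: Hp; rewrite E (negbTE PB).
  have Hi : 0 < / (d * ln 2).
    by apply: Rinv_pos; apply: Rmult_lt_0_compat => //; rewrite -ln_1; apply: ln_increasing; lra.
  exists ((1 + / (d * ln 2)) * K); split; first nra.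
  move=> n Hn H; apply: (tau_step K (1 + / (d * ln 2)) n B) => //; try lra.
    move=> a; apply: linear_le_exp.
    by rewrite -[2]/(INR 2); apply: le_INR; apply/leP; apply: prime_gt1.
  move=> m Hm Hmn Hc; apply: IH => // p Hp Hpm.
  have := H p Hp (dvdn_trans Hpm Hmn); rewrite ltnS leq_eqVlt => /orP [/eqP E|] //.
  move: Hc; rewrite -E prime_coprime //; by rewrite Hpm.
Qed.

(** A prime with [p^d >= 2] has price 1, because [a + 1 <= 2^a <= p^(a d)]. Such primes are removed
    by strong induction at no cost, and only the finitely many primes below a bound depending on [d]
    enter the constant. *)
Lemma tau_bound : exists K, 1 <= K /\ forall n, (0 < n)%nat -> tau_le K n.
Proof.
  have [B HB] := INR_unbounded (exp (/ d * ln 2)).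
  have [K [HK Hs]] := tau_smooth B.+2; exists K; split => // n.
  elim: {n}_.+1 {-2}n (ltnSn n) => // N IH n HnN Hn.
  have [/allP S|/allPn [p]] := boolP (all (fun p => p < B.+2)%nat (primes n)).
    apply: Hs => // p Hp Hpn; apply: S; by rewrite mem_primes Hp Hn.
  rewrite mem_primes -leqNgt => /and3P [Hp _ Hpn] HpB.
  rewrite -(Rmult_1_l K); apply: (tau_step K 1 n p) => //; try lra.
    move=> a; rewrite Rmult_1_l Rpower_mult_INR; last first.
      by apply: lt_0_INR; apply/ltP; apply: prime_gt0.
    have HpR : exp (/ d * ln 2) <= INR p.
      apply: (Rle_trans _ (INR B)); first lra.
      by apply: le_INR; apply/leP; apply: leq_trans HpB; rewrite -addn2 leq_addr.
    have L : ln 2 <= d * ln (INR p).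
      have : / d * ln 2 <= ln (INR p).
        by rewrite -(ln_exp (/ d * ln 2)); apply: ln_le => //; apply: exp_pos.
      move=> X; have -> : ln 2 = d * (/ d * ln 2) by field; lra.
      by apply: Rmult_le_compat_l; lra.
    have P2 : INR a.+1 <= 2 ^ a.
      elim: a => [|a IHa]; first by rewrite /=; lra.
      rewrite S_INR [2 ^ a.+1]/=; have := INR_S_pos a; lra.
    apply: Rle_trans P2 _; rewrite -Rpower_pow; last lra.
    rewrite /Rpower; apply: exp_le; have := pos_INR a; nra.
  move=> m Hm Hmn Hc; apply: IH => //.
  have Hle : (m <= n)%nat by apply: dvdn_leq.
  rewrite ltnS in HnN; apply: leq_trans HnN; rewrite ltn_neqAle Hle andbT.
  apply/negP => /eqP E; move: Hc; by rewrite E prime_coprime // Hpn.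
Qed.

End DivisorBound.

Lemma divisor_fun_le_tau (k n : nat) : (0 < n)%nat ->
  (divisor_fun k n <= size (divisors n) ^ k)%nat.
Proof.
  move=> Hn; rewrite /divisor_fun.
  pose D := [set x : 'I_n.+1 | (x : nat) \in divisors n].
  have HD : (#|D| <= size (divisors n))%nat.
    rewrite cardE -(size_map val); apply: uniq_leq_size.
      by rewrite map_inj_uniq ?enum_uniq //; apply: val_inj.
    by move=> x /mapP [y]; rewrite mem_enum inE => H ->.
  apply: (leq_trans (n := #|D| ^ k)); last by case: (k) => // k'; rewrite leq_exp2r.
  have := card_ffun_on 'I_k (mem D); rewrite card_ord => <-.
  apply: subset_leq_card; apply/subsetP => f; rewrite inE => /eqP E.
  apply/ffun_onP => i; rewrite inE -dvdn_divisors //.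
  have X : (f i %| \prod_(i < k) (f i : nat))%nat by rewrite (bigD1 i) //= dvdn_mulr.
  by rewrite E in X.
Qed.

Lemma divisor_fun_bound (k : nat) (d : R) : 0 < d ->
  exists K, 1 <= K /\ forall n, INR (divisor_fun k n.+1) <= K * Rpower (INR n.+1) d.
Proof.
  (* The bound for the number of divisors is raised to the power [k], so its exponent is divided
     beforehand; [k + 1] avoids a division by zero. *)
  move=> Hd; have Hdk : 0 < d / INR k.+1 by apply: Rdiv_pos_pos => //; apply: lt_0_INR; lia.
  have [K [HK H]] := tau_bound (d / INR k.+1) Hdk.
  exists (K ^ k); split; first by apply: pow_R1_Rle.
  move=> n; have Hn := INR_S_pos n.
  apply: (Rle_trans _ (INR (size (divisors n.+1)) ^ k)).
    by rewrite -INR_expn; apply: le_INR; apply/leP; apply: divisor_fun_le_tau.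
  apply: (Rle_trans _ ((K * Rpower (INR n.+1) (d / INR k.+1)) ^ k)).
    by apply: pow_incr; split; [apply: pos_INR | apply: H].
  rewrite Rpow_mult_distr; apply: Rmult_le_compat_l; first by apply: pow_le; lra.
  rewrite -Rpower_pow; last by apply: Rpower_pos.
  rewrite Rpower_mult; apply: Rle_Rpower => //.
  have Hk : 0 <= INR k by apply: pos_INR.
  rewrite S_INR; apply: (Rmult_le_reg_r (INR k + 1)); first lra.
  have -> : d / (INR k + 1) * INR k * (INR k + 1) = d * INR k by field; lra.
  nra.
Qed.

(** * Powers of the truncated zeta series *)

HB.instance Definition _ := Monoid.isComLaw.Build C (RtoC 0) Cplus Cplus_assoc Cplus_comm Cplus_0_l.
HB.instance Definition _ := Monoid.isComLaw.Build C (RtoC 1) Cmult Cmult_assoc Cmult_comm Cmult_1_l.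
HB.instance Definition _ := Monoid.isMulLaw.Build C (RtoC 0) Cmult Cmult_0_l Cmult_0_r.
HB.instance Definition _ := Monoid.isAddLaw.Build C Cmult Cplus Cmult_plus_distr_r Cmult_plus_distr_l.

Lemma Rplus_assoc' : associative Rplus. Proof. by move=> *; rewrite Rplus_assoc. Qed.
Lemma Rmult_assoc' : associative Rmult. Proof. by move=> *; rewrite Rmult_assoc. Qed.
HB.instance Definition _ := Monoid.isComLaw.Build R 0 Rplus Rplus_assoc' Rplus_comm Rplus_0_l.
HB.instance Definition _ := Monoid.isComLaw.Build R 1 Rmult Rmult_assoc' Rmult_comm Rmult_1_l.
HB.instance Definition _ := Monoid.isMulLaw.Build R 0 Rmult Rmult_0_l Rmult_0_r.
HB.instance Definition _ := Monoid.isAddLaw.Build R Rmult Rplus Rmult_plus_distr_r Rmult_plus_distr_l.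

(* Ordered factorizations of [n] into [k] factors between [1] and [M]; the
   value [f i] encodes the factor [f i + 1]. *)
Definition trunc_divisor_fun (k M n : nat) : nat :=
  #|[set f : {ffun 'I_k -> 'I_M} | (\prod_(i < k) (f i).+1)%nat == n]|.

Lemma trunc_divisor_fun_le (k M n : nat) :
  (trunc_divisor_fun k M n.+1 <= divisor_fun k n.+1)%nat.
Proof.
  pose g (f : {ffun 'I_k -> 'I_M}) : {ffun 'I_k -> 'I_n.+2} := [ffun i => inord (f i).+1].
  rewrite /trunc_divisor_fun /divisor_fun.
  set A := [set f | _]; set B := [set f | _].
  have HA f i : f \in A -> ((f i).+1 <= n.+1)%nat.
    rewrite inE => /eqP E; rewrite -E; apply: dvdn_leq; first by rewrite E.
    by rewrite (bigD1 i) //= dvdn_mulr.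
  rewrite -(card_in_imset (f := g) (D := A)).
    apply: subset_leq_card; apply/subsetP => _ /imsetP [f Hf ->]; rewrite inE.
    have X : (\prod_(i < k) (g f i : nat))%nat = (\prod_(i < k) (f i).+1)%nat.
      by apply: eq_bigr => i _; rewrite ffunE inordK // ltnS; apply: HA.
    by rewrite X; move: Hf; rewrite inE.
  move=> f1 f2 H1 H2 /ffunP E; apply/ffunP => i; apply: val_inj.
  have := E i; rewrite !ffunE => /(f_equal val) /=.
  by rewrite !inordK ?ltnS; [case | apply: HA | apply: HA].
Qed.

(** When [n + 1 <= M], every factor of [n + 1] is at most [M], so truncation loses nothing; with the
    previous lemma the two counts agree in this range. *)
Lemma trunc_divisor_fun_ge (k M n : nat) : (n < M)%nat ->
  (divisor_fun k n.+1 <= trunc_divisor_fun k M n.+1)%nat.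
Proof.
  case: M => // M HM.
  pose g (f : {ffun 'I_k -> 'I_n.+2}) : {ffun 'I_k -> 'I_M.+1} := [ffun i => inord (f i).-1].
  rewrite /trunc_divisor_fun /divisor_fun.
  set B := [set f | _]; set A := [set f | _].
  have HB f i : f \in B -> (0 < f i)%nat.
    rewrite inE => /eqP E; have : (0 < \prod_(i < k) (f i : nat))%nat by rewrite E.
    by rewrite (bigD1 i) //= muln_gt0 => /andP [].
  have HB2 f i : f \in B -> ((f i).-1 < M.+1)%nat.
    move=> Hf; rewrite -ltnS prednK ?HB //; apply: leq_trans (ltn_ord (f i)) _.
    by rewrite ltnS.
  rewrite -(card_in_imset (f := g) (D := B)).
    apply: subset_leq_card; apply/subsetP => _ /imsetP [f Hf ->]; rewrite inE.
    have X : (\prod_(i < k) (g f i).+1)%nat = (\prod_(i < k) (f i : nat))%nat.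
      by apply: eq_bigr => i _; rewrite ffunE inordK; [apply: prednK; apply: HB | apply: HB2].
    by rewrite X; move: Hf; rewrite inE.
  move=> f1 f2 H1 H2 /ffunP E; apply/ffunP => i; apply: val_inj.
  have := E i; rewrite !ffunE => /(f_equal val) /=.
  rewrite !inordK ?HB2 // => X; rewrite -(prednK (HB _ i H1)) -(prednK (HB _ i H2)).
  by rewrite X.
Qed.

Lemma sum_n_big (u : nat -> C) (N : nat) : sum_n u N = \sumC_(i < N.+1) u i.
Proof.
  elim: N => [|N IH]; first by rewrite sum_O big_ord_recr big_ord0 /= Cplus_0_l.
  by rewrite sum_Sn IH [RHS]big_ord_recr.
Qed.

Lemma sum_n_bigR (u : nat -> R) (N : nat) : sum_n u N = \sumR_(i < N.+1) u i.
Proof.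
  elim: N => [|N IH]; first by rewrite sum_O big_ord_recr big_ord0 /= Rplus_0_l.
  by rewrite sum_Sn IH [RHS]big_ord_recr.
Qed.

Lemma nat_Cpow_mul (m n : nat) (s : C) : (0 < m)%nat -> (0 < n)%nat ->
  nat_Cpow_opp (m * n) s = (nat_Cpow_opp m s * nat_Cpow_opp n s)%C.
Proof.
  move=> Hm Hn; rewrite !nat_Cpow_cexp mult_INR ln_mult; try (apply: lt_0_INR; apply/ltP => //).
  by rewrite RtoC_plus -cexp_plus; congr cexp; ring.
Qed.

Lemma nat_Cpow_1 (s : C) : nat_Cpow_opp 1 s = 1.
Proof. by rewrite nat_Cpow_cexp ln_1 Cmult_0_r cexp_0. Qed.

Lemma big_const_C (I : finType) (A : {pred I}) (z : C) :
  \big[Cplus/RtoC 0]_(i in A) z = (RtoC (INR #|A|) * z)%C.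
Proof.
  rewrite big_const; elim: #|A| => [|n IH] /=; first by rewrite Cmult_0_l.
  by rewrite IH -/(INR n.+1) S_INR RtoC_plus; ring.
Qed.

Lemma big_Cpow (z : C) (k : nat) : \big[Cmult/RtoC 1]_(i < k) z = (z ^ k)%C.
Proof.
  elim: k => [|k IH]; first by rewrite big_ord0.
  by rewrite big_ord_recl IH.
Qed.

(** The power expands into a sum over all choices of [k] factors up to [M], grouped according to the
    product, which is at most [M ^ k]. The index [n] stands for the integer [n + 1], hence the
    predecessor of the product. *)
Lemma zeta_trunc_pow (k M : nat) (s : C) :
  ((\sumC_(j < M) nat_Cpow_opp j.+1 s) ^ k)%C =
  \sumC_(n < M ^ k) (RtoC (INR (trunc_divisor_fun k M n.+1)) * nat_Cpow_opp n.+1 s)%C.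
Proof.
  rewrite -big_Cpow bigA_distr_bigA /=.
  have Hb (f : {ffun 'I_k -> 'I_M}) : ((\prod_(i < k) (f i).+1)%nat.-1 < M ^ k)%nat.
    have P : (0 < \prod_(i < k) (f i).+1)%nat by apply: prodn_gt0.
    rewrite prednK //; have -> : (M ^ k)%nat = (\prod_(i < k) M)%nat.
      by rewrite prod_nat_const card_ord.
    by apply: leq_prod => i _; apply: ltn_ord.
  rewrite (partition_big (fun f : {ffun 'I_k -> 'I_M} => Ordinal (Hb f)) predT) //=.
  apply: eq_bigr => n _; rewrite /trunc_divisor_fun.
  transitivity (\big[Cplus/RtoC 0]_(f in [set f : {ffun 'I_k -> 'I_M} |
     (\prod_(i < k) (f i).+1)%nat == n.+1]) nat_Cpow_opp n.+1 s); last by rewrite big_const_C.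
  apply: eq_big => [f|f].
    rewrite inE -val_eqE /=; have P : (0 < \prod_(i < k) (f i).+1)%nat by apply: prodn_gt0.
    by rewrite -[in RHS](prednK P) eqSS.
  rewrite -val_eqE /= => /eqP <-.
  have P : (0 < \prod_(i < k) (f i).+1)%nat by apply: prodn_gt0.
  rewrite prednK //.
  (* Positivity travels through the induction because [nat_Cpow_mul] requires it of both factors. *)
  pose Q (x : C) (y : nat) := (0 < y)%nat /\ x = nat_Cpow_opp y s.
  apply: (proj2 (_ : Q _ _)); apply: (big_ind2 Q).
  - by split=> //; rewrite nat_Cpow_1.
  - move=> x1 y1 x2 y2 [P1 ->] [P2 ->]; split; first by rewrite muln_gt0 P1.
    by rewrite nat_Cpow_mul.
  - by [].
Qed.

(** * Mean squares of Dirichlet polynomials *)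

Lemma RInt_extR (f g : R -> R) (a b : R) : (forall x, f x = g x :> R) ->
  RInt f a b = RInt g a b.
Proof. by move=> H; apply: RInt_ext => x _; apply: H. Qed.

Lemma big_Rle (I : finType) (F G : I -> R) : (forall i, F i <= G i) ->
  \big[Rplus/0]_i F i <= \big[Rplus/0]_i G i.
Proof. by move=> H; elim/big_ind2: _ => *; [lra | lra | apply: H]. Qed.

Lemma big_Rabs (I : finType) (F : I -> R) :
  Rabs (\big[Rplus/0]_i F i) <= \big[Rplus/0]_i Rabs (F i).
Proof.
  elim/big_ind2: _ => [|x1 x2 y1 y2 H1 H2|i _]; [by rewrite Rabs_R0; lra | | lra].
  by apply: Rle_trans (Rabs_triang _ _) _; lra.
Qed.

Lemma big_Rplus (I : finType) (F G : I -> R) :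
  \big[Rplus/0]_i (F i + G i) = \big[Rplus/0]_i F i + \big[Rplus/0]_i G i.
Proof. by rewrite big_split. Qed.

Lemma big_Rscal (I : finType) (F : I -> R) (c : R) :
  \big[Rplus/0]_i (c * F i) = c * \big[Rplus/0]_i F i.
Proof. by rewrite big_distrr. Qed.

Lemma big_Rminus (I : finType) (F G : I -> R) :
  \big[Rplus/0]_i (F i - G i) = \big[Rplus/0]_i F i - \big[Rplus/0]_i G i.
Proof.
  have -> : \big[Rplus/0]_i (F i - G i) = \big[Rplus/0]_i (F i + -1 * G i).
    by apply: eq_bigr => i _; ring.
  by rewrite big_Rplus big_Rscal; ring.
Qed.

Lemma big_Rge0 (I : finType) (F : I -> R) : (forall i, 0 <= F i) -> 0 <= \big[Rplus/0]_i F i.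
Proof. by move=> H; elim/big_ind: _ => *; [lra | lra | apply: H]. Qed.

(** Continuity of the sum is returned along with the interchange so that the lemma can be applied
    again to the outer sum of a double sum. *)
Lemma RInt_big (N : nat) (F : nat -> R -> R) (a b : R) : a <= b ->
  (forall i t, continuous (F i) t) ->
  (forall t, continuous (fun t => \sumR_(i < N) F i t) t) /\
  (RInt (fun t => \sumR_(i < N) F i t) a b : R) = \sumR_(i < N) RInt (F i) a b.
Proof.
  move=> Hab H; elim: N => [|N [IH1 IH2]].
    split.
      move=> t; apply: (continuous_ext (fun _ => 0)); first by move=> x; rewrite big_ord0.
      exact: continuous_const.
    rewrite big_ord0 (RInt_ext _ (fun _ => 0)); last by move=> x _; rewrite big_ord0.
    by rewrite RInt_const /scal /= /mult /=; ring.
  have E t : \sumR_(i < N.+1) F i t = \sumR_(i < N) F i t + F N t.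
    by rewrite big_ord_recr.
  split.
    move=> t; apply: (continuous_ext (fun t => \sumR_(i < N) F i t + F N t)).
      by move=> x; rewrite E.
    by apply: continuousD.
  rewrite (RInt_ext _ (fun t => \sumR_(i < N) F i t + F N t)); last first.
    by move=> x _; rewrite E.
  rewrite RInt_Rplus; [|by apply: ex_RInt_on|by apply: ex_RInt_on].
  by rewrite IH2 [RHS]big_ord_recr.
Qed.

Lemma RInt_cos_bound (l a b : R) : l <> 0 ->
  Rabs (RInt (fun t => cos (t * l)) a b) <= 2 / Rabs l.
Proof.
  move=> Hl.
  have -> : RInt (fun t => cos (t * l)) a b = (sin (b * l) - sin (a * l)) / l.
    apply: is_RInt_unique.
    have -> : (sin (b * l) - sin (a * l)) / l = minus (sin (b * l) / l) (sin (a * l) / l).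
      by rewrite /minus /plus /opp /=; field.
    apply: (is_RInt_deriveR (fun t => sin (t * l) / l)) => t _.
      by auto_derive; [| field].
    by apply: derive_continuous; auto_derive.
  rewrite Rabs_div //; apply: Rmult_le_compat_r.
    by left; apply: Rinv_pos; apply: Rabs_pos_lt.
  apply/Rabs_le_between; have := SIN_bound (b * l); have := SIN_bound (a * l); lra.
Qed.

Definition dir_poly (b : nat -> R) (N : nat) (t : R) : C :=
  \sumC_(n < N) (RtoC (b n) * cexp (0%R, (- (t * ln (INR n.+1)))%R))%C.

Lemma dir_poly_sq (b : nat -> R) (N : nat) (t : R) :
  Cmod (dir_poly b N t) ^ 2 = \sumR_(m < N) \sumR_(n < N)
    (b m * b n * cos (t * (ln (INR m.+1) - ln (INR n.+1)))).
Proof.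
  rewrite Cmod2_alt.
  have -> : Re (dir_poly b N t) = \sumR_(n < N) (b n * cos (t * ln (INR n.+1))).
    rewrite /dir_poly (big_morph Re (id1 := 0) (op1 := Rplus)) //.
    by apply: eq_bigr => n _; rewrite /cexp /Re /Im /= exp_0 cos_neg; ring.
  have -> : Im (dir_poly b N t) = - \sumR_(n < N) (b n * sin (t * ln (INR n.+1))).
    rewrite /dir_poly (big_morph Im (id1 := 0) (op1 := Rplus)) //.
    have EN (y : R) : - y = -1 * y by ring.
    rewrite [RHS]EN -big_Rscal.
    by apply: eq_bigr => n _; rewrite /cexp /Re /Im /= exp_0 sin_neg; ring.
  set A := \big[_/_]_(n < N) (b n * cos _); set B := \big[_/_]_(n < N) (b n * sin _).
  have -> : A ^ 2 + (- B) ^ 2 = A * A + B * B by ring.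
  rewrite {1}/A {1}/B.
  rewrite !big_distrl -big_Rplus; apply: eq_bigr => m _ /=.
  rewrite !big_distrr -big_Rplus; apply: eq_bigr => n _ /=.
  by rewrite Rmult_minus_distr_l cos_minus; ring.
Qed.

Lemma big_shift_le (x : nat -> R) (Z : R) (N m : nat) : (forall n, 0 <= x n) ->
  (forall n, \sumR_(j < n) x j <= Z) ->
  \sumR_(n < N) (if (m < n)%nat then x (n - m.+1)%nat else 0) <= Z.
Proof.
  move=> Hx HZ; suff -> : \sumR_(n < N) (if (m < n)%nat then x (n - m.+1)%nat else 0) =
      \sumR_(j < N - m.+1) x j by [].
  elim: N => [|N IH]; first by rewrite sub0n !big_ord0.
  rewrite big_ord_recr /= IH; case: ltnP => H.
    by rewrite subSn // big_ord_recr.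
  have -> : (N - m.+1 = 0)%nat by apply/eqP; rewrite subn_eq0 leqW.
  have -> : (N.+1 - m.+1 = 0)%nat by apply/eqP; rewrite subn_eq0.
  by rewrite big_ord0; lra.
Qed.

Lemma Rpower_neg_le (x y d : R) : 0 < x <= y -> 0 <= d -> Rpower y (- d) <= Rpower x (- d).
Proof.
  move=> Hxy Hd; rewrite /Rpower; apply: exp_le.
  have : ln x <= ln y by apply: ln_le; lra.
  nra.
Qed.

Section MeanSquare.
Variables (b : nat -> R) (V d : R).
Hypothesis Hd : 0 < d.
Hypothesis Hb : forall n, Rabs (b n) <= V * Rpower (INR n.+1) (- (1 + d)).

Let x (n : nat) := Rpower (INR n.+1) (- (1 + d / 2)).
Let Z := 1 + 2 / d.
Let ell (n : nat) := ln (INR n.+1).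

Lemma x_sum (n : nat) : \sumR_(j < n) x j <= Z.
Proof.
  case: n => [|n].
    by rewrite big_ord0 /Z; have : 0 < 2 / d by [apply: Rdiv_pos_pos; lra]; lra.
  rewrite -sum_n_bigR.
  have := Rpower_sum_bound (d / 2) n by_lra.
  have -> : / (d / 2) = 2 / d by field; lra.
  by [].
Qed.

(** With [p = m + 1], [j = n - m] and [q = p + j], one has [|log (p / q)| >= j / q], whose inverse
    is [1 + p / j]. The summand 1 gives [x m * x n]. For [p / j], the factor [p] is absorbed by
    [p^(- 1 - d)], and [q^(- 1 - d)] is split: [q^(- 1 - d / 2)] is compared with [p], and
    [q^(- d / 2)] with [j]. This split is why [x] has only half of [d] in its exponent. *)
Lemma log_gap (m n : nat) : (m < n)%nat ->
  2 * (Rpower (INR m.+1) (- (1 + d)) * Rpower (INR n.+1) (- (1 + d)) / Rabs (ell m - ell n)) <=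
  2 * (x m * x n + x m * x (n - m.+1)%nat).
Proof.
  move=> Hmn; have Ej : (n - m.+1).+1 = (n - m)%nat by rewrite subnSK.
  have Eq : n.+1 = (m.+1 + (n - m))%nat by rewrite addSn subnKC // ltnW.
  have Hj : (0 < n - m)%nat by rewrite subn_gt0.
  rewrite /x Ej /ell Eq plus_INR.
  have Hp := INR_S_pos m; have Hj1 : 1 <= INR (n - m).
    by rewrite -[1]/(INR 1); apply: le_INR; apply/leP.
  set p := INR m.+1 in Hp *; set j := INR (n - m) in Hj1 *.
  have Hl : j / (p + j) <= Rabs (ln p - ln (p + j)).
    rewrite Rabs_minus_sym; apply: Rle_trans (Rle_abs _).
    have := exp_ineq1_le (ln (p / (p + j))).
    have Hq : 0 < p / (p + j) by apply: Rdiv_pos_pos; lra.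
    rewrite exp_ln // ln_div; try lra.
    have -> : p / (p + j) = 1 - j / (p + j) by field; lra.
    lra.
  have Hjq : 0 < j / (p + j) by apply: Rdiv_pos_pos; lra.
  apply: Rmult_le_compat_l; first lra.
  have Hi : / Rabs (ln p - ln (p + j)) <= 1 + p / j.
    have -> : 1 + p / j = / (j / (p + j)) by field; lra.
    exact: Rinv_le_contravar.
  have P0 := Rpower_pos p (- (1 + d)); have Q0 := Rpower_pos (p + j) (- (1 + d)).
  apply: (Rle_trans _ (Rpower p (- (1 + d)) * Rpower (p + j) (- (1 + d)) * (1 + p / j))).
    by apply: Rmult_le_compat_l => //; apply: Rmult_le_pos; lra.
  rewrite Rmult_plus_distr_l Rmult_1_r; apply: Rplus_le_compat.
    apply: Rmult_le_compat; try lra.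
      by apply: Rle_Rpower; lra.
    by apply: Rle_Rpower; lra.
  have -> : Rpower (p + j) (- (1 + d)) = Rpower (p + j) (- (1 + d / 2)) * Rpower (p + j) (- (d / 2)).
    by rewrite -Rpower_plus; congr Rpower; field.
  have -> : Rpower p (- (1 + d)) * (Rpower (p + j) (- (1 + d / 2)) * Rpower (p + j) (- (d / 2))) * (p / j) =
    (Rpower (p + j) (- (1 + d / 2))) * ((Rpower p (- (1 + d)) * p) * (Rpower (p + j) (- (d / 2)) * / j)).
    by rewrite /Rdiv; ring.
  have N1 := Rpower_neg_le p (p + j) (1 + d / 2) by_lra by_lra.
  have N2 : Rpower (p + j) (- (d / 2)) * / j <= Rpower j (- (1 + d / 2)).
    have -> : - (1 + d / 2) = - (d / 2) + Ropp 1 by ring.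
    rewrite Rpower_plus (Rpower_Ropp j 1) Rpower_1; last lra.
    apply: Rmult_le_compat_r; first by left; apply: Rinv_pos; lra.
    by apply: Rpower_neg_le; lra.
  have N3 : Rpower p (- (1 + d)) * p <= 1.
    have E1 : Rpower p (- (1 + d)) * p = Rpower p (- d).
      rewrite -{2}(Rpower_1 p); last lra.
      by rewrite -Rpower_plus; congr Rpower; ring.
    rewrite E1 -(Rpower_O p); last lra.
    by apply: Rle_Rpower; lra.
  apply: Rmult_le_compat => //; try (exact: Rpower_ge0).
    apply: Rmult_le_pos; apply: Rmult_le_pos; try lra; try (exact: Rpower_ge0).
    by left; apply: Rinv_pos; lra.
  rewrite -[Rpower j _]Rmult_1_l; apply: Rmult_le_compat => //.
    by apply: Rmult_le_pos; lra.
  by apply: Rmult_le_pos; left; [apply: Rpower_pos | apply: Rinv_pos; lra].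
Qed.

(** Each off-diagonal integral is at most [2 / |log (m / n)|] times the coefficients, and by
    [log_gap] the double sum is dominated by three products of convergent sums, each at most
    [Z * Z]. The bound depends neither on [N] nor on the interval. *)
Lemma mean_square (N : nat) (S T : R) : S <= T ->
  Rabs (RInt (fun t => Cmod (dir_poly b N t) ^ 2) S T -
    (T - S) * \sumR_(n < N) (b n) ^ 2) <= 6 * (V * Z) ^ 2.
Proof.
  move=> HST.
  pose c (m n : nat) t := b m * b n * cos (t * (ell m - ell n)).
  have cc m n t : continuous (c m n) t.
    by apply: derive_continuous; rewrite /c; auto_derive.
  have X0 n : 0 <= x n by exact: Rpower_ge0.
  have HZ : 0 <= Z by apply: Rle_trans (x_sum O); rewrite big_ord0; lra.
  have E1 : RInt (fun t => Cmod (dir_poly b N t) ^ 2) S T =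
      \sumR_(m < N) \sumR_(n < N) RInt (c m n) S T.
    have I1 m := RInt_big N (c m) S T HST (cc m).
    have [_ I2] := RInt_big N (fun m t => \sumR_(n < N) c m n t) S T HST
      (fun m => proj1 (I1 m)).
    rewrite (RInt_ext _ (fun t => \sumR_(m < N) \sumR_(n < N) c m n t)).
      by rewrite I2; apply: eq_bigr => m _; rewrite (proj2 (I1 m)).
    by move=> t _; rewrite dir_poly_sq.
  have E2 : (T - S) * \sumR_(n < N) (b n) ^ 2 =
      \sumR_(m < N) \sumR_(n < N) (if n == m then (T - S) * b n ^ 2 else 0).
    rewrite -big_Rscal; apply: eq_bigr => m _.
    by rewrite -big_mkcond big_pred1_eq.
  rewrite E1 E2 -big_Rminus; apply: Rle_trans (big_Rabs _ _) _.
  pose g (m n : nat) := if (m < n)%nat then x (n - m.+1)%nat else 0.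
  have G0 m n : 0 <= g m n by rewrite /g; case: ifP => _; [apply: X0 | lra].
  (* One majorant serves both orders of [m] and [n]: [g m n] vanishes unless [m < n], so at most one
     of the last two summands is present. *)
  have term (m n : 'I_N) : Rabs (RInt (c m n) S T - (if n == m then (T - S) * b n ^ 2 else 0)) <=
      2 * V ^ 2 * (x m * x n + x m * g m n + x n * g n m).
    have V2 : 0 <= V ^ 2 by apply: pow2_ge_0.
    have P m' n' : 0 <= x m' * g m' n' by apply: Rmult_le_pos.
    have Pxx : 0 <= x m * x n by apply: Rmult_le_pos.
    case: (eqVneq n m) => [->|Hnm].
      have -> : RInt (c m m) S T = (T - S) * b m ^ 2.
        rewrite (RInt_extR _ (fun _ => b m ^ 2)); last first.
          by move=> t; rewrite /c Rminus_diag Rmult_0_r cos_0; ring.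
        by rewrite RInt_const.
      rewrite Rminus_diag Rabs_R0; have := P m m; nra.
    rewrite Rminus_0_r.
    have off (m' n' : nat) : (m' < n')%nat -> Rabs (RInt (c m' n') S T) <=
        2 * V ^ 2 * (x m' * x n' + x m' * g m' n').
      move=> Hmn; have Hell : ell m' - ell n' <> 0.
        have : ell m' < ell n'; last lra.
        apply: ln_increasing; first by apply: lt_0_INR; lia.
        by apply: lt_INR; apply/ltP.
      have -> : RInt (c m' n') S T = b m' * b n' * RInt (fun t => cos (t * (ell m' - ell n'))) S T.
        rewrite -RInt_Rscal //; apply: ex_RInt_on => // t _.
        by apply: derive_continuous; auto_derive.
      rewrite !Rabs_mult.
      have L := log_gap m' n' Hmn; have K := RInt_cos_bound (ell m' - ell n') S T Hell.
      have K0 : 0 < / Rabs (ell m' - ell n') by apply: Rinv_pos; apply: Rabs_pos_lt.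
      rewrite /g Hmn.
      apply: (Rle_trans _ ((V * Rpower (INR m'.+1) (- (1 + d))) * (V * Rpower (INR n'.+1) (- (1 + d))) *
        (2 / Rabs (ell m' - ell n')))).
        apply: Rmult_le_compat => //; try (by apply: Rabs_pos); try (by apply: Rmult_le_pos; apply: Rabs_pos).
        by apply: Rmult_le_compat => //; apply: Rabs_pos.
      move: L; set w := _ / Rabs _; set r := _ + _ => L.
      have -> : V * Rpower (INR m'.+1) (- (1 + d)) * (V * Rpower (INR n'.+1) (- (1 + d))) *
        (2 / Rabs (ell m' - ell n')) = V ^ 2 * (2 * w) by rewrite /w /Rdiv; ring.
      have -> : 2 * V ^ 2 * r = V ^ 2 * (2 * r) by ring.
      exact: Rmult_le_compat_l.
    have [Hlt|Hlt|E] := ltngtP (m : nat) (n : nat).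
    - have := off _ _ Hlt; have := P n m; nra.
    - have E3 : RInt (c m n) S T = RInt (c n m) S T.
        apply: RInt_extR => t; rewrite /c -(cos_neg (t * _)).
        have -> : - (t * (ell m - ell n)) = t * (ell n - ell m) by ring.
        by ring.
      rewrite E3; have := off _ _ Hlt; have := P m n; rewrite (Rmult_comm (x m)); nra.
    - by move: Hnm; rewrite -val_eqE /= E eqxx.
  apply: (Rle_trans _ (\sumR_(m < N) \sumR_(n < N)
    (2 * V ^ 2 * (x m * x n + x m * g m n + x n * g n m)))).
    apply: big_Rle => m; rewrite -big_Rminus; apply: Rle_trans (big_Rabs _ _) _.
    by apply: big_Rle => n; apply: term.
  have S1 : \sumR_(m < N) \sumR_(n < N) (x m * x n) <= Z * Z.
    rewrite (eq_bigr (fun m : 'I_N => (\sumR_(n < N) x n) * x m)); last first.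
      by move=> m _; rewrite big_Rscal Rmult_comm.
    rewrite big_Rscal; apply: Rmult_le_compat; try apply: x_sum; by apply: big_Rge0.
  have S2 : \sumR_(m < N) \sumR_(n < N) (x m * g m n) <= Z * Z.
    apply: (Rle_trans _ (\sumR_(m < N) (Z * x m))).
      apply: big_Rle => m; rewrite big_Rscal Rmult_comm; apply: Rmult_le_compat_r => //.
      by apply: big_shift_le => //; apply: x_sum.
    by rewrite big_Rscal; apply: Rmult_le_compat_l => //; apply: x_sum.
  have S3 : \sumR_(m < N) \sumR_(n < N) (x n * g n m) <= Z * Z.
    by rewrite exchange_big.
  rewrite (eq_bigr (fun m : 'I_N => 2 * V ^ 2 * (\sumR_(n < N) (x m * x n) +
     \sumR_(n < N) (x m * g m n) + \sumR_(n < N) (x n * g n m)))); last first.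
    by move=> m _; rewrite big_Rscal !big_Rplus.
  rewrite big_Rscal !big_Rplus.
  have V2 : 0 <= V ^ 2 by apply: pow2_ge_0.
  have -> : 6 * (V * Z) ^ 2 = 2 * V ^ 2 * (Z * Z + Z * Z + Z * Z) by ring.
  apply: Rmult_le_compat_l; first lra.
  by repeat apply: Rplus_le_compat.
Qed.

End MeanSquare.

(** * The smooth weight *)

(** The parameter [u] is [log (Y / n)], for which [Y^w n^(- w)] is [exp (w u)]; the term [w * w] is
    the Gaussian damping in the vertical direction. *)
Definition kern (u : R) (w : C) : C := cexp (w * RtoC u + w * w).

Lemma Cmod_kern (u x y : R) : Cmod (kern u (x, y)) = exp (x * u + x ^ 2 - y ^ 2).
Proof. by rewrite Cmod_cexp; congr exp; rewrite /Re /Im /=; ring. Qed.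

Lemma kern_plus (u v : R) (w : C) : kern (u + v) w = (cexp (w * RtoC u) * kern v w)%C.
Proof. by rewrite -cexp_plus; congr cexp; rewrite RtoC_plus; ring. Qed.

Lemma holo_kern (u : R) (w : C) : holo (kern u) w.
Proof.
  apply: holo_cexp; apply: holo_plus.
    by apply: holo_mult; [apply: holo_id | apply: holo_const].
  by apply: holo_mult; apply: holo_id.
Qed.

Lemma Cmod_pair_ge (x y : R) : Rabs x <= Cmod (x, y).
Proof. exact: (re_le_Cmod (x, y)). Qed.

Definition weight (H u : R) : C := CInt (fun v => kern u (2, v) / (2, v))%C (- H) H.

Lemma con_kern_div (H u x : R) : x <> 0 -> con (- H) H (fun v => kern u (x, v) / (x, v))%C.
Proof.
  move=> Hx v _; apply: ctn_div; [| apply: ctn_vert | by apply: pair_neq0; left].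
  by apply: holo_ctn; [apply: holo_kern | apply: ctn_vert].
Qed.

Lemma RInt_odd (f : R -> R) (H : R) : 0 <= H -> (forall v, continuous f v) ->
  (forall v, f (- v) = - f v) -> (RInt f (- H) H : R) = 0.
Proof.
  move=> HH Hc Ho.
  have ex a b : ex_RInt f a b.
    by apply: (ex_RInt_contR) => z _; apply: Hc.
  have := RInt_comp_lin (V := R_CompleteNormedModule) f (-1) 0 (- H) H (ex _ _).
  have -> : -1 * - H + 0 = H by ring.
  have -> : -1 * H + 0 = - H by ring.
  rewrite -(opp_RInt_swap f (- H) H (ex _ _)) /opp /=.
  rewrite (RInt_extR _ f); first lra.
  move=> v; rewrite /scal /= /mult /=; have -> : -1 * v + 0 = - v by ring.
  by rewrite Ho; ring.
Qed.

(** Under [v -> - v] the integrand is conjugated, so its imaginary part is odd. Real weights give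
    real coefficients, as required by the expansion of the mean square. *)
Lemma weight_real (H u : R) : 0 <= H -> weight H u = RtoC (Re (weight H u)).
Proof.
  move=> HH; apply: C_ext => //; rewrite {1}/Im /=.
  have E v : Im (kern u (2, v) / (2, v)) =
      exp (2 * u + 4 - v ^ 2) * (2 * sin (v * u + 4 * v) - v * cos (v * u + 4 * v)) / (4 + v ^ 2).
    have -> : kern u (2, v) = (exp (2 * u + 4 - v ^ 2) * cos (v * u + 4 * v),
                exp (2 * u + 4 - v ^ 2) * sin (v * u + 4 * v)).
      rewrite /kern /cexp; congr (exp _ * cos _, exp _ * sin _); rewrite /Re /Im /=; ring.
    rewrite /Im /=; field; have := pow2_ge_0 v; rewrite /=; lra.
  rewrite (RInt_extR _ _ _ _ E); apply: RInt_odd => //.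
    move=> v; apply: derive_continuous; auto_derive.
    by have := pow2_ge_0 v; rewrite /=; lra.
  move=> v; have -> : - v * u + 4 * - v = - (v * u + 4 * v) by ring.
  by rewrite sin_neg cos_neg; have -> : (- v) ^ 2 = v ^ 2; [ring | rewrite /Rdiv; ring].
Qed.

Lemma weight_le (H u : R) : 0 <= H -> Cmod (weight H u) <= 2 * exp 4 * H * exp (2 * u).
Proof.
  move=> HH.
  apply: Rle_trans (CInt_bound_const (- H) H by_lra _ (exp 4 * exp (2 * u) / 2) _ _) _.
  - by apply: con_kern_div; lra.
  - move=> v Hv; apply: Cmod_div_le; first lra.
      by apply: Rle_trans (Cmod_pair_ge _ _); rewrite Rabs_pos_eq; lra.
    by rewrite Cmod_kern -exp_plus; apply: exp_le; have := pow2_ge_0 v; lra.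
  - by right; field.
Qed.

(** Moving the line of integration from [Re w = 2] to [Re w = - eta] picks up the residue [2 PI],
    and the new line gains [exp (- eta u)]. The condition [3 u <= H^2] serves the horizontal sides:
    for [u >= 0] it gives [2 u - H^2 <= - u <= - eta u]. *)
Lemma weight_near (H u eta : R) : 1 <= H -> 0 < eta <= 1 -> 3 * u <= H ^ 2 ->
  Cmod (weight H u - RtoC (2 * PI)) <= (4 * exp 1 / eta + 24 * exp 4) * H * exp (- (eta * u)).
Proof.
  move=> HH He Hu.
  pose B := 2 * exp 4 * exp (- (eta * u)).
  have Hhor x y : - eta <= x <= 2 -> y ^ 2 = H ^ 2 -> Cmod (kern u (x, y)) <= B.
    move=> Hx Hy; rewrite Cmod_kern Hy.
    have X2 : x ^ 2 <= 4 by nra.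
    have [Hu0|Hu0] := Rle_dec 0 u.
    - have : exp (x * u + x ^ 2 - H ^ 2) <= exp (4 + - (eta * u)) by apply: exp_le; nra.
      rewrite exp_plus /B; have := exp_pos 4; have := exp_pos (- (eta * u)); nra.
    - have : exp (x * u + x ^ 2 - H ^ 2) <= exp (4 + - (eta * u)).
        by apply: exp_le; have := pow2_ge_0 H; nra.
      rewrite exp_plus /B; have := exp_pos 4; have := exp_pos (- (eta * u)); nra.
  have S := cauchy_rect_split (kern u) eta 2 H B by_lra by_lra by_lra
    (fun x y _ _ => holo_kern u (x, y))
    (fun x Hx => conj (Hhor x H Hx erefl) (Hhor x (- H) Hx (ltac:(ring)))).
  have L : Cmod (CInt (fun v => kern u ((- eta)%R, v) / ((- eta)%R, v))%C (- H) H) <=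
      2 * ((H - - H) * (exp 1 * exp (- (eta * u)) / eta)).
    apply: CInt_bound_const; first lra.
      by apply: con_kern_div; lra.
    move=> v Hv; apply: Cmod_div_le; first lra.
      by apply: Rle_trans (Cmod_pair_ge _ _); rewrite Rabs_Ropp Rabs_pos_eq; lra.
    by rewrite Cmod_kern -exp_plus; apply: exp_le; have := pow2_ge_0 v; nra.
  have K0 : kern u 0 = 1.
    by rewrite /kern; have -> : (0 * RtoC u + 0 * 0 = 0)%C; [ring | apply: cexp_0].
  rewrite K0 Cmult_1_r -/(weight H u) in S.
  set l := CInt _ _ _ in S L.
  have -> : (weight H u - RtoC (2 * PI) = (weight H u - RtoC (2 * PI) - l) + l)%C by ring.
  apply: Rle_trans (Cmod_triangle _ _) _.
  have BH : B / H <= B * H.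
    have B0 : 0 <= B.
      by rewrite /B; have := exp_pos 4; have := exp_pos (- (eta * u)); nra.
    apply: Rmult_le_compat_l => //; apply: (Rle_trans _ 1); last by [].
    by rewrite -[X in _ <= X]Rinv_1; apply: Rinv_le_contravar; lra.
  have B0 : 0 <= B * H.
    by apply: Rmult_le_pos; last lra; rewrite /B; have := exp_pos 4; have := exp_pos (- (eta * u)); nra.
  have X : 4 * ((2 + eta) * (B / H)) <= 12 * (B * H).
    apply: (Rle_trans _ (4 * ((2 + eta) * (B * H)))); last nra.
    by apply: Rmult_le_compat_l; first lra; apply: Rmult_le_compat_l => //; lra.
  apply: Rle_trans (Rplus_le_compat _ _ _ _ (Rle_trans _ _ _ S X) L) _.
  by rewrite /B; right; field; lra.
Qed.

(** For [u >= 0] the weight is bounded, and for [u < 0] it is of order [exp (2 u)]. Both cases lie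
    below [exp (p u)] for every [p] in [[0, 2]], which leaves the rate of decay beyond [Y] free to
    be chosen. *)
Lemma weight_bounds (eta : R) : 0 < eta <= 1 -> exists K, 1 <= K /\ forall H u, 1 <= H ->
  3 * u <= H ^ 2 ->
  Cmod (weight H u - RtoC (2 * PI)) <= K * H * exp (- (eta * u)) /\
  Cmod (weight H u) <= K * H /\
  forall p, 0 <= p <= 2 -> Cmod (weight H u) <= K * H * exp (p * u).
Proof.
  move=> He.
  pose K1 := 4 * exp 1 / eta + 24 * exp 4.
  have E1 : 0 < 4 * exp 1 / eta by apply: Rdiv_pos_pos; [have := exp_pos 1 |]; lra.
  have E4 := exp_pos 4.
  have E41 : 1 <= exp 4 by have := exp_ineq1_le 4; lra.
  have PI8 : 2 * PI <= 8 by have := PI_4; lra.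
  exists (K1 + 8); split; first by rewrite /K1; lra.
  move=> H u HH Hu.
  have N := weight_near H u eta HH He Hu; rewrite -/K1 in N.
  have W := weight_le H u by_lra.
  have EP x : 0 < exp x := exp_pos x.
  have KH : 0 <= K1 * H by rewrite /K1; apply: Rmult_le_pos; lra.
  have U x : 0 <= x -> 1 <= exp x by have := exp_ineq1_le x; lra.
  have D x : x <= 0 -> exp x <= 1 by move=> Hx; rewrite -exp_0; apply: exp_le.
  have A1 : Cmod (weight H u) <= (K1 + 8) * H * (if Rle_dec 0 u then 1 else exp (2 * u)).
    case: Rle_dec => Hu0 /=.
      have -> : (weight H u = (weight H u - RtoC (2 * PI)) + RtoC (2 * PI))%C by ring.
      apply: Rle_trans (Cmod_triangle _ _) _; rewrite Cmod_R Rabs_pos_eq; last first.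
        by have := PI_RGT_0; lra.
      have := Rmult_le_compat_l _ _ _ KH (D (- (eta * u)) (ltac:(nra))); nra.
    apply: Rle_trans W _; apply: Rmult_le_compat_r; first by left.
    by apply: Rmult_le_compat_r; first lra; rewrite /K1; lra.
  have K8 : 0 <= (K1 + 8) * H by nra.
  split; [|split].
  - apply: Rle_trans N _; apply: Rmult_le_compat_r; first by left.
    nra.
  - apply: Rle_trans A1 _; rewrite -[X in _ <= X]Rmult_1_r; apply: Rmult_le_compat_l => //.
    by case: Rle_dec => Hu0 /=; [lra | apply: D; lra].
  - move=> p Hp; apply: Rle_trans A1 _; apply: Rmult_le_compat_l => //.
    by case: Rle_dec => Hu0 /=; [apply: U; nra | apply: exp_le; nra].
Qed.

(** * The smoothed approximate formula for powers of zeta *)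

Lemma Cpow_diff (A : R) (a b : C) (k : nat) : 1 <= A -> Cmod a <= A -> Cmod b <= A ->
  Cmod (a ^ k - b ^ k) <= INR k * A ^ k * Cmod (a - b).
Proof.
  move=> HA Ha Hb; have D := Cmod_ge_0 (a - b).
  elim: k => [|k IH].
    have -> : (a ^ 0 - b ^ 0 = 0)%C by rewrite /=; ring.
    by rewrite Cmod_0 /=; lra.
  have -> : (a ^ k.+1 - b ^ k.+1 = a * (a ^ k - b ^ k) + (a - b) * b ^ k)%C.
    by rewrite /=; ring.
  apply: Rle_trans (Cmod_triangle _ _) _; rewrite !Cmod_mult.
  have Ak : 1 <= A ^ k by apply: pow_R1_Rle.
  have Bk : Cmod (b ^ k) <= A ^ k.
    by rewrite Cmod_pow; apply: pow_incr; split; [apply: Cmod_ge_0 |].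
  rewrite (S_INR k) [A ^ k.+1]/=.
  have Kp := pos_INR k.
  have P1 : Cmod a * Cmod (a ^ k - b ^ k) <= A * (INR k * A ^ k * Cmod (a - b)).
    by apply: Rmult_le_compat => //; apply: Cmod_ge_0.
  have P2 : Cmod (a - b) * Cmod (b ^ k) <= Cmod (a - b) * (A * A ^ k).
    by apply: Rmult_le_compat_l => //; nra.
  lra.
Qed.

Lemma CInt_big (N : nat) (F : nat -> R -> C) (a b : R) : a <= b ->
  (forall i, con a b (F i)) ->
  con a b (fun t => \sumC_(i < N) F i t) /\
  CInt (fun t => \sumC_(i < N) F i t) a b = \sumC_(i < N) CInt (F i) a b.
Proof.
  move=> Hab H; elim: N => [|N [IH1 IH2]].
    have E t : \sumC_(i < 0) F i t = RtoC 0 by rewrite big_ord0.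
    split.
      by move=> t _; split; apply: (continuous_ext (fun _ => 0)) => [x|];
        rewrite ?E //; apply: continuous_const.
    rewrite big_ord0 (CInt_ext a b Hab _ (fun t => 0 * RtoC 0)%C); last first.
      by move=> t _; rewrite E; ring.
    by rewrite (CInt_scal a b Hab); [ring | move=> t _; apply: ctn_const].
  have E t : \sumC_(i < N.+1) F i t =
      (\sumC_(i < N) F i t + F N t)%C by rewrite big_ord_recr.
  split.
    move=> t Ht; have [C1 C2] := ctn_plus _ _ t (IH1 t Ht) (H N t Ht).
    split; [apply: continuous_ext C1 | apply: continuous_ext C2] => x; by rewrite E.
  rewrite (CInt_ext a b Hab _ (fun t => \sumC_(i < N) F i t + F N t)%C); last first.
    by move=> t _; rewrite E.
  by rewrite CInt_plus // IH2 [RHS]big_ord_recr.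
Qed.

(** The coefficient belonging to the integer [n + 1]. Taking the real part changes nothing for
    [H >= 0], by [weight_real]. *)
Definition coef (k M : nat) (sigma H Y : R) (n : nat) : R :=
  INR (trunc_divisor_fun k M n.+1) * Rpower (INR n.+1) (- sigma) *
  Re (weight H (ln Y - ln (INR n.+1))).

Definition trunc_zeta (M : nat) (s : C) : C := \sumC_(j < M) nat_Cpow_opp j.+1 s.

Lemma nat_Cpow_polar (n : nat) (sigma t : R) : nat_Cpow_opp n (sigma, t) =
  (RtoC (Rpower (INR n) (- sigma)) * cexp (0%R, (- (t * ln (INR n)))%R))%C.
Proof.
  apply: C_ext; rewrite /nat_Cpow_opp /cexp /Re /Im /= exp_0 ?cos_neg ?sin_neg; ring.
Qed.

(** On the right side the power of the partial sum is a finite Dirichlet polynomial, so it can be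
    integrated termwise; each [n^(- w)] merges with the kernel for [Y] into the kernel for
    [Y / n]. *)
Lemma trunc_main_term (k M : nat) (sigma t H Y : R) : 0 <= H ->
  CInt (fun v => trunc_zeta M ((sigma, t) + (2, v)) ^ k * kern (ln Y) (2, v) / (2, v))%C (- H) H =
  dir_poly (coef k M sigma H Y) (M ^ k) t.
Proof.
  move=> HH; have Hab : - H <= H by lra.
  pose c n := (RtoC (INR (trunc_divisor_fun k M n.+1)) * nat_Cpow_opp n.+1 (sigma, t))%C.
  pose G n v := (c n * (kern (ln Y - ln (INR n.+1)) (2, v) / (2, v)))%C.
  rewrite (CInt_ext _ _ Hab _ (fun v => \sumC_(n < M ^ k) G n v)); last first.
    move=> v _; rewrite zeta_trunc_pow /Cdiv -Cmult_assoc big_distrl; apply: eq_bigr => n _ /=.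
    rewrite /G /c !nat_Cpow_cexp.
    have -> : (- ((sigma, t) + (2, v)) * RtoC (ln (INR n.+1)) =
      - (sigma, t) * RtoC (ln (INR n.+1)) + (2, v) * RtoC (- ln (INR n.+1)))%C.
      by rewrite RtoC_opp; ring.
    have -> : ln Y - ln (INR n.+1) = - ln (INR n.+1) + ln Y by ring.
    by rewrite cexp_plus kern_plus /Cdiv; ring.
  have [_ ->] := CInt_big (M ^ k) G (- H) H Hab (fun n => con_scal _ _ (c n) _ (con_kern_div H _ 2 by_lra)).
  apply: eq_bigr => n _; rewrite /G CInt_scal //; last by apply: con_kern_div; lra.
  rewrite -/(weight H _) weight_real // /c nat_Cpow_polar /coef !RtoC_mult; ring.
Qed.

Section Approximation.
Variable zeta : C -> C.
Hypothesis Hzeta : is_riemann_zeta zeta.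
Variable k : nat.

Lemma zeta_right_bound (s : C) : 2 <= Re s -> Cmod (zeta s) <= 2.
Proof.
  move=> Hs; have [B HB] := ex_series_Rpower 1 Rlt_0_1.
  have HB2 : B <= 2.
    have X N : sum_n (fun n => Rpower (INR n.+1) (- (1 + 1))) N <= 2.
      by have := Rpower_sum_bound 1 N Rlt_0_1; rewrite Rinv_1; lra.
    exact: (is_lim_seq_le _ (fun _ => 2) B 2 X HB (is_lim_seq_const 2)).
  apply: Rle_trans HB2.
  apply: (is_series_Cmod_le _ _ _ _ (proj1 Hzeta s by_lra) _ HB) => n.
  rewrite Cmod_nat_Cpow; apply: Rle_Rpower; [exact: INR_S_pos | lra].
Qed.

Lemma trunc_zeta_close (eps : R) : 0 < eps -> exists M0 : nat, forall M : nat, (M0 <= M)%nat ->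
  forall s, 2 <= Re s -> Cmod (zeta s ^ k - trunc_zeta M s ^ k) <= eps.
Proof.
  (* The bound [e1 <= 1] keeps the partial sum below 3, as zeta is at most 2 here; the other bound
     compensates the constant of [Cpow_diff] at [A = 3]. *)
  move=> He; pose e1 := Rmin 1 (eps / (INR k * 3 ^ k + 1)).
  have K0 : 0 < INR k * 3 ^ k + 1.
    have : 0 <= INR k * 3 ^ k by apply: Rmult_le_pos; [apply: pos_INR | apply: pow_le; lra].
    lra.
  have He1 : 0 < e1 by apply: Rmin_pos; [lra | apply: Rdiv_pos_pos].
  have [N HN] := zeta_tail zeta Hzeta e1 He1.
  exists N.+1 => -[|M] // HM s Hs.
  have E : trunc_zeta M.+1 s = sum_n (fun n => nat_Cpow_opp n.+1 s) M by rewrite sum_n_big.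
  have T := HN M HM s Hs; rewrite -E in T.
  have L1 : e1 <= 1 by apply: Rmin_l.
  have L2 : e1 <= eps / (INR k * 3 ^ k + 1) by apply: Rmin_r.
  have Z2 := zeta_right_bound s Hs.
  have Z3 : Cmod (trunc_zeta M.+1 s) <= 3.
    have -> : (trunc_zeta M.+1 s = zeta s - (zeta s - trunc_zeta M.+1 s))%C by ring.
    by apply: Rle_trans (Cmod_minus_le _ _) _; lra.
  apply: Rle_trans (Cpow_diff 3 _ _ k _ _ Z3) _; try lra.
  have Pk : 0 <= INR k * 3 ^ k by apply: Rmult_le_pos; [apply: pos_INR | apply: pow_le; lra].
  apply: (Rle_trans _ (INR k * 3 ^ k * e1)); first by apply: Rmult_le_compat_l; lra.
  have X : e1 * (INR k * 3 ^ k + 1) <= eps.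
    have -> : eps = eps / (INR k * 3 ^ k + 1) * (INR k * 3 ^ k + 1) by field; lra.
    by apply: Rmult_le_compat_r; lra.
  nra.
Qed.

Lemma ctn_zeta_vert (x t v : R) : 0 < t + v -> ctn (fun v => zeta ((x, t) + (0, v))%C) v.
Proof.
  move=> Hv; apply: (holo_ctn zeta (fun v => (x, t) + (0, v))%C).
    by apply: zeta_holo => //; apply: Im_neq1.
  by apply: ctn_plus; [apply: ctn_const | apply: ctn_vert].
Qed.

Lemma ctn_pow (f : R -> C) (t : R) (n : nat) : ctn f t -> ctn (fun u => f u ^ n)%C t.
Proof.
  by move=> Hf; elim: n => [|n IH] /=; [apply: ctn_const | apply: ctn_mult].
Qed.

(** The three error terms are the left side, where [|w| >= eta] and the kernel is at most
    [exp (1 - eta log Y)]; the horizontal sides, estimated by the growth of zeta, which is why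
    [t - H >= 5] is required; and the replacement of zeta by its partial sum on the right side,
    where [Re (s + w) >= 2]. *)
Lemma approx_formula (M : nat) (sigma eta t H Y rho : R) :
  1 / 2 <= sigma - eta -> sigma < 1 -> 0 < eta <= 1 -> 1 <= H -> H + 5 <= t -> 1 <= Y -> 0 <= rho ->
  (forall s, 2 <= Re s -> Cmod (zeta s ^ k - trunc_zeta M s ^ k) <= rho) ->
  Cmod (RtoC (2 * PI) * zeta (sigma, t) ^ k - dir_poly (coef k M sigma H Y) (M ^ k) t) <=
  2 * RInt (fun v => exp 1 / eta * exp (- (eta * ln Y)) * Cmod (zeta (sigma - eta, t + v)) ^ k) (- H) H
  + 12 * ((12 * (t + H + 3)) ^ k * exp (2 * ln Y + 4 - H ^ 2))
  + 2 * H * (rho * exp (2 * ln Y + 4)).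
Proof.
  move=> Hx0 Hs He HH Ht HY Hrho Htr; have Hab : - H <= H by lra.
  have LY : 0 <= ln Y by rewrite -ln_1; apply: ln_le; lra.
  pose s : C := (sigma, t).
  pose f w := (zeta (s + w) ^ k * kern (ln Y) w)%C.
  have Hf x y : - eta <= x <= 2 -> - H <= y <= H -> holo f (x, y).
    move=> Hx Hy; apply: holo_mult; last by apply: holo_kern.
    apply: (holo_pow (fun w => zeta (s + w)%C)); apply: holo_shift; apply: zeta_holo => //.
    by apply: Im_neq1; rewrite /s /Im /=; lra.
  have Hz x y : - eta <= x <= 2 -> - H <= y <= H ->
      Cmod (zeta (s + (x, y))%C ^ k) <= (12 * (t + H + 3)) ^ k.
    move=> Hx Hy; rewrite Cmod_pow; apply: pow_incr; split; first exact: Cmod_ge_0.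
    apply: Rle_trans (zeta_growth zeta Hzeta _ _ _) _; rewrite /s /Re /Im /=; try lra.
    apply: Rmult_le_compat_l; first lra.
    apply: Rle_trans (Cmod_le_sum _) _; rewrite /Re /Im /= !Rabs_pos_eq; lra.
  pose B := (12 * (t + H + 3)) ^ k * exp (2 * ln Y + 4 - H ^ 2).
  have B0 : 0 <= B.
    by apply: Rmult_le_pos; [apply: pow_le; lra | exact: exp_ge0].
  have Hhor x y : - eta <= x <= 2 -> - H <= y <= H -> y ^ 2 = H ^ 2 -> Cmod (f (x, y)) <= B.
    move=> Hx Hy Hy2; rewrite /f Cmod_mult Cmod_kern Hy2; apply: Rmult_le_compat.
    - exact: Cmod_ge_0.
    - exact: exp_ge0.
    - exact: Hz.
    - by apply: exp_le; nra.
  have S := cauchy_rect_split f eta 2 H B by_lra by_lra by_lra Hf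
    (fun x Hx => conj (Hhor x H Hx by_lra erefl) (Hhor x (- H) Hx by_lra (ltac:(ring)))).
  have F0 : f 0 = (zeta (sigma, t) ^ k)%C.
    rewrite /f /kern; have -> : (s + 0 = s)%C by ring.
    have -> : (0 * RtoC (ln Y) + 0 * 0 = 0)%C by ring.
    by rewrite cexp_0 Cmult_1_r.
  rewrite F0 in S.
  have cf x : - eta <= x <= 2 -> x <> 0 -> con (- H) H (fun v => f (x, v) / (x, v))%C.
    move=> Hx Hx0' v Hv; apply: ctn_div; [| apply: ctn_vert | by apply: pair_neq0; left].
    by apply: holo_ctn; [apply: Hf | apply: ctn_vert].
  have ct : con (- H) H (fun v => trunc_zeta M (s + (2, v)) ^ k * kern (ln Y) (2, v) / (2, v))%C.
    move=> v Hv; apply: ctn_div; [| apply: ctn_vert | by apply: pair_neq0; left; lra].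
    apply: ctn_mult; last by apply: holo_ctn; [apply: holo_kern | apply: ctn_vert].
    apply: (ctn_pow (fun v => trunc_zeta M (s + (2, v))%C)).
    apply: (holo_ctn (trunc_zeta M) (fun v => s + (2, v))%C); last first.
      by apply: ctn_plus; [apply: ctn_const | apply: ctn_vert].
    case: (M) => [|M'].
      by apply: (holo_ext (fun _ => RtoC 0)); [move=> z; rewrite /trunc_zeta big_ord0 | apply: holo_const].
    apply: (holo_ext (fun z => sum_n (fun n => nat_Cpow_opp n.+1 z) M')).
      by move=> z; rewrite sum_n_big.
    by apply: holo_sum => n; apply: holo_nat_Cpow.
  have Rt : Cmod (CInt (fun v => f (2, v) / (2, v))%C (- H) H -
      dir_poly (coef k M sigma H Y) (M ^ k) t) <= 2 * H * (rho * exp (2 * ln Y + 4)).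
    rewrite -trunc_main_term; last lra.
    rewrite -CInt_minus //; last by apply: cf; lra.
    apply: Rle_trans (CInt_bound_const _ _ Hab _ (rho * exp (2 * ln Y + 4) / 2) _ _) _.
    - by apply: con_plus; [apply: cf; lra | apply: con_opp].
    - move=> v Hv; rewrite [X in Cmod X](_ : _ = (zeta (s + (2, v)) ^ k - trunc_zeta M (s + (2, v)) ^ k) *
        kern (ln Y) (2, v) / (2, v))%C; last first.
        have D (a b c e : C) : (a * c / e - b * c / e = (a - b) * c / e)%C by rewrite /Cdiv; ring.
        exact: D.
      apply: Cmod_div_le; first lra.
        by apply: Rle_trans (Cmod_pair_ge _ _); rewrite Rabs_pos_eq; lra.
      rewrite Cmod_mult Cmod_kern.
      apply: Rmult_le_compat; [exact: Cmod_ge_0 | exact: exp_ge0 | |].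
        by apply: Htr; rewrite /s /Re /=; lra.
      by apply: exp_le; have := pow2_ge_0 v; lra.
    - by right; field.
  have Lt : Cmod (CInt (fun v => f ((- eta)%R, v) / ((- eta)%R, v))%C (- H) H) <=
     2 * RInt (fun v => exp 1 / eta * exp (- (eta * ln Y)) * Cmod (zeta (sigma - eta, t + v)) ^ k) (- H) H.
    apply: CInt_bound => //.
    - by apply: cf; lra.
    - apply: ex_RInt_on => // v Hv; apply: continuousM.
        exact: continuous_const.
      apply: (continuous_ext (fun v => Cmod (zeta ((sigma - eta)%R, (t + v)%R) ^ k)%C)).
        by move=> x; rewrite Cmod_pow.
      apply: ctn_Cmod; apply: (ctn_pow (fun v => zeta ((sigma - eta)%R, (t + v)%R))).
      have := ctn_zeta_vert (sigma - eta) t v by_lra.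
      have E u : (((sigma - eta)%R, t) + (0, u))%C = ((sigma - eta)%R, (t + u)%R).
        by apply: C_ext; rewrite /Re /Im /= ?Rplus_0_r.
      by move=> [C1 C2]; split; [apply: continuous_ext C1 | apply: continuous_ext C2] => u; rewrite E.
    - move=> v Hv.
      have -> : exp 1 / eta * exp (- (eta * ln Y)) * Cmod (zeta (sigma - eta, t + v)) ^ k =
        Cmod (zeta (sigma - eta, t + v)) ^ k * exp (1 + - (eta * ln Y)) / eta.
        by rewrite exp_plus; field; lra.
      apply: Cmod_div_le; first lra.
        by apply: Rle_trans (Cmod_pair_ge _ _); rewrite Rabs_Ropp Rabs_pos_eq; lra.
      rewrite /f Cmod_mult Cmod_kern Cmod_pow.
      have -> : (s + ((- eta)%R, v))%C = (sigma - eta, t + v) by [].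
      apply: Rmult_le_compat_l; first by apply: pow_le; apply: Cmod_ge_0.
      by apply: exp_le; have := pow2_ge_0 v; nra.
  move: S Rt Lt; set r := CInt _ _ _; set l := CInt _ _ _; set P := dir_poly _ _ _.
  set X := (RtoC (2 * PI) * _)%C => S Rt Lt.
  have -> : (X - P = (r - P) - (r - X - l) - l)%C by ring.
  apply: Rle_trans (Cmod_minus_le _ _) _.
  apply: Rle_trans (Rplus_le_compat_r _ _ _ (Cmod_minus_le _ _)) _.
  (* The width [2 + eta] is at most 3, hence the factor 12. *)
  have BH : 4 * ((2 + eta) * (B / H)) <= 12 * B.
    have X1 : B / H <= B.
      rewrite -[X in _ <= X]Rmult_1_r; apply: Rmult_le_compat_l => //.
      by rewrite -[X in _ <= X]Rinv_1; apply: Rinv_le_contravar; lra.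
    have X2 : 0 <= B / H by apply: Rmult_le_pos => //; left; apply: Rinv_pos; lra.
    nra.
  rewrite -/B; lra.
Qed.

End Approximation.

(** * Integrated estimates *)

Lemma RInt_ge0 (f : R -> R) (a b : R) : a <= b -> (forall t, a <= t <= b -> continuous f t) ->
  (forall t, a <= t <= b -> 0 <= f t) -> 0 <= RInt f a b.
Proof.
  move=> Hab Hc H.
  have -> : 0 = RInt (fun _ => 0) a b by rewrite RInt_const /scal /= /mult /=; ring.
  apply: RInt_le => //; [exact: ex_RInt_const | exact: ex_RInt_on | move=> x Hx; apply: H; lra].
Qed.

Lemma RInt_ChaslesR (f : R -> R) (a b c : R) : ex_RInt f a b -> ex_RInt f b c ->
  RInt f a b + RInt f b c = RInt f a c.
Proof. exact: (RInt_Chasles (V := R_CompleteNormedModule)). Qed.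

Lemma RInt_shift (f : R -> R) (t a b : R) : ex_RInt f (a + t) (b + t) ->
  (RInt (fun v => f (t + v)) a b : R) = RInt f (a + t) (b + t).
Proof.
  move=> H; have := RInt_comp_lin (V := R_CompleteNormedModule) f 1 t a b.
  rewrite !Rmult_1_l => /(_ H) <-; apply: RInt_extR => v.
  by rewrite /scal /= /mult /= Rmult_1_l Rmult_1_l Rplus_comm.
Qed.

(** Expand the integral of [(g - m)^2 >= 0], where [m] is the mean value of [g]. *)
Lemma RInt_Cauchy_Schwarz (g : R -> R) (a b : R) : a < b ->
  (forall t, a <= t <= b -> continuous g t) ->
  (RInt g a b) ^ 2 <= (b - a) * RInt (fun t => g t ^ 2) a b.
Proof.
  move=> Hab Hc; have Hle : a <= b by lra.
  have c2 t : a <= t <= b -> continuous (fun t => g t ^ 2) t.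
    move=> /Hc X; apply: (continuous_ext (fun t => g t * g t)); first by move=> x /=; ring.
    exact: continuousM.
  have e1 := ex_RInt_on g a b Hle Hc; have e2 := ex_RInt_on _ a b Hle c2.
  pose I := RInt g a b; pose m := I / (b - a).
  have cm t : a <= t <= b -> continuous (fun t => (g t ^ 2 - 2 * m * g t) + m ^ 2) t.
    move=> Ht; apply: continuousD; last exact: continuous_const.
    apply: (continuous_minus (K := R_AbsRing) (V := R_NormedModule)); first exact: c2.
    by apply: continuousM; [apply: continuous_const | apply: Hc].
  have P : 0 <= RInt (fun t => (g t ^ 2 - 2 * m * g t) + m ^ 2) a b.
    apply: RInt_ge0 => // t Ht.
    have -> : g t ^ 2 - 2 * m * g t + m ^ 2 = (g t - m) ^ 2 by ring.
    exact: pow2_ge_0.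
  have e3 := ex_RInt_Rscal a b (2 * m) g e1.
  have e4 : ex_RInt (fun t => g t ^ 2 - 2 * m * g t) a b.
    by apply: (ex_RInt_minus (V := R_NormedModule)).
  rewrite RInt_Rplus // in P; last exact: ex_RInt_const.
  rewrite RInt_Rminus // RInt_Rscal // RInt_const -/I in P.
  have E : scal (b - a) (m ^ 2) = m * I.
    by rewrite /scal /= /mult /= /m; field; lra.
  rewrite E in P; rewrite -/I.
  have -> : I ^ 2 = (b - a) * (m * I) by rewrite /m; field; lra.
  apply: Rmult_le_compat_l; lra.
Qed.

(** The cross term is split pointwise with a free weight [lam]; the condition [lam <= 1] lets the
    square of the difference be absorbed into the term with [2 / lam]. *)
Lemma mean_square_compare (f p : R -> C) (S T lam : R) : S <= T -> 0 < lam <= 1 ->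
  con S T f -> con S T p ->
  Rabs (RInt (fun t => Cmod (f t) ^ 2) S T - RInt (fun t => Cmod (p t) ^ 2) S T) <=
  lam * RInt (fun t => Cmod (p t) ^ 2) S T + 2 / lam * RInt (fun t => Cmod (f t - p t) ^ 2) S T.
Proof.
  move=> HST Hl cf cp.
  have sq (h : R -> C) : con S T h -> ex_RInt (fun t => Cmod (h t) ^ 2) S T.
    move=> ch; apply: ex_RInt_on => // t Ht.
    apply: (continuous_ext (fun t => Cmod (h t) * Cmod (h t))); first by move=> x /=; ring.
    by apply: continuousM; apply: ctn_Cmod; apply: ch.
  have e1 := sq f cf; have e2 := sq p cp.
  have e3 : ex_RInt (fun t => Cmod (f t - p t) ^ 2) S T.
    by apply: (sq (fun t => f t - p t)%C); apply: con_plus => //; apply: con_opp.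
  rewrite -RInt_Rminus // -!RInt_Rscal // -RInt_Rplus; try exact: ex_RInt_Rscal.
  apply: (norm_RInt_le (V := R_NormedModule)
    (fun t => Cmod (f t) ^ 2 - Cmod (p t) ^ 2)
    (fun t => lam * Cmod (p t) ^ 2 + 2 / lam * Cmod (f t - p t) ^ 2) S T) => //; last first.
  - apply: RInt_correctR.
    by apply: (ex_RInt_plus (V := R_NormedModule)); apply: ex_RInt_Rscal.
  - apply: RInt_correctR.
    exact: (ex_RInt_minus (V := R_NormedModule)).
  move=> t _; rewrite -[norm _]/(Rabs (Cmod (f t) ^ 2 - Cmod (p t) ^ 2)).
  set a := Cmod (f t); set b := Cmod (p t); set e := Cmod (f t - p t).
  have A1 : a <= b + e.
    rewrite /a; have -> : (f t = p t + (f t - p t))%C by ring.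
    have -> : e = Cmod (f t - p t) by [].
    by apply: Cmod_triangle.
  have A2 : b <= a + e.
    rewrite /b; have -> : (p t = f t - (f t - p t))%C by ring.
    by apply: Cmod_minus_le.
  have a0 : 0 <= a by exact: Cmod_ge_0.
  have b0 : 0 <= b by exact: Cmod_ge_0.
  have e0 : 0 <= e by exact: Cmod_ge_0.
  (* AM-GM: [2 b e <= lam b^2 + e^2 / lam] *)
  have B : 2 * b * e <= lam * b ^ 2 + / lam * e ^ 2.
    have X : 0 <= / lam * (lam * b - e) ^ 2.
      by apply: Rmult_le_pos; [left; apply: Rinv_pos; lra | apply: pow2_ge_0].
    have -> : lam * b ^ 2 + / lam * e ^ 2 = / lam * (lam * b - e) ^ 2 + 2 * b * e by field; lra.
    lra.
  have L1 : 1 <= / lam by rewrite -[X in X <= _]Rinv_1; apply: Rinv_le_contravar; lra.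
  have L2 : 2 / lam * e ^ 2 >= / lam * e ^ 2 + e ^ 2.
    by rewrite /Rdiv; have := pow2_ge_0 e; nra.
  have Q : Rabs (a ^ 2 - b ^ 2) <= 2 * b * e + e ^ 2.
    by apply/Rabs_le_between; nra.
  lra.
Qed.

Lemma divisor_sum_bound (k : nat) (a : R) : 1 < a -> exists B, forall N : nat,
  \sumR_(n < N) (INR (divisor_fun k n.+1) ^ 2 * Rpower (INR n.+1) (- a)) <= B.
Proof.
  (* A quarter of the excess [a - 1] goes into each of the two divisor factors, leaving the
     convergent exponent [1 + (a - 1) / 2]. *)
  move=> Ha; have [K [HK H]] := divisor_fun_bound k ((a - 1) / 4) by_lra.
  exists (K ^ 2 * (1 + / ((a - 1) / 2))) => N.
  apply: (Rle_trans _ (\sumR_(n < N) (K ^ 2 * Rpower (INR n.+1) (- (1 + (a - 1) / 2))))).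
    apply: big_Rle => n.
    have -> : - (1 + (a - 1) / 2) = (a - 1) / 4 + (a - 1) / 4 + - a by field.
    rewrite !Rpower_plus -!Rmult_assoc; apply: Rmult_le_compat_r; first exact: Rpower_ge0.
    have -> : K ^ 2 * Rpower (INR n.+1) ((a - 1) / 4) * Rpower (INR n.+1) ((a - 1) / 4) =
       (K * Rpower (INR n.+1) ((a - 1) / 4)) ^ 2 by ring.
    by apply: pow_incr; split; [apply: pos_INR | apply: H].
  rewrite big_Rscal; apply: Rmult_le_compat_l; first exact: pow2_ge_0.
  have Hi : 0 < / ((a - 1) / 2) by apply: Rinv_pos; lra.
  case: N => [|N]; first by rewrite big_ord0; lra.
  rewrite -(sum_n_bigR (fun n => Rpower (INR n.+1) (- (1 + (a - 1) / 2)))).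
  by apply: Rpower_sum_bound; lra.
Qed.

Lemma mean_coeff_series (k : nat) (sigma : R) : 1 / 2 < sigma ->
  is_series (fun n => INR (divisor_fun k n.+1) ^ 2 * Rpower (INR n.+1) (- (2 * sigma)))
    (mean_coeff k sigma).
Proof.
  move=> Hs; apply: Series_correct.
  have [B HB] := divisor_sum_bound k (2 * sigma) by_lra.
  apply: (ex_series_nonneg_bounded _ B) => n.
    by apply: Rmult_le_pos; [apply: pow2_ge_0 | exact: Rpower_ge0].
  rewrite sum_n_bigR; exact: (HB n.+1).
Qed.

Lemma big_le_extend (F : nat -> R) (M N : nat) : (M <= N)%nat -> (forall n, 0 <= F n) ->
  \sumR_(n < M) F n <= \sumR_(n < N) F n.
Proof.
  move=> /subnK <- HF; elim: (N - M)%nat => [|j IH]; first by rewrite add0n; lra.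
  have -> : \sumR_(n < j.+1 + M) F n = \sumR_(n < j + M) F n + F (j + M)%nat.
    by rewrite addSn big_ord_recr.
  by have := HF (j + M)%nat; lra.
Qed.

(** Factoring [W^2 - (2 PI)^2] and inserting the closeness of [W] to [2 PI] gives a gain [Y^(- eta)]
    and a loss [n^eta]. The loss is affordable as long as the series with exponent [2 sigma - eta]
    converges. The term with [tau] pays for the truncation of the divisor function. *)
Lemma diagonal (k : nat) (sigma eta K B1 : R) : (0 < k)%nat -> 1 / 2 < sigma -> 1 <= K ->
  (forall H u, 1 <= H -> 3 * u <= H ^ 2 ->
    Cmod (weight H u - RtoC (2 * PI)) <= K * H * exp (- (eta * u)) /\
    Cmod (weight H u) <= K * H) ->
  (forall N : nat, \sumR_(n < N) (INR (divisor_fun k n.+1) ^ 2 *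
      Rpower (INR n.+1) (- (2 * sigma - eta))) <= B1) ->
  forall tau, 0 < tau -> exists M0 : nat, forall M : nat, (M0 <= M)%nat -> forall H Y,
    1 <= H -> 3 * ln Y <= H ^ 2 ->
    Rabs (\sumR_(n < M ^ k) (coef k M sigma H Y n) ^ 2 -
      (2 * PI) ^ 2 * mean_coeff k sigma) <=
    9 * K ^ 2 * H ^ 2 * exp (- (eta * ln Y)) * B1 + (2 * PI) ^ 2 * tau.
Proof.
  move=> Hk Hs HK HW HB1 tau Htau.
  have HS := mean_coeff_series k sigma Hs.
  pose a n := INR (divisor_fun k n.+1) ^ 2 * Rpower (INR n.+1) (- (2 * sigma)).
  pose aM M n := INR (trunc_divisor_fun k M n.+1) ^ 2 * Rpower (INR n.+1) (- (2 * sigma)).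
  have [M0 HM0] := is_series_R_eps _ _ tau HS Htau.
  exists M0.+1 => -[|M] // HM H Y HH HY.
  have a0 n : 0 <= a n.
    by apply: Rmult_le_pos; [apply: pow2_ge_0 | exact: Rpower_ge0].
  have aM0 n : 0 <= aM M.+1 n.
    by apply: Rmult_le_pos; [apply: pow2_ge_0 | exact: Rpower_ge0].
  have dle n : INR (trunc_divisor_fun k M.+1 n.+1) <= INR (divisor_fun k n.+1).
    by apply: le_INR; apply/leP; apply: trunc_divisor_fun_le.
  have aMa n : aM M.+1 n <= a n.
    apply: Rmult_le_compat_r; first exact: Rpower_ge0.
    by apply: pow_incr; split; [apply: pos_INR | apply: dle].
  pose W n := Re (weight H (ln Y - ln (INR n.+1))).
  have Hu n : 3 * (ln Y - ln (INR n.+1)) <= H ^ 2.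
    have : 0 <= ln (INR n.+1).
      rewrite -ln_1; apply: ln_le; [lra | exact: INR_S_pos].
    lra.
  have Hw n : Rabs (W n ^ 2 - (2 * PI) ^ 2) <=
      9 * K ^ 2 * H ^ 2 * exp (- (eta * ln Y)) * Rpower (INR n.+1) eta.
    have [N1 N2] := HW H _ HH (Hu n).
    have E1 : weight H (ln Y - ln (INR n.+1)) = RtoC (W n) by apply: weight_real; lra.
    rewrite E1 -RtoC_minus !Cmod_R in N1 N2.
    have -> : W n ^ 2 - (2 * PI) ^ 2 = (W n - 2 * PI) * (W n + 2 * PI) by ring.
    rewrite Rabs_mult.
    have KH : 1 <= K * H by nra.
    have S1 : Rabs (W n + 2 * PI) <= 9 * (K * H).
      apply: Rle_trans (Rabs_triang _ _) _; rewrite (Rabs_pos_eq (2 * PI)); last first.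
        by have := PI_RGT_0; lra.
      have := PI_4; lra.
    have -> : 9 * K ^ 2 * H ^ 2 * exp (- (eta * ln Y)) * Rpower (INR n.+1) eta =
        (K * H * exp (- (eta * (ln Y - ln (INR n.+1))))) * (9 * (K * H)).
      have -> : - (eta * (ln Y - ln (INR n.+1))) = - (eta * ln Y) + eta * ln (INR n.+1) by ring.
      by rewrite /Rpower exp_plus; ring.
    by apply: Rmult_le_compat => //; apply: Rabs_pos.
  have E2 : \sumR_(n < M.+1 ^ k) (coef k M.+1 sigma H Y n) ^ 2 =
      \sumR_(n < M.+1 ^ k) (aM M.+1 n * (W n ^ 2 - (2 * PI) ^ 2)) +
      (2 * PI) ^ 2 * \sumR_(n < M.+1 ^ k) aM M.+1 n.
    rewrite -big_Rscal -big_Rplus; apply: eq_bigr => n _; rewrite /coef -/(W n) /aM.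
    have -> : Rpower (INR n.+1) (- (2 * sigma)) = Rpower (INR n.+1) (- sigma) ^ 2.
      have -> : - (2 * sigma) = - sigma + - sigma by ring.
      by rewrite Rpower_plus; ring.
    by ring.
  rewrite E2.
  have T1 : Rabs (\sumR_(n < M.+1 ^ k) (aM M.+1 n * (W n ^ 2 - (2 * PI) ^ 2))) <=
      9 * K ^ 2 * H ^ 2 * exp (- (eta * ln Y)) * B1.
    apply: Rle_trans (big_Rabs _ _) _.
    have C0 : 0 <= 9 * K ^ 2 * H ^ 2 * exp (- (eta * ln Y)).
      apply: Rmult_le_pos; last exact: exp_ge0.
      by apply: Rmult_le_pos; [have := pow2_ge_0 K; lra | apply: pow2_ge_0].
    apply: (Rle_trans _ (\sumR_(n < M.+1 ^ k) (9 * K ^ 2 * H ^ 2 * exp (- (eta * ln Y)) *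
       (INR (divisor_fun k n.+1) ^ 2 * Rpower (INR n.+1) (- (2 * sigma - eta)))))); last first.
      by rewrite big_Rscal; apply: Rmult_le_compat_l.
    apply: big_Rle => n; rewrite Rabs_mult (Rabs_pos_eq (aM _ _)) //.
    apply: (Rle_trans _ (a n * (9 * K ^ 2 * H ^ 2 * exp (- (eta * ln Y)) * Rpower (INR n.+1) eta))).
      by apply: Rmult_le_compat => //; apply: Rabs_pos.
    right; rewrite /a; have -> : - (2 * sigma - eta) = - (2 * sigma) + eta by ring.
    by rewrite Rpower_plus; ring.
  (* Truncation is squeezed: the truncated sum lies below the full series and above its first
     [M + 1] terms, on which the truncated divisor function is exact. *)
  have T2 : Rabs (\sumR_(n < M.+1 ^ k) aM M.+1 n - mean_coeff k sigma) <= tau.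
    have U1 : \sumR_(n < M.+1 ^ k) aM M.+1 n <= mean_coeff k sigma.
      apply: (Rle_trans _ (\sumR_(n < M.+1 ^ k) a n)); first by apply: big_Rle => n.
      have : (0 < M.+1 ^ k)%nat by rewrite expn_gt0.
      case: (M.+1 ^ k)%nat => // N _; rewrite -sum_n_bigR.
      exact: sum_n_le_is_series.
    have U2 : \sumR_(n < M.+1) a n <= \sumR_(n < M.+1 ^ k) aM M.+1 n.
      apply: (Rle_trans _ (\sumR_(n < M.+1) aM M.+1 n)).
        apply: big_Rle => n; apply: Rmult_le_compat_r; first exact: Rpower_ge0.
        apply: pow_incr; split; first exact: pos_INR.
        by apply: le_INR; apply/leP; apply: trunc_divisor_fun_ge.
      apply: big_le_extend => //.
      by rewrite -{1}(expn1 M.+1); apply: leq_pexp2l.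
    have /Rabs_def2 [_ U3] := HM0 M HM; rewrite (sum_n_bigR a) in U3.
    by apply/Rabs_le_between; lra.
  set X := \big[_/_]_(n < _) (aM _ _ * _) in T1 *; set X2 := \big[_/_]_(n < _) aM _ _ in T2 *.
  have -> : X + (2 * PI) ^ 2 * X2 - (2 * PI) ^ 2 * mean_coeff k sigma =
    X + (2 * PI) ^ 2 * (X2 - mean_coeff k sigma) by ring.
  apply: Rle_trans (Rabs_triang _ _) _; apply: Rplus_le_compat => //.
  rewrite Rabs_mult (Rabs_pos_eq ((2 * PI) ^ 2)); last exact: pow2_ge_0.
  by apply: Rmult_le_compat_l => //; apply: pow2_ge_0.
Qed.

(** The decay rate [p = 1 - sigma + 2 d] is chosen so that [n^d n^(- sigma) n^(- p) = n^(- 1 - d)],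
    the form required by [mean_square]. Its cost is the factor [Y^p]. *)
Lemma coef_bound (k M : nat) (sigma d K Kd H Y : R) : 0 < d -> 0 <= 1 - sigma + 2 * d <= 2 ->
  0 <= Kd -> 0 <= K -> 1 <= H -> 3 * ln Y <= H ^ 2 ->
  (forall n, INR (divisor_fun k n.+1) <= Kd * Rpower (INR n.+1) d) ->
  (forall H u, 1 <= H -> 3 * u <= H ^ 2 -> forall p, 0 <= p <= 2 ->
     Cmod (weight H u) <= K * H * exp (p * u)) ->
  forall n, Rabs (coef k M sigma H Y n) <=
    Kd * K * H * exp ((1 - sigma + 2 * d) * ln Y) * Rpower (INR n.+1) (- (1 + d)).
Proof.
  move=> Hd Hp HKd HK HH HY Hdiv HW n; rewrite /coef !Rabs_mult.
  have L : 0 <= ln (INR n.+1) by rewrite -ln_1; apply: ln_le; [lra | exact: INR_S_pos].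
  have X := Rle_trans _ _ _ (re_le_Cmod _) (HW H (ln Y - ln (INR n.+1)) HH by_lra _ Hp).
  rewrite (Rabs_pos_eq (INR _)); last exact: pos_INR.
  rewrite (Rabs_pos_eq (Rpower _ _)); last exact: Rpower_ge0.
  apply: (Rle_trans _ ((Kd * Rpower (INR n.+1) d) * Rpower (INR n.+1) (- sigma) *
     (K * H * exp ((1 - sigma + 2 * d) * (ln Y - ln (INR n.+1)))))).
    apply: Rmult_le_compat => //.
    - by apply: Rmult_le_pos; [apply: pos_INR | exact: Rpower_ge0].
    - exact: Rabs_pos.
    - apply: Rmult_le_compat_r; first exact: Rpower_ge0.
      apply: Rle_trans (Hdiv n).
      by apply: le_INR; apply/leP; apply: trunc_divisor_fun_le.
  right.
  have -> : exp ((1 - sigma + 2 * d) * (ln Y - ln (INR n.+1))) =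
      exp ((1 - sigma + 2 * d) * ln Y) * Rpower (INR n.+1) (- (1 - sigma + 2 * d)).
    by rewrite /Rpower -exp_plus; congr exp; ring.
  have -> : - (1 + d) = d + - sigma + - (1 - sigma + 2 * d) by ring.
  by rewrite !Rpower_plus; ring.
Qed.

(** * Moments of zeta over short windows *)

Section Moments.
Variable zeta : C -> C.
Hypothesis Hzeta : is_riemann_zeta zeta.
Variable k : nat.

Lemma continuous_moment (x t : R) : 0 < t ->
  continuous (fun t => Cmod (zeta (x, t)) ^ (2 * k)%nat) t.
Proof.
  move=> Ht; elim: (2 * k)%nat => [|n IH] /=; first exact: continuous_const.
  apply: continuousM => //; apply: ctn_Cmod.
  apply: (holo_ctn zeta (fun t => (x, t))); last exact: ctn_vert.
  by apply: zeta_holo => //; apply: Im_neq1.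
Qed.

Lemma ex_RInt_moment (x a b : R) : 0 < a -> 0 < b ->
  ex_RInt (fun t => Cmod (zeta (x, t)) ^ (2 * k)%nat) a b.
Proof.
  move=> Ha Hb; apply: (ex_RInt_contR) => z Hz.
  apply: continuous_moment; have : 0 < Rmin a b by apply: Rmin_pos.
  lra.
Qed.

Lemma moment_incr (x a b : R) : 1 <= a <= b -> zeta_moment zeta k x a <= zeta_moment zeta k x b.
Proof.
  move=> Hab; rewrite /zeta_moment -(RInt_ChaslesR _ 1 a b); try (apply: ex_RInt_moment; lra).
  have : 0 <= RInt (fun t => Cmod (zeta (x, t)) ^ (2 * k)%nat) a b; last lra.
  apply: RInt_ge0; first lra.
    by move=> t Ht; apply: continuous_moment; lra.
  by move=> t Ht; apply: pow_le; apply: Cmod_ge_0.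
Qed.

Lemma moment_ge0 (x a : R) : 1 <= a -> 0 <= zeta_moment zeta k x a.
Proof.
  move=> Ha; apply: RInt_ge0 => //; first by move=> t Ht; apply: continuous_moment; lra.
  by move=> t Ht; apply: pow_le; apply: Cmod_ge_0.
Qed.

Lemma continuous_zeta_moment (x t : R) : 0 < t -> continuous (zeta_moment zeta k x) t.
Proof.
  move=> Ht; apply: derive_continuous.
  exists (Cmod (zeta (x, t)) ^ (2 * k)%nat).
  apply: (is_derive_RInt (V := R_NormedModule) (fun t => Cmod (zeta (x, t)) ^ (2 * k)%nat) _ 1 t).
    exists (mkposreal t Ht) => y Hy; apply: RInt_correctR.
    apply: ex_RInt_moment; first lra.
    by move: Hy; rewrite /ball /= /AbsRing_ball /= /abs /minus /plus /opp /= => /Rabs_def2; lra.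
  exact: continuous_moment.
Qed.

(** Cauchy-Schwarz on a window of length [2 H]. Writing the integral over the window as a difference
    of values of the moment function prepares its integration in [t]. *)
Lemma window_bound (x t H c : R) : 1 <= H -> H + 1 <= t ->
  (RInt (fun v => c * Cmod (zeta (x, t + v)) ^ k) (- H) H) ^ 2 <=
  c ^ 2 * (2 * H) * (zeta_moment zeta k x (t + H) - zeta_moment zeta k x (t - H)).
Proof.
  move=> HH Ht.
  have cg v : - H <= v <= H -> continuous (fun v => c * Cmod (zeta (x, t + v)) ^ k) v.
    move=> Hv; apply: continuousM; first exact: continuous_const.
    apply: (continuous_ext (fun v => Cmod (zeta (x, (t + v)%R) ^ k)%C)); first by move=> u; rewrite Cmod_pow.
    apply: ctn_Cmod; apply: (ctn_pow (fun v => zeta (x, (t + v)%R))).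
    apply: (holo_ctn zeta (fun v => (x, (t + v)%R))).
      by apply: zeta_holo => //; apply: Im_neq1; rewrite /Im /=; lra.
    apply: ctn_pair; first exact: continuous_const.
    apply: continuousD; first exact: continuous_const.
    exact: continuous_id.
  apply: Rle_trans (RInt_Cauchy_Schwarz _ (- H) H by_lra cg) _.
  have -> : RInt (fun v => (c * Cmod (zeta (x, t + v)) ^ k) ^ 2) (- H) H =
      c ^ 2 * (zeta_moment zeta k x (t + H) - zeta_moment zeta k x (t - H)).
    have e : ex_RInt (fun t => Cmod (zeta (x, t)) ^ (2 * k)%nat) (- H + t) (H + t).
      by apply: ex_RInt_moment; lra.
    have -> : zeta_moment zeta k x (t + H) - zeta_moment zeta k x (t - H) =
        RInt (fun t => Cmod (zeta (x, t)) ^ (2 * k)%nat) (- H + t) (H + t).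
      rewrite /zeta_moment -(RInt_ChaslesR _ 1 (t - H) (t + H)); try (apply: ex_RInt_moment; lra).
      have -> : t - H = - H + t by ring.
      have -> : t + H = H + t by ring.
      ring.
    rewrite -(RInt_shift _ t (- H) H e) -RInt_Rscal.
      by apply: RInt_extR => v; rewrite Rpow_mult_distr -pow_mult mulnC.
    apply: ex_RInt_on; first lra.
    move=> v Hv; apply: (continuous_comp (fun v => t + v) (fun t => Cmod (zeta (x, t)) ^ (2 * k)%nat)).
      apply: continuousD; first exact: continuous_const.
      exact: continuous_id.
    by apply: continuous_moment; lra.
  by right; ring.
Qed.

(** This replaces an exchange of integrations. With [G] the moment function, the two shifted
    integrals overlap and leave the integral of [G] over [[T - H, T + H]] minus the one over
    [[S - H, S + H]]; the first is at most [2 H G (T + H)] by monotonicity and the second is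
    nonnegative. *)
Lemma window_integral (x H S T : R) : 1 <= H -> H + 1 <= S -> S <= T ->
  ex_RInt (fun t => zeta_moment zeta k x (t + H) - zeta_moment zeta k x (t - H)) S T /\
  (RInt (fun t => zeta_moment zeta k x (t + H) - zeta_moment zeta k x (t - H)) S T <=
    2 * H * zeta_moment zeta k x (T + H)).
Proof.
  move=> HH HS HT; pose G := zeta_moment zeta k x.
  have eG a b : 1 <= a -> 1 <= b -> ex_RInt G a b.
    move=> Ha Hb; apply: (ex_RInt_contR) => z Hz.
    apply: continuous_zeta_moment; have : 1 <= Rmin a b by apply: Rmin_glb.
    lra.
  have cs (h t : R) : 0 < t + h -> continuous (fun t => G (t + h)) t.
    move=> Ht; apply: (continuous_comp (fun t => t + h) G).
      apply: continuousD; first exact: continuous_id.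
      exact: continuous_const.
    exact: continuous_zeta_moment.
  have e1 : ex_RInt (fun t => G (t + H)) S T by apply: ex_RInt_on => // t Ht; apply: cs; lra.
  have e2 : ex_RInt (fun t => G (t - H)) S T by apply: ex_RInt_on => // t Ht; apply: (cs (- H)); lra.
  split; first exact: (ex_RInt_minus (V := R_NormedModule)).
  have sh h : 1 <= S + h -> RInt (fun t => G (t + h)) S T = RInt G (S + h) (T + h).
    move=> Hh; rewrite -(RInt_shift G h S T); last by apply: eG; lra.
    by apply: RInt_extR => v; rewrite Rplus_comm.
  rewrite -/G RInt_Rminus // sh; last lra.
  have -> : RInt (fun t => G (t - H)) S T = RInt G (S - H) (T - H) by apply: (sh (- H)); lra.
  have C1 := RInt_ChaslesR G (S - H) (S + H) (T + H) (eG (S - H) (S + H) by_lra by_lra) (eG (S + H) (T + H) by_lra by_lra).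
  have C2 := RInt_ChaslesR G (S - H) (T - H) (T + H) (eG (S - H) (T - H) by_lra by_lra) (eG (T - H) (T + H) by_lra by_lra).
  have P1 : 0 <= RInt G (S - H) (S + H).
    apply: RInt_ge0; first lra.
      by move=> t Ht; apply: continuous_zeta_moment; lra.
    by move=> t Ht; apply: moment_ge0; lra.
  have P2 : RInt G (T - H) (T + H) <= 2 * H * G (T + H).
    have -> : 2 * H * G (T + H) = RInt (fun _ => G (T + H)) (T - H) (T + H).
      by rewrite RInt_const /scal /= /mult /=; ring.
    apply: RInt_le; [lra | by apply: eG; lra | exact: ex_RInt_const |].
    by move=> t Ht; apply: moment_incr; lra.
  lra.
Qed.

Lemma error_square (E : R -> C) (x H S T c e : R) : 1 <= H -> H + 1 <= S -> S <= T ->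
  con S T E ->
  (forall t, S <= t <= T ->
    Cmod (E t) <= 2 * RInt (fun v => c * Cmod (zeta (x, t + v)) ^ k) (- H) H + e) ->
  RInt (fun t => Cmod (E t) ^ 2) S T <=
  32 * c ^ 2 * H ^ 2 * zeta_moment zeta k x (T + H) + 2 * e ^ 2 * (T - S).
Proof.
  move=> HH HS HT cE HE.
  have [eW IW] := window_integral x H S T HH HS HT.
  pose h t := 16 * c ^ 2 * H * (zeta_moment zeta k x (t + H) - zeta_moment zeta k x (t - H)) + 2 * e ^ 2.
  have eh : ex_RInt h S T.
    apply: (ex_RInt_plus (V := R_NormedModule)); last exact: ex_RInt_const.
    exact: ex_RInt_Rscal.
  apply: (Rle_trans _ (RInt h S T)).
    apply: RInt_le => //.
      apply: ex_RInt_on => // t Ht.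
      apply: (continuous_ext (fun t => Cmod (E t) * Cmod (E t))); first by move=> y /=; ring.
      by apply: continuousM; apply: ctn_Cmod; apply: cE.
    move=> t Ht; have := HE t by_lra; have := window_bound x t H c HH by_lra.
    set I := RInt _ _ _; set D := _ - _; rewrite /h -/D => W X.
    have P : Cmod (E t) ^ 2 <= (2 * I + e) ^ 2 by apply: pow_incr; split => //; apply: Cmod_ge_0.
    (* Here [8 I^2] meets the factor [2 H] of [window_bound], giving [16 c^2 H]; integration in [t]
       contributes another [2 H]. *)
    have Q : (2 * I + e) ^ 2 <= 8 * I ^ 2 + 2 * e ^ 2 by have := pow2_ge_0 (2 * I - e); lra.
    lra.
  rewrite RInt_Rplus //; [|exact: ex_RInt_Rscal | exact: ex_RInt_const].
  rewrite RInt_Rscal // RInt_const.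
  have -> : scal (T - S) (2 * e ^ 2) = 2 * e ^ 2 * (T - S) by rewrite /scal /= /mult /=; ring.
  apply: Rplus_le_compat_r.
  have C0 : 0 <= 16 * c ^ 2 * H by apply: Rmult_le_pos; [have := pow2_ge_0 c; lra | lra].
  apply: Rle_trans (Rmult_le_compat_l _ _ _ C0 IW) _; right; ring.
Qed.

End Moments.

Lemma con_dir_poly (b : nat -> R) (N : nat) (S T : R) : S <= T -> con S T (dir_poly b N).
Proof.
  move=> HST.
  apply: (proj1 (CInt_big N (fun n t => (RtoC (b n) * cexp (0%R, (- (t * ln (INR n.+1)))%R))%C) S T HST _)).
  move=> n t _; apply: ctn_mult; first exact: ctn_const.
  apply: (holo_ctn cexp (fun t => (0%R, (- (t * ln (INR n.+1)))%R))).
    exact: (holo_cexp _ _ (holo_id _)).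
  apply: ctn_pair; first exact: continuous_const.
  by apply: derive_continuous; auto_derive.
Qed.

(** * A bound for the error with free parameters *)

Section Effective.
Variable zeta : C -> C.
Hypothesis Hzeta : is_riemann_zeta zeta.
Variable k : nat.
Hypothesis Hk : (0 < k)%nat.

(** The comparison with the Dirichlet polynomial is made on [[S, T]] only, since the contour must
    stay above height 5; the piece below [S] enters through its moment and through [S] times the
    main coefficient. The constant is fixed before [T], [H], [Y] and [S]. *)
Lemma effective_bound (sigma x0 d : R) : 1 / 2 <= x0 -> x0 < sigma < 1 -> 0 < d <= 1 / 2 ->
  exists A, 0 <= A /\ forall T H Y S, 1 <= H -> H + 5 <= S -> S <= T -> 1 <= Y ->
    3 * ln Y <= H ^ 2 ->
    12 * ((12 * (T + H + 3)) ^ k * exp (2 * ln Y + 4 - H ^ 2)) <= exp (- ((sigma - x0) * ln Y)) ->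
    Rabs (moment_error zeta k sigma T) <=
    A * (zeta_moment zeta k sigma S + S + H ^ 2 * T * exp (- ((sigma - x0) * ln Y)) +
      H ^ 2 * exp (- ((sigma - x0) * ln Y)) * zeta_moment zeta k x0 (T + H) +
      H ^ 2 * exp ((1 - sigma + 2 * d) * ln Y) ^ 2).
Proof.
  move=> Hx0 Hs Hd; pose eta := sigma - x0; have Heta : 0 < eta <= 1 by rewrite /eta; lra.
  have [K [HK HW]] := weight_bounds eta Heta.
  have [Kd [HKd Hdiv]] := divisor_fun_bound k d by_lra.
  have [B1 HB1] := divisor_sum_bound k (2 * sigma - eta) (ltac:(rewrite /eta; lra)).
  have B10 : 0 <= B1 by have := HB1 O; rewrite big_ord0.
  have mc0 : 0 <= mean_coeff k sigma.
    have HS := mean_coeff_series k sigma by_lra.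
    apply: Rle_trans (sum_n_le_is_series _ _ O _ HS).
      by rewrite sum_O; apply: Rmult_le_pos; [apply: pow2_ge_0 | exact: Rpower_ge0].
    by move=> n; apply: Rmult_le_pos; [apply: pow2_ge_0 | exact: Rpower_ge0].
  set mc := mean_coeff k sigma in mc0 *.
  pose P2 := (2 * PI) ^ 2.
  have HP2 : 1 <= P2 by rewrite /P2; have := PI2_3_2; nra.
  (* [C5] belongs to the diagonal, [C6] to the left side of the contour and [C7] to the off-diagonal
     terms. [C5] enters the final constant twice and [C7] is doubled, because the mean square of the
     polynomial is used both directly and, multiplied by [Ye], in the cross term. *)
  pose C5 := 9 * K ^ 2 * B1 + P2.
  have HC5 : 0 <= C5.
    by rewrite /C5; have : 0 <= K ^ 2 * B1 by [apply: Rmult_le_pos => //; apply: pow2_ge_0]; lra.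
  pose C6 := 64 * (exp 1 / eta) ^ 2.
  have HC6 : 0 <= C6 by rewrite /C6; have := pow2_ge_0 (exp 1 / eta); lra.
  pose C7 := 12 * (Kd * K * (1 + 2 / d)) ^ 2.
  have HC7 : 0 <= C7 by rewrite /C7; have := pow2_ge_0 (Kd * K * (1 + 2 / d)); lra.
  have P2mc : 0 <= P2 * mc by apply: Rmult_le_pos; lra.
  exists (P2 + P2 * mc + (P2 * mc + C5 + C5 + 16) + C6 + C7); split; first lra.
  move=> T H Y S HH HS HT HY HYH Hhor.
  have LY : 0 <= ln Y by rewrite -ln_1; apply: ln_le; lra.
  set Ye := exp (- ((sigma - x0) * ln Y)) in Hhor *.
  have Ye0 : 0 < Ye by apply: exp_pos.
  have Ye1 : Ye <= 1 by rewrite -exp_0; apply: exp_le; rewrite -/eta; nra.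
  (* With this accuracy of the truncated zeta, the third error term of [approx_formula] is exactly
     [Ye]. *)
  pose rho := Ye * exp (- (2 * ln Y + 4)) / (2 * H).
  have rho0 : 0 < rho.
    by apply: Rdiv_pos_pos; [apply: Rmult_lt_0_compat => //; apply: exp_pos | lra].
  have Erho : 2 * H * (rho * exp (2 * ln Y + 4)) = Ye.
    have -> : 2 * H * (rho * exp (2 * ln Y + 4)) = Ye * (exp (- (2 * ln Y + 4)) * exp (2 * ln Y + 4)).
      by rewrite /rho; field; lra.
    by rewrite -exp_plus Rplus_opp_l exp_0 Rmult_1_r.
  have [M1 HM1] := trunc_zeta_close zeta Hzeta k rho rho0.
  have [M2 HM2] := diagonal k sigma eta K B1 Hk by_lra HK
    (fun H u h1 h2 => conj (proj1 (HW H u h1 h2)) (proj1 (proj2 (HW H u h1 h2)))) HB1 Ye Ye0.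
  (* [M] depends on all parameters, which is harmless because no estimate below involves it. *)
  pose M := maxn M1 M2.
  have HM : forall s, 2 <= Re s -> Cmod (zeta s ^ k - trunc_zeta M s ^ k) <= rho.
    by apply: HM1; apply: leq_maxl.
  have Diag := HM2 M (leq_maxr _ _) H Y HH HYH.
  pose b := coef k M sigma H Y; pose N := (M ^ k)%nat.
  rewrite -/b -/N -/P2 -/mc -/Ye in Diag.
  pose p := 1 - sigma + 2 * d; pose V := Kd * K * H * exp (p * ln Y).
  have V0 : 0 <= V.
    by apply: Rmult_le_pos; [repeat apply: Rmult_le_pos; lra | exact: exp_ge0].
  have Hb : forall n, Rabs (b n) <= V * Rpower (INR n.+1) (- (1 + d)).
    apply: coef_bound => //; try lra.
    by move=> H' u h1 h2; exact: (proj2 (proj2 (HW H' u h1 h2))).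
  have MS := mean_square b V d by_lra Hb N S T HT.
  set D := \big[_/_]_(n < N) _ in Diag MS.
  set IP := RInt (fun t => Cmod (dir_poly b N t) ^ 2) S T in MS.
  pose f t := (RtoC (2 * PI) * zeta (sigma, t) ^ k)%C.
  have cf : con S T f.
    move=> t Ht; apply: ctn_mult; first exact: ctn_const.
    apply: (ctn_pow (fun t => zeta (sigma, t))); apply: (holo_ctn zeta (fun t => (sigma, t))).
      by apply: zeta_holo => //; apply: Im_neq1; rewrite /Im /=; lra.
    exact: ctn_vert.
  have cp := con_dir_poly b N S T HT.
  (* The weight [Ye] balances the two halves: the mean square of the difference is about [Ye^2]
     times that of the polynomial, up to small factors, so [Ye] times one and [2 / Ye] times the
     other have the same order. *)
  have Cmp := mean_square_compare f (dir_poly b N) S T Ye HT by_lra cf cp.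
  rewrite -/IP in Cmp.
  have Ef : (RInt (fun t => Cmod (f t) ^ 2) S T : R) =
      P2 * RInt (fun t => Cmod (zeta (sigma, t)) ^ (2 * k)%nat) S T.
    rewrite -RInt_Rscal; last by apply: ex_RInt_moment => //; lra.
    apply: RInt_extR => t; rewrite /f Cmod_mult Cmod_pow Cmod_R Rabs_pos_eq; last first.
      by have := PI_RGT_0; lra.
    by rewrite Rpow_mult_distr -pow_mult (mulnC 2%nat k).
  have HE : forall t, S <= t <= T -> Cmod (f t - dir_poly b N t) <=
      2 * RInt (fun v => exp 1 / eta * Ye * Cmod (zeta (x0, t + v)) ^ k) (- H) H + 2 * Ye.
    move=> t Ht.
    have X := approx_formula zeta Hzeta k M sigma eta t H Y rho (ltac:(rewrite /eta; lra)) by_lra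
      Heta HH by_lra HY by_lra HM.
    rewrite Erho in X.
    have E0 : sigma - eta = x0 by rewrite /eta; ring.
    rewrite E0 -/Ye in X.
    have Y1 : 12 * ((12 * (t + H + 3)) ^ k * exp (2 * ln Y + 4 - H ^ 2)) <= Ye.
      apply: Rle_trans Hhor; apply: Rmult_le_compat_l; first lra.
      apply: Rmult_le_compat_r; first exact: exp_ge0.
      by apply: pow_incr; lra.
    by move: X; rewrite -/b -/N -/(f t); lra.
  have ES := error_square zeta Hzeta k (fun t => f t - dir_poly b N t)%C x0 H S T
    (exp 1 / eta * Ye) (2 * Ye) HH by_lra HT (con_plus _ _ _ _ cf (con_opp _ _ _ cp)) HE.
  set IE := RInt (fun t => Cmod (f t - dir_poly b N t) ^ 2) S T in ES Cmp.
  set G := zeta_moment zeta k x0 (T + H) in ES *.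
  have G0 : 0 <= G by apply: moment_ge0 => //; lra.
  set m1 := zeta_moment zeta k sigma S.
  have m10 : 0 <= m1 by apply: moment_ge0 => //; lra.
  (* Telescoping from zeta to the polynomial, from the polynomial to its diagonal, and from the
     diagonal to the main coefficient, everything scaled by [P2 = (2 PI)^2]. *)
  have Split : P2 * moment_error zeta k sigma T = P2 * m1 + (P2 * RInt (fun t => Cmod (zeta (sigma, t)) ^ (2 * k)%nat) S T - IP)
     + (IP - (T - S) * D) + (T - S) * (D - P2 * mc) - S * (P2 * mc).
    have E : moment_error zeta k sigma T = m1 + RInt (fun t => Cmod (zeta (sigma, t)) ^ (2 * k)%nat) S T - T * mc.
      by rewrite /moment_error {1}/zeta_moment -(RInt_ChaslesR _ 1 S T) //; apply: ex_RInt_moment => //; lra.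
    by rewrite E; ring.
  rewrite -Ef in Split.
  set I1 := RInt (fun t => Cmod (f t) ^ 2) S T in Split Cmp.
  have H1 : 1 <= H ^ 2 by nra.
  have HYe : 0 <= H ^ 2 * Ye by apply: Rmult_le_pos; lra.
  have Dl : Rabs (D - P2 * mc) <= C5 * (H ^ 2 * Ye).
    apply: Rle_trans Diag _; rewrite -/eta.
    have : P2 * Ye <= P2 * (H ^ 2 * Ye) by apply: Rmult_le_compat_l; nra.
    rewrite /C5; lra.
  have Dl1 : D <= P2 * mc + C5 * H ^ 2.
    have : C5 * (H ^ 2 * Ye) <= C5 * H ^ 2 by apply: Rmult_le_compat_l => //; nra.
    have := Rle_abs (D - P2 * mc); lra.
  have Q1 : 6 * (V * (1 + 2 / d)) ^ 2 = C7 / 2 * (H ^ 2 * exp (p * ln Y) ^ 2).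
    by rewrite /V /C7; field; lra.
  rewrite Q1 in MS.
  set U := H ^ 2 * exp (p * ln Y) ^ 2 in MS.
  have U0 : 0 <= U by apply: Rmult_le_pos; apply: pow2_ge_0.
  have [MSa MSb] := proj1 (Rabs_le_between _ _) MS.
  have IPb : Ye * IP <= (P2 * mc + C5) * (H ^ 2 * T * Ye) + C7 / 2 * U.
    have TD : (T - S) * D <= T * (P2 * mc + C5 * H ^ 2).
      have X0 : 0 <= P2 * mc + C5 * H ^ 2 by have : 0 <= C5 * H ^ 2 by [apply: Rmult_le_pos; lra]; lra.
      apply: (Rle_trans _ ((T - S) * (P2 * mc + C5 * H ^ 2))); first by apply: Rmult_le_compat_l; lra.
      by apply: Rmult_le_compat_r; lra.
    have X1 : Ye * IP <= Ye * (T * (P2 * mc + C5 * H ^ 2)) + Ye * (C7 / 2 * U).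
      by rewrite -Rmult_plus_distr_l; apply: Rmult_le_compat_l; lra.
    have X2 : Ye * (C7 / 2 * U) <= 1 * (C7 / 2 * U).
      by apply: Rmult_le_compat_r => //; apply: Rmult_le_pos; lra.
    have X3 : Ye * T * (P2 * mc) * 1 <= Ye * T * (P2 * mc) * H ^ 2.
      by apply: Rmult_le_compat_l => //; apply: Rmult_le_pos => //; apply: Rmult_le_pos; lra.
    lra.
  have IEb : 2 / Ye * IE <= C6 * (H ^ 2 * Ye * G) + 16 * (H ^ 2 * T * Ye).
    have X1 : 2 / Ye * IE <= 2 / Ye * (32 * (exp 1 / eta * Ye) ^ 2 * H ^ 2 * G + 2 * (2 * Ye) ^ 2 * (T - S)).
      by apply: Rmult_le_compat_l => //; left; apply: Rdiv_pos_pos; lra.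
    apply: Rle_trans X1 _.
    have -> : 2 / Ye * (32 * (exp 1 / eta * Ye) ^ 2 * H ^ 2 * G + 2 * (2 * Ye) ^ 2 * (T - S)) =
      C6 * (H ^ 2 * Ye * G) + 16 * ((T - S) * Ye) by rewrite /C6; field; lra.
    have : (T - S) * Ye <= H ^ 2 * T * Ye; last lra.
    by apply: Rmult_le_compat_r; [lra | nra].
  have TDl : Rabs ((T - S) * (D - P2 * mc)) <= C5 * (H ^ 2 * T * Ye).
    rewrite Rabs_mult (Rabs_pos_eq (T - S)); last lra.
    apply: (Rle_trans _ (T * (C5 * (H ^ 2 * Ye)))); last by right; ring.
    by apply: Rmult_le_compat => //; [lra | apply: Rabs_pos | lra].
  have W1 : 0 <= H ^ 2 * T * Ye by apply: Rmult_le_pos; [apply: Rmult_le_pos |]; lra.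
  have W2 : 0 <= H ^ 2 * Ye * G by apply: Rmult_le_pos.
  have Fin : Rabs (P2 * moment_error zeta k sigma T) <=
      P2 * m1 + (P2 * mc + C5 + C5 + 16) * (H ^ 2 * T * Ye) + C6 * (H ^ 2 * Ye * G) + C7 * U + S * (P2 * mc).
    rewrite Split; move: Cmp TDl; rewrite -/IE -/I1 => /Rabs_le_between Cmp /Rabs_le_between TDl.
    have SP : 0 <= S * (P2 * mc) by apply: Rmult_le_pos; lra.
    have PM : 0 <= P2 * m1 by apply: Rmult_le_pos; lra.
    by apply/Rabs_le_between; lra.
  apply: (Rle_trans _ (Rabs (P2 * moment_error zeta k sigma T))).
    rewrite Rabs_mult (Rabs_pos_eq P2); last lra.
    by have := Rabs_pos (moment_error zeta k sigma T); nra.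
  apply: Rle_trans Fin _; rewrite -/p -/U.
  set c1 := P2 * mc + C5 + C5 + 16.
  have c10 : 0 <= c1 by rewrite /c1; lra.
  set A := P2 + P2 * mc + c1 + C6 + C7.
  have W c w : c <= A -> 0 <= w -> c * w <= A * w by move=> *; apply: Rmult_le_compat_r.
  have := W P2 m1; have := W (P2 * mc) S; have := W c1 (H ^ 2 * T * Ye).
  have := W C6 (H ^ 2 * Ye * G); have := W C7 U; rewrite /A => h5 h4 h3 h2 h1.
  have {}h1 := h1 by_lra m10; have {}h2 := h2 by_lra by_lra.
  have {}h3 := h3 by_lra W1; have {}h4 := h4 by_lra W2.
  have {}h5 := h5 by_lra U0.
  lra.
Qed.

(** * Inputs for the choice of parameters *)

Lemma ln_pow_bound (a : nat) (e : R) : 0 < e ->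
  exists B, 0 <= B /\ forall T, 1 <= T -> ln T ^ a <= B * Rpower T e.
Proof.
  (* From [log T <= T^c / c]; the denominator [a + 1] also covers [a = 0]. *)
  move=> He; pose c := e / INR a.+1.
  have Ha : 0 < INR a.+1 by apply: lt_0_INR; lia.
  have Hc : 0 < c by apply: Rdiv_pos_pos.
  exists ((/ c) ^ a); split; first by apply: pow_le; left; apply: Rinv_pos.
  move=> T HT; have L : 0 <= ln T by rewrite -ln_1; apply: ln_le; lra.
  have X : ln T <= / c * Rpower T c.
    apply: (Rmult_le_reg_l c) => //; rewrite -Rmult_assoc Rinv_r ?Rmult_1_l; try lra.
    by rewrite /Rpower; have := exp_ineq1_le (c * ln T); lra.
  apply: Rle_trans (pow_incr _ _ a (conj L X)) _; rewrite Rpow_mult_distr.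
  apply: Rmult_le_compat_l; first by apply: pow_le; left; apply: Rinv_pos.
  rewrite -Rpower_pow; last exact: Rpower_pos.
  rewrite Rpower_mult; apply: Rle_Rpower => //.
  have E : e = c * INR a.+1 by rewrite /c; field; lra.
  by rewrite [X in _ <= X]E; apply: Rmult_le_compat_l; [lra | rewrite S_INR; lra].
Qed.

(** A crude polynomial bound is enough: it will be applied at [S = log T + 5], where a power of [S]
    is a power of a logarithm. *)
Lemma small_moment (sigma : R) : 1 / 2 <= sigma <= 1 -> exists B, 0 <= B /\
  forall S, 5 <= S -> zeta_moment zeta k sigma S <= B * S ^ (2 * k).+1.
Proof.
  move=> Hs; have m5 := moment_ge0 zeta Hzeta k sigma 5 by_lra.
  have P24 : 0 <= 24 ^ (2 * k)%nat by apply: pow_le; lra.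
  exists (zeta_moment zeta k sigma 5 + 24 ^ (2 * k)%nat); split; first lra.
  move=> S HS; rewrite {1}/zeta_moment -(RInt_ChaslesR _ 1 5 S); try (apply: ex_RInt_moment => //; lra).
  rewrite -/(zeta_moment zeta k sigma 5) Rmult_plus_distr_r; apply: Rplus_le_compat.
    rewrite -[X in X <= _]Rmult_1_r; apply: Rmult_le_compat_l => //.
    by apply: pow_R1_Rle; lra.
  have Sp : 0 <= S ^ (2 * k)%nat by apply: pow_le; lra.
  apply: (Rle_trans _ (RInt (fun _ => (24 * S) ^ (2 * k)%nat) 5 S)); last first.
    rewrite RInt_const /scal /= /mult /= Rpow_mult_distr.
    have : 0 <= 24 ^ (2 * k)%nat * S ^ (2 * k)%nat by apply: Rmult_le_pos.
    nra.
  apply: RInt_le => //; [by apply: ex_RInt_moment => //; lra | exact: ex_RInt_const |].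
  move=> t Ht; apply: pow_incr; split; first exact: Cmod_ge_0.
  apply: Rle_trans (zeta_growth zeta Hzeta _ _ _) _; rewrite /Re /Im /=; try lra.
  have := Cmod_le_sum (sigma, t); rewrite /Re /Im /= !Rabs_pos_eq; lra.
Qed.

Lemma moment_admissible_2 : moment_admissible zeta k 2.
Proof.
  split; first lra; move=> eps He; exists (2 ^ (2 * k)%nat), 1 => T HT.
  have P : 0 <= 2 ^ (2 * k)%nat by apply: pow_le; lra.
  rewrite Rabs_pos_eq; last by apply: moment_ge0 => //; lra.
  apply: (Rle_trans _ (RInt (fun _ => 2 ^ (2 * k)%nat) 1 T)).
    apply: RInt_le; [lra | by apply: ex_RInt_moment => //; lra | exact: ex_RInt_const |].
    move=> t Ht; apply: pow_incr; split; first exact: Cmod_ge_0.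
    by apply: zeta_right_bound => //; rewrite /Re /=; lra.
  rewrite RInt_const /scal /= /mult /= Rmult_comm; apply: Rmult_le_compat_l => //.
  apply: (Rle_trans _ T); first lra.
  rewrite -{1}(Rpower_1 T); last lra.
  by apply: Rle_Rpower; lra.
Qed.

(** The point 2 is admissible and 1/2 is a lower bound, so the infimum is finite. Admissibility of
    the infimum itself is not known, which is why a nearby point is extracted. *)
Lemma sigma_star_approx (e : R) : 0 < e -> 1 / 2 <= sigma_star zeta k /\
  exists x, sigma_star zeta k <= x < sigma_star zeta k + e /\ moment_admissible zeta k x.
Proof.
  move=> He; rewrite /sigma_star.
  have [lb gr] := Glb_Rbar_correct (moment_admissible zeta k).
  have L : Rbar_le (1 / 2) (Glb_Rbar (moment_admissible zeta k)).
    by apply: gr => x [Hx _].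
  have U := lb 2 moment_admissible_2.
  case: (Glb_Rbar _) lb gr L U => [m| |] //= lb gr L U.
  split => //; apply: NNPP => N.
  have : Rbar_le (m + e) m.
    apply: gr => x Hx; rewrite /=; apply: Rnot_lt_le => Hlt; apply: N; exists x.
    by split => //; split => //; apply: (lb x Hx).
  by rewrite /=; lra.
Qed.

End Effective.

(* With mathcomp imported, [%nat] would make [<=] the boolean comparison. *)
Theorem theorem2 (zeta : C -> C) (Hzeta : is_riemann_zeta zeta)
  (k : nat) (Hk : (3 <= k)%coq_nat)
  (sigma : R) (Hsigma : sigma_star zeta k < sigma < 1) :
  forall eps : R, 0 < eps ->
    vinogradov (moment_error zeta k sigma)
      (fun T : R =>
         Rpower T (2 * (1 - sigma) / (2 - sigma_star zeta k - sigma) + eps)).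
Proof.
  move=> eps Heps.
  have Hk0 : (0 < k)%nat by apply: leq_trans (_ : 3 <= k)%nat => //; apply/leP.
  (* The first entry gives [x0 < sigma]; the second makes the passage from [sigma_star] to [x0] cost
     at most [eps / 2] in the exponent. *)
  have He : 0 < Rmin (sigma - sigma_star zeta k) (eps * (1 - sigma)).
    by apply: Rmin_pos; [lra | apply: Rmult_lt_0_compat; lra].
  have [Hst [x0 [Hx0 [_ Hadm]]]] := sigma_star_approx zeta Hzeta k _ He.
  have M1 := Rmin_l (sigma - sigma_star zeta k) (eps * (1 - sigma)).
  have M2 := Rmin_r (sigma - sigma_star zeta k) (eps * (1 - sigma)).
  set ss := sigma_star zeta k in Hsigma Hst Hx0 M1 M2 He *.
  pose nu := / (2 - x0 - sigma).
  have Hden : 0 < 2 - x0 - sigma by lra.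
  have Hnu : 0 < nu by apply: Rinv_pos.
  pose th := 2 * (1 - sigma) * nu.
  have Hth : 0 < th by apply: Rmult_lt_0_compat; lra.
  have Hth2 : th + eps / 2 <= 2 * (1 - sigma) / (2 - ss - sigma) + eps.
    have X : th - 2 * (1 - sigma) / (2 - ss - sigma) =
        2 * (1 - sigma) * (x0 - ss) / ((2 - x0 - sigma) * (2 - ss - sigma)).
      by rewrite /th /nu; field; lra.
    have Y : 2 * (1 - sigma) * (x0 - ss) / ((2 - x0 - sigma) * (2 - ss - sigma)) <= eps / 2.
      have P : 0 < (2 - x0 - sigma) * (2 - ss - sigma) by apply: Rmult_lt_0_compat; lra.
      apply: (Rmult_le_reg_r ((2 - x0 - sigma) * (2 - ss - sigma))) => //.
      have -> : 2 * (1 - sigma) * (x0 - ss) / ((2 - x0 - sigma) * (2 - ss - sigma)) *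
        ((2 - x0 - sigma) * (2 - ss - sigma)) = 2 * (1 - sigma) * (x0 - ss) by field; lra.
      (* Both [x0] and [ss] lie below [sigma], so each factor of the denominator exceeds
         [2 (1 - sigma)]; the exponents differ by at most [(x0 - ss) / (2 (1 - sigma))]. *)
      have Q : (2 * (1 - sigma)) * (2 * (1 - sigma)) <= (2 - x0 - sigma) * (2 - ss - sigma).
        by apply: Rmult_le_compat; lra.
      have Q2 : 2 * (1 - sigma) * (x0 - ss) <= 2 * (1 - sigma) * (eps * (1 - sigma)).
        by apply: Rmult_le_compat_l; lra.
      have : eps / 2 * ((2 * (1 - sigma)) * (2 * (1 - sigma))) <=
         eps / 2 * ((2 - x0 - sigma) * (2 - ss - sigma)) by apply: Rmult_le_compat_l; lra.
      lra.
    lra.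
  (* The balance equation: with [Y = T^nu], the quantities [T Y^(- (sigma - x0))] and
     [Y^(2 - 2 sigma)] are both [T^th]. *)
  have Enu1 : 1 - (sigma - x0) * nu = th by rewrite /th /nu; field; lra.
  (* The off-diagonal term has exponent [2 (1 - sigma + 2 d) nu = th + 4 d nu], so [4 d nu] has to
     be small. *)
  pose d := Rmin (1 / 2) (eps / (32 * nu)).
  have Hd0 : 0 < d by apply: Rmin_pos; [lra | apply: Rdiv_pos_pos; lra].
  have Hd1 : d <= 1 / 2 by apply: Rmin_l.
  have Hd2 : 4 * d * nu <= eps / 8.
    have : d <= eps / (32 * nu) by apply: Rmin_r.
    move=> X; have -> : eps / 8 = 4 * (eps / (32 * nu)) * nu by field; lra.
    by apply: Rmult_le_compat_r; lra.
  have [A [HA Eff]] := effective_bound zeta Hzeta k Hk0 sigma x0 d by_lra by_lra (conj Hd0 Hd1).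
  (* Of the [eps / 2] available beyond [th], at most [eps / 8] goes to powers of [log T], [eps / 8]
     to the moment hypothesis at [x0], and [eps / 8] to [4 d nu]. *)
  have [B1 [HB1 L1]] := ln_pow_bound (2 * k).+1 (eps / 8) by_lra.
  have [B2 [HB2 L2]] := ln_pow_bound 2 (eps / 8) by_lra.
  have [B3 [HB3 L3]] := ln_pow_bound 1 (eps / 8) by_lra.
  have [B4 [HB4 L4]] := small_moment zeta Hzeta k sigma by_lra.
  have [A5 [T5 L5]] := Hadm (eps / 8) by_lra.
  pose a0 := ln (12 * 60 ^ k) + 4.
  have P60 : 1 <= 60 ^ k by apply: pow_R1_Rle; lra.
  have a00 : 0 <= a0.
    by rewrite /a0; have : ln 1 <= ln (12 * 60 ^ k) by [apply: ln_le; lra]; rewrite ln_1; lra.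
  (* For [H >= h0] the square [H^2 >= h0 H] dominates everything it must: [a0] for the constants of
     the horizontal sides, [k H] for the growth of zeta, [2 nu H] for [Y^2] and one more [nu H] for
     the target [Y^(- (sigma - x0))]. It also gives [3 log Y <= H^2]. *)
  pose h0 := a0 + INR k + 3 * nu + 10.
  pose Csum := B4 * 6 ^ (2 * k).+1 * B1 + 6 * B3 + B2 + B2 * (Rabs A5 * Rpower 2 (1 + eps / 8)) + B2.
  pose Ctot := A * Csum.
  exists Ctot, (Rmax (exp h0) (Rmax T5 10)) => T HT.
  have HTh : exp h0 < T by apply: Rle_lt_trans HT; apply: Rmax_l.
  have HT5 : T5 < T.
    by apply: Rle_lt_trans HT; apply: Rle_trans (Rmax_r _ _); apply: Rmax_l.
  have HT10 : 10 < T.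
    by apply: Rle_lt_trans HT; apply: Rle_trans (Rmax_r _ _); apply: Rmax_r.
  pose H := ln T; pose Y := Rpower T nu; pose S := H + 5.
  have Hk1 := pos_INR k.
  have HH : h0 <= H by rewrite -(ln_exp h0); apply: ln_le; [apply: exp_pos | lra].
  have H10 : 10 <= H by apply: Rle_trans HH; rewrite /h0; lra.
  (* Written as [T = exp (H / 2) ^ 2]. It yields [S <= T], the bound [T + H <= 2 T] for the moment
     at [T + H], and the constant 60 on the horizontal sides. *)
  have HT2 : H <= T / 2.
    have E2 : 2 * (H / 2) = H by field.
    have : H <= exp (H / 2) * 2 by have := exp_ineq1_le (H / 2); lra.
    have ET : exp (H / 2) * exp (H / 2) = T.
      by rewrite -exp_plus; have -> : H / 2 + H / 2 = H; [field | rewrite /H exp_ln //; lra].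
    have E4 : 4 <= exp (H / 2) by have := exp_ineq1_le (H / 2); lra.
    nra.
  have LYe : ln Y = nu * H by rewrite /Y /Rpower ln_exp.
  have Tpos : 0 < T by lra.
  have EY (c : R) : exp (c * ln Y) = Rpower T (c * nu).
    by rewrite LYe /Rpower; congr exp; rewrite /H; ring.
  have EYn (c : R) : exp (- (c * ln Y)) = Rpower T (- (c * nu)).
    by rewrite LYe /Rpower; congr exp; rewrite /H; ring.
  have HY1 : 1 <= Y by apply: Rpower_ge1; lra.
  have HnuH : 0 <= nu * H by apply: Rmult_le_pos; lra.
  have HYH : 3 * ln Y <= H ^ 2.
    have : 3 * nu * H <= H * H by apply: Rmult_le_compat_r; [lra | rewrite /h0 in HH; lra].
    rewrite LYe; lra.
  have Hhor : 12 * ((12 * (T + H + 3)) ^ k * exp (2 * ln Y + 4 - H ^ 2)) <= exp (- ((sigma - x0) * ln Y)).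
    have X1 : (12 * (T + H + 3)) ^ k <= 60 ^ k * exp (INR k * H).
      have -> : exp (INR k * H) = T ^ k by rewrite -Rpower_pow.
      by rewrite -Rpow_mult_distr; apply: pow_incr; lra.
    have E12 : 12 * 60 ^ k = exp (a0 - 4).
      by have -> : a0 - 4 = ln (12 * 60 ^ k) by [rewrite /a0; ring]; rewrite exp_ln; lra.
    apply: (Rle_trans _ (12 * ((60 ^ k * exp (INR k * H)) * exp (2 * ln Y + 4 - H ^ 2)))).
      apply: Rmult_le_compat_l; first lra.
      by apply: Rmult_le_compat_r => //; exact: exp_ge0.
    have -> : 12 * (60 ^ k * exp (INR k * H) * exp (2 * ln Y + 4 - H ^ 2)) =
      exp (a0 - 4) * exp (INR k * H) * exp (2 * ln Y + 4 - H ^ 2) by rewrite -E12; ring.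
    rewrite -!exp_plus; apply: exp_le; rewrite LYe.
    have Q1 : h0 * H <= H * H by apply: Rmult_le_compat_r; lra.
    have Q2 : (sigma - x0) * (nu * H) <= 1 * (nu * H) by apply: Rmult_le_compat_r; lra.
    have Q3 : a0 * 1 <= a0 * H by apply: Rmult_le_compat_l; lra.
    rewrite /h0 in Q1; lra.
  have := Eff T H Y S by_lra (ltac:(rewrite /S; lra)) (ltac:(rewrite /S; lra)) HY1 HYH Hhor.
  rewrite EYn EY => Main.
  pose R0 := Rpower T (th + eps / 2).
  have mono e : e <= th + eps / 2 -> Rpower T e <= R0 by move=> X; apply: Rle_Rpower; lra.
  have HS6 : S <= 6 * H by rewrite /S; lra.
  have t1 : zeta_moment zeta k sigma S <= B4 * 6 ^ (2 * k).+1 * B1 * R0.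
    apply: Rle_trans (L4 S (ltac:(rewrite /S; lra))) _.
    have -> : B4 * 6 ^ (2 * k).+1 * B1 * R0 = B4 * (6 ^ (2 * k).+1 * (B1 * R0)) by ring.
    apply: Rmult_le_compat_l => //.
    apply: (Rle_trans _ ((6 * H) ^ (2 * k).+1)); first by apply: pow_incr; rewrite /S; lra.
    rewrite Rpow_mult_distr; apply: Rmult_le_compat_l; first by apply: pow_le; lra.
    apply: Rle_trans (L1 T by_lra) _; apply: Rmult_le_compat_l => //; apply: mono; lra.
  have t2 : S <= 6 * B3 * R0.
    apply: Rle_trans HS6 _; rewrite Rmult_assoc; apply: Rmult_le_compat_l; first lra.
    have := L3 T by_lra; rewrite pow_1 => X; apply: Rle_trans X _.
    by apply: Rmult_le_compat_l => //; apply: mono; lra.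
  have H2 := L2 T by_lra; rewrite -/H in H2.
  have t3 : H ^ 2 * T * Rpower T (- ((sigma - x0) * nu)) <= B2 * R0.
    apply: (Rle_trans _ (B2 * Rpower T (eps / 8) * T * Rpower T (- ((sigma - x0) * nu)))).
      apply: Rmult_le_compat_r; first exact: Rpower_ge0.
      by apply: Rmult_le_compat_r; lra.
    rewrite !Rmult_assoc; apply: Rmult_le_compat_l => //.
    rewrite -{2}(Rpower_1 T) // -!Rpower_plus; apply: mono; lra.
  have t4 : H ^ 2 * Rpower T (- ((sigma - x0) * nu)) * zeta_moment zeta k x0 (T + H) <=
      B2 * (Rabs A5 * Rpower 2 (1 + eps / 8)) * R0.
    have Z1 : zeta_moment zeta k x0 (T + H) <= Rabs A5 * (Rpower 2 (1 + eps / 8) * Rpower T (1 + eps / 8)).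
      apply: Rle_trans (Rle_abs _) _; apply: Rle_trans (L5 (T + H) by_lra) _.
      apply: (Rle_trans _ (Rabs A5 * Rpower (T + H) (1 + eps / 8))).
        by apply: Rmult_le_compat_r; [exact: Rpower_ge0 | apply: Rle_abs].
      apply: Rmult_le_compat_l; first exact: Rabs_pos.
      by rewrite -Rpower_prod; [apply: Rle_Rpower_l | |]; lra.
    have Z0 : 0 <= zeta_moment zeta k x0 (T + H) by apply: moment_ge0 => //; lra.
    apply: (Rle_trans _ ((B2 * Rpower T (eps / 8)) * Rpower T (- ((sigma - x0) * nu)) *
      (Rabs A5 * (Rpower 2 (1 + eps / 8) * Rpower T (1 + eps / 8))))).
      apply: Rmult_le_compat => //.
        by apply: Rmult_le_pos; [apply: pow2_ge_0 | exact: Rpower_ge0].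
      by apply: Rmult_le_compat_r => //; exact: Rpower_ge0.
    have -> : B2 * Rpower T (eps / 8) * Rpower T (- ((sigma - x0) * nu)) *
      (Rabs A5 * (Rpower 2 (1 + eps / 8) * Rpower T (1 + eps / 8))) =
      B2 * (Rabs A5 * Rpower 2 (1 + eps / 8)) *
      (Rpower T (eps / 8) * Rpower T (- ((sigma - x0) * nu)) * Rpower T (1 + eps / 8)) by ring.
    apply: Rmult_le_compat_l.
      by repeat apply: Rmult_le_pos => //; [apply: Rabs_pos | exact: Rpower_ge0].
    by rewrite -!Rpower_plus; apply: mono; lra.
  have t5 : H ^ 2 * Rpower T ((1 - sigma + 2 * d) * nu) ^ 2 <= B2 * R0.
    apply: (Rle_trans _ (B2 * Rpower T (eps / 8) * Rpower T ((1 - sigma + 2 * d) * nu) ^ 2)).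
      by apply: Rmult_le_compat_r => //; apply: pow2_ge_0.
    rewrite Rmult_assoc; apply: Rmult_le_compat_l => //.
    have -> : Rpower T (eps / 8) * Rpower T ((1 - sigma + 2 * d) * nu) ^ 2 =
      Rpower T (eps / 8) * (Rpower T ((1 - sigma + 2 * d) * nu) * Rpower T ((1 - sigma + 2 * d) * nu)) by ring.
    rewrite -!Rpower_plus; apply: mono; rewrite /th; lra.
  apply: Rle_trans Main _.
  apply: (Rle_trans _ (Ctot * R0)).
    have -> : Ctot * R0 = A * (Csum * R0) by rewrite /Ctot; ring.
    by apply: Rmult_le_compat_l => //; rewrite /Csum; lra.
  apply: Rmult_le_compat_l; last by apply: Rle_Rpower; lra.
  rewrite /Ctot; apply: Rmult_le_pos => //; rewrite /Csum.
  have Q6 : 0 <= 6 ^ (2 * k).+1 by apply: pow_le; lra.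
  have Q7 : 0 <= B4 * 6 ^ (2 * k).+1 * B1 by apply: Rmult_le_pos => //; apply: Rmult_le_pos.
  have Q8 : 0 <= B2 * (Rabs A5 * Rpower 2 (1 + eps / 8)).
    by repeat apply: Rmult_le_pos => //; [apply: Rabs_pos | exact: Rpower_ge0].
  lra.
Qed.
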